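(* Let $B$ be a norming region and let $(B_n)_{n\in\mathbb N}$ be an increasing sequence of finite subsets of $S$ with $B_n\uparrow S$. There are isomorphisms between the cones of all (1) $Q$-excessive measures $\nu$, (2) $P_h$-excessive measures $\mu$, (3) $P_h$-quasi-processes $\eta$, and (4) consistent entrance families $(\bar\mu_{B_n})_{n\in\mathbb N}$ for $Q$ along $(B_n)$, such that corresponding objects satisfy: (i) $\eta=\mathcal K^\nu|_{\{T_B=0\}}\circ[\cdot]^{-1}$; (ii) $\nu(x)=\mathbf 1_{B^c}(x)\frac{\mu(x)}{h(x)}+\sum_{z\in B}\mu(z)g(z,x)$ for all $x\in S$; (iii) $\mu$ is the occupation measure of $\eta$: $\mu(x)=\int\sum_{n\in\mathbb Z}\mathbf 1_{\{x\}}(w_n)\,\eta(d[(w_n)])$; (iv) $\bar\mu_{B_n}(x)=\mathcal K^\nu|_{\{T_{B_n}=0\}}(X_0=x)$ for all $n$, and $\bar\mu_{B_n}(x)=\frac1{h(x)}\eta(H_{B_n}=x)$ for all $n$ with $B\subset B_n$; (v) for all $n\in\mathbb N$, $\nu|_{B_n}=\bar\mu_{B_n}G|_{B_n\times B_n}$ and $\bar\mu_{B_n}=\nu|_{B_n}(\mathbb I-Q^{B_n})$.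
   Context: Setting: $S$ countable, $p=(p_{x,y})$ stochastic on $S$, $(d_x)_{x\in S}$ probability distributions on $\mathbb N_0$, $m_x=\sum_mm\,d_x(m)$, $q_{x,y}=m_xp_{x,y}$, $Q=(q_{x,y})$, $G=(g(x,y))=\sum_{n\ge0}Q^n$, assumed finite entrywise. For the branching Markov chain (each individual at $z$ independently has a $d_z$-distributed number of children at independent $p(z,\cdot)$-locations), $\mathcal H_B$ denotes the set of individuals located in $B$ with no strict ancestor in $B$, and $\mathbb E^x$ expectation from one individual at $x$. A norming region is a finite $B\subset S$ with $\sum_{y\in B}g(x,y)>0$ for all $x$; $h(x)=\mathbb E^x[\#\mathcal H_B]$. $P_h$: substochastic matrix $p^h_{x,y}=\mathbf 1_{B^c}(x)q_{x,y}h(y)/h(x)$, chain laws $P_h^x$ absorbed at $\partial$. A measure on $S$ finite at each point is $Q$-excessive if $\nu Q\le\nu$ pointwise, $P_h$-excessive if $\mu P_h\le\mu$ pointwise. $\nu^{\mathrm{pot}}=\nu-\nu Q$. $\mathcal Q^x_m$: measure on $S^{m+1}$ with $\mathcal Q^x_m(\{(x_0,\dots,x_m)\})=\mathbf 1_{\{x=x_0\}}q_{x_0,x_1}\cdots q_{x_{m-1},x_m}$. A consistent entrance family along $(B_n)$ is a family of finite measures $\bar\mu_{B_n}$ on $S$ with $\bar\mu_{B_n}(y)=\mathbf 1_{B_n}(y)\sum_{x\in S}\bar\mu_{B_{n+1}}(x)\sum_{m\ge0}\mathcal Q^x_m(X_m=y,\ X_0,\dots,X_{m-1}\notin B_n)$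 for all $n,y$. For finite $B'$, $Q^{B'}(x,y)=\sum_{n\ge1}\mathcal Q^x_n(T^*_{B'}=n,X_n=y)$ for $x,y\in B'$, where $T^*_{B'}$ is the first return time ($\ge1$) to $B'$; $G|_{B'\times B'}$ is the restriction of $G$; $\mathbb I$ the identity. $\mathcal W$: sequences $(x_n)_{n\in-\mathbb N_0}$ in $S\cup\{\partial\}$ with $x_n\in S\iff\alpha\le n$ for some $\alpha\in-\mathbb N_0\cup\{-\infty\}$. One-sided Kuznetsov measure $\mathcal K^\nu$: measure on $\mathcal W$ with $\mathcal K^\nu(\{(\dots,\partial,x_{-k},\dots,x_0)\})=\nu^{\mathrm{pot}}(x_{-k})q_{x_{-k},x_{-k+1}}\cdots q_{x_{-1},x_0}$ and $\mathcal K^\nu(X_{-k}=x_{-k},\dots,X_0=x_0)=\nu(x_{-k})q_{x_{-k},x_{-k+1}}\cdots q_{x_{-1},x_0}$. On $\mathcal W$, $T_{B'}=\min\{n\le0:X_n\in B'\}$ (first entrance time). Quasi-processes: $D$ = paths $w\in(S\cup\{\partial\})^{\mathbb Z}$ with $w_n\in S$ iff $t_\partial\le n<t^\partial$ for some $t_\partial<t^\partial$ in $\mathbb Z\cup\{\pm\infty\}$ and $w_n\to\partial$ as $n\to-\infty$; $D^*$ = $D$ modulo time shifts, $[\cdot]$ the projection (an element of $\mathcal W$ is embedded in $D$ by setting $w_n=\partial$ for $n>0$ and then projected). For finite $B'$, $D^*_{B'}$, $H_{B'}$ (first position in $B'$), $\pi_{B'}$ (path from first entrance in $B'$ onwards).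 A $P_h$-quasi-process is a measure $\eta$ on $D^*$ with $\eta(D^*_{B'})<\infty$ and $\eta|_{D^*_{B'}}(\pi_{B'}\in\cdot)=P_h^{\bar\mu}$ with $\bar\mu=\eta|_{D^*_{B'}}(H_{B'}\in\cdot)$, for every finite $B'$. *)

(* Defs.v *)
From HB Require Import structures.
From mathcomp Require Import all_boot all_order all_algebra.
From mathcomp Require Import all_classical all_reals all_analysis.

Set Implicit Arguments.
Unset Strict Implicit.
Unset Printing Implicit Defensive.

Import Order.TTheory GRing.Theory Num.Theory.

Local Open Scope classical_set_scope.
Local Open Scope ring_scope.
Local Open Scope ereal_scope.

Section BranchingMarkovDefs.
Context {R : realType} {S : countType}.

Definition stochastic (p : S -> S -> R) : Prop :=
  (forall x y, (0 <= p x y)%R) /\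
  (forall x, \esum_(y in [set: S]) (p x y)%:E = 1).

Definition nat_distribution (dx : nat -> R) : Prop :=
  (forall m, (0 <= dx m)%R) /\ \esum_(m in [set: nat]) (dx m)%:E = 1.

Definition mean_offspring (d : S -> nat -> R) (x : S) : \bar R :=
  \esum_(m in [set: nat]) (m%:R * d x m)%:E.

Definition qm (p : S -> S -> R) (d : S -> nat -> R) (x y : S) : \bar R :=
  mean_offspring d x * (p x y)%:E.

Fixpoint Qpow p d (n : nat) (x y : S) : \bar R :=
  match n with
  | 0%N => ((x == y)%:R)%:E
  | n'.+1 => \esum_(z in [set: S]) qm p d x z * Qpow p d n' z y
  end.

Definition gm p d (x y : S) : \bar R := \esum_(n in [set: nat]) Qpow p d n x y.

Fixpoint qchain p d (x : S) (t : seq S) : \bar R :=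
  match t with
  | [::] => 1
  | y :: t' => qm p d x y * qchain p d y t'
  end.

(** Q^x_m(A) for A a set of paths (x_0,...,x_m) (encoded as sequences of
    length m+1):  Q^x_m({(x_0..x_m)}) = 1_{x = x_0} q_{x_0,x_1} ... *)
Definition Qpath p d (x : S) (m : nat) (A : set (seq S)) : \bar R :=
  \esum_(t in [set t : seq S | size t = m /\ A (x :: t)]) qchain p d x t.

Definition entrance p d (B' : set S) (x y : S) : \bar R :=
  \esum_(m in [set: nat])
    Qpath p d x m [set s | nth x s m = y /\
                           forall i, (i < m)%N -> ~ B' (nth x s i)].

Definition Qreturn p d (B' : set S) (x y : S) : \bar R :=
  \esum_(n in [set n : nat | (0 < n)%N])
    Qpath p d x n [set s | B' (nth x s n) /\ nth x s n = y /\
                           forall i, (0 < i < n)%N -> ~ B' (nth x s i)].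

Definition measK (mu : S -> R) (K : S -> S -> \bar R) (y : S) : \bar R :=
  \esum_(x in [set: S]) (mu x)%:E * K x y.

Definition Q_excessive p d (nu : S -> R) : Prop :=
  (forall x, (0 <= nu x)%R) /\ (forall y, measK nu (qm p d) y <= (nu y)%:E).

Definition nu_pot p d (nu : S -> R) (x : S) : \bar R :=
  (nu x)%:E - measK nu (qm p d) x.

(** * The branching Markov chain (Ulam--Harris labels).
    An individual is a label u : seq nat; the i-th child of u is (i :: u),
    so the strict ancestors of u are the (drop j u), 0 < j <= size u.
    Nf u w = number of children of u, Xf u w = position of u. *)

Fixpoint alive (N : seq nat -> nat) (u : seq nat) : bool :=
  match u with
  | [::] => true
  | i :: u' => alive N u' && (i < N u')%N
  end.

Fixpoint generation (N : seq nat -> nat) (k : nat) : seq (seq nat) :=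
  match k with
  | 0%N => [:: [::]]
  | k'.+1 => flatten [seq [seq i :: u | i <- iota 0 (N u)] | u <- generation N k']
  end.

Definition bmc_event {dO} {O : measurableType dO}
  (Nf : seq nat -> O -> nat) (Xf : seq nat -> O -> S)
  (k : nat) (n : seq nat -> nat) (xs : seq nat -> S) : set O :=
  [set w | (forall u, alive (Nf^~ w) u -> (size u < k)%N -> Nf u w = n u) /\
           (forall u, alive (Nf^~ w) u -> (size u <= k)%N -> Xf u w = xs u)].

(** (Nf, Xf) under P is the branching Markov chain started from one
    individual at x: its law up to every generation k is the one of the
    model (offspring of an individual at z ~ d_z, children placed
    independently according to p(z, .)). *)
Definition is_BMC (p : S -> S -> R) (d : S -> nat -> R) {dO} {O : measurableType dO} (P : probability O R)
  (Nf : seq nat -> O -> nat) (Xf : seq nat -> O -> S) (x : S) : Prop :=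
  (forall u m, measurable [set w | Nf u w = m]) /\
  (forall u y, measurable [set w | Xf u w = y]) /\
  (forall k n xs,
     P (bmc_event Nf Xf k n xs) =
     (((xs [::] == x)%:R *
       \prod_(j < k) \prod_(u <- generation n j)
          (d (xs u) (n u) * \prod_(0 <= i < n u) p (xs u) (xs (i :: u))))%R)%:E).

Definition numH {dO} {O : measurableType dO}
  (Nf : seq nat -> O -> nat) (Xf : seq nat -> O -> S) (B : set S) (w : O)
  : \bar R :=
  \esum_(u in [set u : seq nat | alive (Nf^~ w) u /\ B (Xf u w) /\
            forall j, (0 < j <= size u)%N -> ~ B (Xf (drop j u) w)]) 1.

Definition hfun {dO} {O : measurableType dO} (P : S -> probability O R)
  (Nf : seq nat -> O -> nat) (Xf : seq nat -> O -> S) (B : set S) (x : S)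
  : \bar R :=
  \int[P x]_w numH Nf Xf B w.

Definition norming_region p d (B : set S) : Prop :=
  finite_set B /\ forall x, 0 < \esum_(y in B) gm p d x y.

Definition ph p d (B : set S) (h : S -> \bar R) (x y : S) : \bar R :=
  if `[< B x >] then 0 else qm p d x y * (fine (h y) / fine (h x))%:E.

Definition Ph_excessive p d B h (mu : S -> R) : Prop :=
  (forall x, (0 <= mu x)%R) /\ (forall y, measK mu (ph p d B h) y <= (mu y)%:E).

Definition consistent_entrance_family p d (Bn : nat -> set S)
  (mb : nat -> S -> R) : Prop :=
  (forall n x, (0 <= mb n x)%R) /\
  (forall n, \esum_(x in [set: S]) (mb n x)%:E < +oo) /\
  (forall n y, (mb n y)%:E =
     (\1_(Bn n) y)%:E *
     \esum_(x in [set: S]) (mb n.+1 x)%:E * entrance p d (Bn n) x y).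

(** * One-sided paths W: w k = X_{-k} (None = cemetery) *)
Definition inW (w : nat -> option S) : Prop :=
  w 0%N <> None /\ forall k, w k = None -> w k.+1 = None.

Definition Wcyl (ys : seq (option S)) : set (nat -> option S) :=
  [set w | forall i, (i < size ys)%N -> w i = nth None ys i].

Definition Wgen : set (set (nat -> option S)) := [set A | exists ys, A = Wcyl ys].

(** measurable space carrying W (measures are required to vanish off W) *)
Definition Wspace := g_sigma_algebraType Wgen.

Definition is_Kuznetsov p d (nu : S -> R) (K : {measure set Wspace -> \bar R})
  : Prop :=
  K (~` inW) = 0 /\
  (forall (x : S) (r : seq S),
     K [set w | inW w /\ forall i, w i = nth None (map Some (rev (x :: r))) i]
     = nu_pot p d nu x * qchain p d x r) /\
  (forall (x : S) (r : seq S),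
     K [set w | inW w /\ forall i, (i <= size r)%N ->
                  w i = Some (nth x (rev (x :: r)) i)]
     = (nu x)%:E * qchain p d x r).

Definition TB0 (B' : set S) : set Wspace :=
  [set w | inW w /\ (exists x, w 0%N = Some x /\ B' x) /\
           forall k, (0 < k)%N -> forall x, w k = Some x -> ~ B' x].

Definition inD (w : int -> option S) : Prop :=
  (exists n, w n <> None) /\
  (forall a b c : int, (a <= b <= c)%R -> w a <> None -> w c <> None -> w b <> None) /\
  (forall F : set S, finite_set F ->
     exists N : int, forall n : int, (n <= N)%R -> forall x, w n = Some x -> ~ F x).

Definition shift_equiv (w w' : int -> option S) : Prop :=
  exists t : int, forall n, w' n = w (n + t)%R.

Definition dclass (w : int -> option S) : set (int -> option S) :=
  [set w' | shift_equiv w w'].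

Definition Dstar : set (set (int -> option S)) :=
  [set C | exists w, inD w /\ C = dclass w].

Definition first_entrance (B' : set S) (w : int -> option S) (n : int) : Prop :=
  (exists x, w n = Some x /\ B' x) /\
  forall m : int, (m < n)%R -> forall x, w m = Some x -> ~ B' x.

Definition DstarB (B' : set S) : set (set (int -> option S)) :=
  [set C | Dstar C /\ exists w, C w /\ exists n x, w n = Some x /\ B' x].

Definition H_is (B' : set S) (x : S) : set (set (int -> option S)) :=
  [set C | Dstar C /\ exists w n, C w /\ first_entrance B' w n /\ w n = Some x].

Definition pi_cyl (B' : set S) (ys : seq (option S)) : set (set (int -> option S)) :=
  [set C | Dstar C /\ exists w n, C w /\ first_entrance B' w n /\
     forall i, (i < size ys)%N -> w (n + i%:Z)%R = nth None ys i].

Definition Dgen : set (set (set (int -> option S))) :=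
  [set A | exists B' ys, finite_set B' /\ A = pi_cyl B' ys].

(** measurable space carrying D^* (measures are required to vanish off D^* ) *)
Definition Dspace := g_sigma_algebraType Dgen.

Definition Kext (K : S -> S -> \bar R) (a b : option S) : \bar R :=
  match a, b with
  | Some x, Some y => K x y
  | Some x, None => 1 - \esum_(y in [set: S]) K x y
  | None, None => 1
  | None, Some _ => 0
  end.

Fixpoint chainw (K : option S -> option S -> \bar R) (a : option S)
  (s : seq (option S)) : \bar R :=
  match s with
  | [::] => 1
  | b :: s' => K a b * chainw K b s'
  end.

Definition markov_cyl (mu0 : S -> \bar R) (K : S -> S -> \bar R)
  (ys : seq (option S)) : \bar R :=
  match ys with
  | [::] => \esum_(x in [set: S]) mu0 x
  | Some x :: s => mu0 x * chainw (Kext K) (Some x) s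
  | None :: _ => 0
  end.

Definition quasi_process (K : S -> S -> \bar R) (eta : {measure set Dspace -> \bar R})
  : Prop :=
  eta (~` Dstar) = 0 /\
  forall B' : set S, finite_set B' ->
    eta (DstarB B') < +oo /\
    forall ys, eta (pi_cyl B' ys) = markov_cyl (fun x => eta (H_is B' x)) K ys.

Definition embW (w : nat -> option S) : int -> option S :=
  fun n => if (n <= 0)%R then w (absz n) else None.

Definition proj_preimage (A : set Dspace) : set Wspace :=
  [set w | inD (embW w) /\ A (dclass (embW w))].

Definition occupation (x : S) (C : Dspace) : \bar R :=
  \esum_(n in [set n : int | xget point C n = Some x]) 1.

Definition cone_iso {A B : Type} (CA : set A) (CB : set B)
  (eqB : B -> B -> Prop) (addA : A -> A -> A) (scaleA : R -> A -> A)
  (is_sum : B -> B -> B -> Prop) (is_scale : R -> B -> B -> Prop)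
  (F : A -> B) : Prop :=
  (forall a, CA a -> CB (F a)) /\
  (forall a1 a2, CA a1 -> CA a2 -> eqB (F a1) (F a2) -> a1 = a2) /\
  (forall b, CB b -> exists2 a, CA a & eqB (F a) b) /\
  (forall a1 a2, CA a1 -> CA a2 -> is_sum (F a1) (F a2) (F (addA a1 a2))) /\
  (forall c a, (0 <= c)%R -> CA a -> is_scale c (F a) (F (scaleA c a))).

End BranchingMarkovDefs.

(* Main.v *)
(** Many-to-one: [h x] is the total q-weight [hitting B x] of the paths from x stopped on
    first hitting B.

    For finite B, let [escape B nu x] be the mass that the Kuznetsov measure of nu gives to the
    paths that are at x at time 0 and whose strict past avoids B.  Cutting a path at its first
    entrance into B gives [nu x = 1_(x notin B) escape B nu x + sum_(z in B) escape B nu z g(z,x)],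
    and cutting it at its last previous visit to B gives
    [escape B nu = nu - sum_(z in B) nu z (taboo Green function)]; the two formulas are inverse to
    each other.  The three objects attached to nu are then [mu = h . escape B nu],
    [mb_n = escape (B_n) nu] restricted to [B_n], and the image eta of the Kuznetsov measure on
    [{T_B = 0}], for which [eta (H_B' = x) = h x . escape (B `|` B') nu x] on B'.

    A consistent family determines nu through [nu = mb_n G] on [B_n]; dividing the entrance laws
    of a quasi-process by h gives a consistent family along [B `|` B_n], and these entrance laws
    determine the quasi-process.  The Kuznetsov measure itself is built from the Markov chain
    with the nu-reversed kernel, killed at rate [nu_pot / nu]. *)

Require Import Defs.
From HB Require Import structures.
From mathcomp Require Import all_boot all_order all_algebra.
From mathcomp Require Import all_classical all_reals all_analysis.
From mathcomp Require Import measurable_realfun zify.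

Set Implicit Arguments.
Unset Strict Implicit.
Unset Printing Implicit Defensive.

Import Order.TTheory GRing.Theory Num.Theory.
Local Open Scope classical_set_scope.
Local Open Scope ring_scope.
Local Open Scope ereal_scope.

(** * Sums and measures on countable spaces *)

Section esum_extra.
Context {R : realType}.

(** Finiteness of [gm] bounds [taboo], [entrance] and [qm], and finiteness of B turns the balayage
    formulas into finite sums; so they are inverted in the reals, where subtraction is harmless. Two
    facts are not algebraic in this way. The sign of [escape] is invisible in its formula and is
    read off its meaning as a Kuznetsov mass, which is why the Kuznetsov measure is built before
    balayage. And a one-sided path represents an element of [Dstar] only if it leaves every finite
    set backwards in time; this holds almost everywhere by Borel-Cantelli, because the expected
    numbers of visits are entries of G. Both the Kuznetsov measure and the quasi-process may have
    infinite mass, so each uniqueness proof needs a cover by sets of finite mass: the position at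
    time 0 in the first case, the classes that meet [Bn n] in the second. Finally, the h-transform
    telescopes only along paths that stay off B before their end, while the given sets need not
    contain B; hence the passage to the unions of B with [Bn n]. *)

Lemma esum_bij (T T' : choiceType) (P : set T) (Q : set T') (e : T -> T')
    (e' : T' -> T) (a : T' -> \bar R) :
  (forall x, P x -> Q (e x)) -> (forall y, Q y -> P (e' y)) ->
  (forall x, P x -> e' (e x) = x) -> (forall y, Q y -> e (e' y) = y) ->
  \esum_(j in Q) a j = \esum_(i in P) a (e i).
Proof.
move=> PQ QP eK e'K; apply: reindex_esum; split.
- by move=> x /PQ.
- by move=> x y /[!inE] Px Py exy; rewrite -(eK _ Px) -(eK _ Py) exy.
- by move=> y Qy; exists (e' y); [exact: QP|exact: e'K].
Qed.

Lemma esumZl (T : choiceType) (P : set T) (c : \bar R) (a : T -> \bar R) :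
  0 <= c -> (forall i, P i -> 0 <= a i) ->
  \esum_(i in P) (c * a i) = c * \esum_(i in P) a i.
Proof.
move=> c0 a0.
have finE (X : set T) : finite_set X -> X `<=` P ->
    \sum_(i \in X) (c * a i) = c * \sum_(i \in X) a i.
  move=> finX XP; rewrite !fsbig_finite//= big_seq [in RHS]big_seq ge0_sume_distrr// => i.
  by rewrite in_fset_set// inE => /XP/a0.
apply/eqP; rewrite eq_le; apply/andP; split.
  apply: ge_ereal_sup => _ [X [finX XP] <-].
  rewrite finE//; apply: lee_wpmul2l => //.
  by apply: esum_ge; exists X.
have ca0 : 0 <= \esum_(i in P) (c * a i).
  by apply: esum_ge0 => i Pi; rewrite mule_ge0// a0.
case: c c0 finE ca0 => [r| |//] c0 finE ca0.
- have [->|r0] := eqVneq r 0%R; first by rewrite mul0e esum1// => i _; rewrite mul0e.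
  have {}r0 : (0 < r)%R by rewrite lt_neqAle eq_sym r0.
  rewrite -lee_pdivlMl//; apply: ge_ereal_sup => _ [X [finX XP] <-].
  rewrite lee_pdivlMl// -finE//; apply: esum_ge; exists X => //.
(* For [c = +oo] and a nonzero sum, some finite partial sum is already positive, and [+oo] times
   that one is the top. *)
- have [->|an0] := eqVneq (\esum_(i in P) a i) 0; first by rewrite mule0.
  have : 0 < \esum_(i in P) a i by rewrite lt_neqAle eq_sym an0 esum_ge0.
  move=> /ereal_sup_gt[_ [X [finX XP] <-] X0].
  apply: esum_ge; exists X => //; rewrite finE//.
  by rewrite [leRHS]gt0_mulye ?leey.
Qed.

Lemma esumZr (T : choiceType) (P : set T) (c : \bar R) (a : T -> \bar R) :
  0 <= c -> (forall i, P i -> 0 <= a i) ->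
  \esum_(i in P) (a i * c) = (\esum_(i in P) a i) * c.
Proof.
move=> c0 a0; rewrite muleC -esumZl//; apply: eq_esum => i _; exact: muleC.
Qed.

Lemma esum_swap (T T' : choiceType) (P : set T) (Q : set T')
    (a : T -> T' -> \bar R) :
  (forall i j, P i -> Q j -> 0 <= a i j) ->
  \esum_(i in P) \esum_(j in Q) a i j = \esum_(j in Q) \esum_(i in P) a i j.
Proof.
move=> a0; rewrite !esum_esum//; last by move=> *; exact: a0.
by apply: (esum_bij (e := fun x => (x.2, x.1)) (e' := fun x => (x.2, x.1))) => [[]|[]|[]|[]] //= ? ? [].
Qed.

Lemma le_esum_subset (T : choiceType) (P Q : set T) (a : T -> \bar R) :
  P `<=` Q -> \esum_(i in P) a i <= \esum_(i in Q) a i.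
Proof.
move=> PQ; apply: ge_ereal_sup => _ [X [finX XP] <-].
by apply: esum_ge; exists X => //; split => //; exact: subset_trans PQ.
Qed.

Lemma esum_ge_term (T : choiceType) (P : set T) (a : T -> \bar R) x :
  P x -> a x <= \esum_(i in P) a i.
Proof.
move=> Px; apply: esum_ge; exists [set x]; last by rewrite fsbig_set1.
by split=> // y ->.
Qed.

Lemma esum_fiber (T T' : choiceType) (P : set T) (Q : set T') (f : T -> T')
    (a : T -> \bar R) :
  (forall x, P x -> Q (f x)) -> (forall x, P x -> 0 <= a x) ->
  \esum_(i in P) a i = \esum_(y in Q) \esum_(i in [set i | P i /\ f i = y]) a i.
Proof.
move=> PQ a0; rewrite esum_esum; last by move=> i j _ [/a0].
apply/esym.
apply: (esum_bij (e := fun x => (f x, x)) (e' := fun x => x.2)) => //=.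
- by move=> x Px; split => //=; exact: PQ.
- by move=> [y x] [_ []].
- by move=> [y x] [_ [/= _ ->]].
Qed.

Lemma esum_single (T : choiceType) (P : set T) (x : T) (a : T -> \bar R) :
  P x -> 0 <= a x -> (forall y, P y -> y <> x -> a y = 0) ->
  \esum_(i in P) a i = a x.
Proof.
move=> Px ax0 a0; rewrite (esumID [set x]).
- rewrite [X in _ + X]esum1 ?adde0; last by move=> y [Py]; exact: a0.
  rewrite (_ : P `&` [set x] = [set x]) ?esum_set1//.
  by apply/seteqP; split=> [y []//|y ->].
- by move=> y Py; have [->//|/a0->] := pselect (y = x).
Qed.

Lemma esum_fin (T : choiceType) (P : set T) (a : T -> \bar R) : finite_set P ->
  (forall i, P i -> 0 <= a i) -> (forall i, P i -> a i < +oo) ->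
  \esum_(i in P) a i < +oo.
Proof.
move=> finP a0 aoo; rewrite esum_fset//; last by move=> i /[!inE]/a0.
rewrite fsbig_finite//= big_seq lte_sum_pinfty// => i.
by rewrite in_fset_set// inE => /aoo.
Qed.

Lemma esum_eq0 (T : choiceType) (P : set T) (a : T -> \bar R) :
  (forall i, P i -> 0 <= a i) -> \esum_(i in P) a i = 0 ->
  forall i, P i -> a i = 0.
Proof.
move=> a0 e0 i Pi; apply/eqP; rewrite eq_le a0// andbT -e0.
exact: esum_ge_term.
Qed.

End esum_extra.

(** * Measures and integrals over countable index sets *)

Section countable_measure.
Context d (T : measurableType d) (R : realType) (mu : {measure set T -> \bar R}).

Lemma bigcup_countType_measurable (I : countType) (P : set I) (F : I -> set T) :
  (forall i, P i -> measurable (F i)) -> measurable (\bigcup_(i in P) F i).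
Proof.
move=> mF; rewrite bigcup_mkcond; apply: countable_bigcupT_measurable; first exact: countableP.
move=> i.
by case: ifPn => // /[!inE]; exact: mF.
Qed.

Lemma bigcap_countType_measurable (I : countType) (P : set I) (F : I -> set T) :
  (forall i, P i -> measurable (F i)) -> measurable (\bigcap_(i in P) F i).
Proof.
move=> mF; rewrite -[X in measurable X]setCK setC_bigcap; apply: measurableC.
by apply: bigcup_countType_measurable => i /mF; exact: measurableC.
Qed.

Lemma measure_bigcup_esum (I : countType) (P : set I) (F : I -> set T) :
  (forall i, P i -> measurable (F i)) -> trivIset P F ->
  mu (\bigcup_(i in P) F i) = \esum_(i in P) mu (F i).
Proof.
move=> mF tF.
pose D := [set n : nat | exists2 i, P i & pickle i = n].
pose G n := if pickle_inv n is Some i then F i else set0.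
have GE i : G (pickle i) = F i by rewrite /G pickleK_inv.
have -> : \bigcup_(i in P) F i = \bigcup_(n in D) G n.
  apply/seteqP; split=> [w [i Pi Fi]|w [_ [i Pi <-]]].
    by exists (pickle i); [exists i|rewrite GE].
  by rewrite GE => Fi; exists i.
rewrite measure_bigcup.
- rewrite nneseries_esum// [in LHS](_ : [set x | x \in D] = D); last first.
    by apply/seteqP; split => x /=; rewrite inE.
  rewrite (_ : D = pickle @` P); last first.
    by apply/seteqP; split => [_ [i Pi <-]|_ [i Pi <-]]; exists i.
  rewrite esum_image; first by apply: eq_esum => i _; rewrite GE.
  by move=> x y _ _; exact: (pcan_inj pickleK).
- by move=> _ [i Pi <-]; rewrite GE; exact: mF.
- move=> _ _ [i Pi <-] [j Pj <-]; rewrite !GE => Fij.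
  by congr pickle; exact: tF Fij.
Qed.

Lemma measure0_bigcup (I : countType) (P : set I) (F : I -> set T) :
  (forall i, P i -> measurable (F i)) -> (forall i, P i -> mu (F i) = 0) ->
  mu (\bigcup_(i in P) F i) = 0.
Proof.
move=> mF F0; rewrite bigcup_mkcond.
pose G n := if pickle_inv n is Some i then (if i \in P then F i else set0) else set0.
have -> : \bigcup_i (if i \in P then F i else set0) = \bigcup_n G n.
  apply/seteqP; split=> [w [i _ Fi]|w [n _]].
    by exists (pickle i) => //; rewrite /G pickleK_inv.
  by rewrite /G; case: pickle_inv => // i Fi; exists i.
have mG n : measurable (G n).
  rewrite /G; case: pickle_inv => // i; case: ifPn => // /[!inE]; exact: mF.
apply/eqP; rewrite eq_le measure_ge0 andbT.
apply: le_trans (measure_sigma_subadditive mu mG _ _) _ => //.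
  exact: bigcupT_measurable.
rewrite eseries0// => n _ _; rewrite /G; case: pickle_inv => [i|]; last by rewrite measure0.
by case: ifPn => [/[!inE]/F0//|_]; rewrite measure0.
Qed.

Lemma measureI_null (A N : set T) : measurable A -> measurable N ->
  mu N = 0 -> mu (A `&` ~` N) = mu A.
Proof.
move=> mA mN N0; apply/eqP; rewrite eq_le; apply/andP; split.
  by apply: le_measure; rewrite ?inE//; apply: measurableI => //; exact: measurableC.
rewrite -[leRHS]adde0 -N0 -measureU//; first last.
- by apply/seteqP; split => [x [[_ nN] /nN]|].
- by apply: measurableI => //; exact: measurableC.
apply: le_measure; rewrite ?inE//.
  by apply: measurableU => //; apply: measurableI => //; exact: measurableC.
by move=> x Ax; have [|] := pselect (N x); [right|left].
Qed.

(** Meant for maps [f] that record a finite amount of discrete data: measurability is only asked of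
    the fibres inside [A], and [A] is their countable union. *)
Lemma measure_partition (I : countType) (f : T -> I) (A : set T) :
  (forall c, measurable (A `&` [set w | f w = c])) ->
  mu A = \esum_(c in [set: I]) mu (A `&` [set w | f w = c]).
Proof.
move=> mA; rewrite -measure_bigcup_esum//.
- by congr (mu _); apply/seteqP; split=> [w Aw|w [c _ []]//]; exists (f w).
- by move=> c c' _ _ [w [[_ <-] [_ <-]]].
Qed.

Lemma integral_esum_indic (I : countType) (F : I -> set T) :
  (forall i, measurable (F i)) ->
  \int[mu]_w (\esum_(i in [set i | F i w]) 1) = \esum_(i in [set: I]) mu (F i).
Proof.
move=> mF.
pose G n := if pickle_inv n is Some i then F i else set0.
have mG n : measurable (G n) by rewrite /G; case: pickle_inv.
have GE i : G (pickle i) = F i by rewrite /G pickleK_inv.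
have imgE (a : nat -> \bar R) : (forall n, 0 <= a n) ->
    (forall n, pickle_inv n = None :> option I -> a n = 0) ->
    \sum_(n <oo) a n = \esum_(i in [set: I]) a (pickle i).
  move=> a0 aN; rewrite nneseries_esumT// -(esum_image setT (@pickle I)); last first.
    by move=> x y _ _; exact: (pcan_inj pickleK).
  rewrite (esumID (pickle @` [set: I])) ?setTI//.
  rewrite [X in _ + X]esum1 ?adde0// => n nI.
  apply: aN; case e : (pickle_inv n) => [i|//]; case: nI; exists i => //.
  by have := @pickle_invK I n; rewrite /= /oapp e.
under eq_integral => w _.
  rewrite (_ : \esum_(i in _) _ = \sum_(n <oo) (\1_(G n) w)%:E); last first.
    rewrite imgE//; last by move=> n e; rewrite /G e indicE in_set0.
    rewrite esum_mkcond; apply: eq_esum => i _; rewrite GE indicE.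
    have -> : (i \in [set i | F i w]) = (w \in F i) by apply/idP/idP; rewrite !inE.
    by case: (w \in F i).
  over.
rewrite integral_nneseries//; last first.
  by move=> n; apply/measurable_EFinP; exact: measurable_indic.
under eq_eseriesr => n _ do rewrite integral_indic// setIT.
rewrite imgE//; first by apply: eq_esum => i _; rewrite GE.
by move=> n e; rewrite /G e measure0.
Qed.

End countable_measure.

Section esum_products.
Context {R : realType}.

Lemma esum_setbij (T T' : choiceType) (P : set T) (Q : set T') (e : T -> T')
    (a : T' -> \bar R) :
  (forall x, P x -> Q (e x)) ->
  (forall x y, P x -> P y -> e x = e y -> x = y) ->
  (forall y, Q y -> exists2 x, P x & e x = y) ->
  \esum_(j in Q) a j = \esum_(i in P) a (e i).
Proof.
move=> PQ inj sur; apply: reindex_esum; split.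
- by move=> x /PQ.
- by move=> x y /[!inE] Px Py; exact: inj.
- by move=> y /sur.
Qed.

Lemma esum_mul (T T' : choiceType) (P : set T) (Q : set T') (a : T -> \bar R)
    (b : T' -> \bar R) :
  (forall i, P i -> 0 <= a i) -> (forall j, Q j -> 0 <= b j) ->
  (\esum_(i in P) a i) * (\esum_(j in Q) b j) =
  \esum_(i in P) \esum_(j in Q) (a i * b j).
Proof.
move=> a0 b0; rewrite -esumZr//; last exact: esum_ge0.
by apply: eq_esum => i Pi; rewrite esumZl// a0.
Qed.

(** Used to cut path sums: [y] is the cutting point, the inner sums run over the pieces before and
    after it, and the right side is one sum over all cut paths, ready for a bijection with uncut
    paths. *)
Lemma esum_conv (Y T T' : choiceType) (P : set Y) (I : Y -> set T)
    (J : Y -> set T') (a : Y -> T -> \bar R) (b : Y -> T' -> \bar R) :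
  (forall y i, 0 <= a y i) -> (forall y j, 0 <= b y j) ->
  \esum_(y in P) ((\esum_(i in I y) a y i) * (\esum_(j in J y) b y j)) =
  \esum_(k in P `*`` (fun y => I y `*` J y)) (a k.1 k.2.1 * b k.1 k.2.2).
Proof.
move=> a0 b0; rewrite -(@esum_esum _ _ _ P (fun y => I y `*` J y)
    (fun y k => a y k.1 * b y k.2)); last by move=> *; rewrite mule_ge0.
apply: eq_esum => y Py; rewrite esum_mul//.
by rewrite (@esum_esum _ _ _ (I y) (fun=> J y) (fun i j => a y i * b y j))// => *; rewrite mule_ge0.
Qed.

Lemma esum_delta (T : choiceType) (P : set T) (x : T) (a : T -> \bar R) :
  P x -> 0 <= a x -> \esum_(y in P) (((x == y)%:R)%:E * a y) = a x.
Proof.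
move=> Px ax; rewrite (esum_single (x := x))// ?eqxx ?mul1e//.
by move=> y _ yx; rewrite (_ : x == y = false) ?mul0e//; apply/eqP => /esym.
Qed.

End esum_products.

(** * Path sums and Green identities *)

Section path_sums.
Context {R : realType} {S : countType} (p : S -> S -> R) (d : S -> nat -> R).
Hypothesis q0 : forall x y, 0 <= qm p d x y.
Local Notation q := (qm p d).
Local Notation qc := (qchain p d).
Local Notation g := (gm p d).
Implicit Types (B : set S) (x y z : S) (s t : seq S).

Definition avoids B : set (seq S) := [set s | all (fun z => z \notin B) s].

(* Green function of the chain killed on returning to B: interior of the path off B *)
Definition taboo B x y : \bar R := \esum_(s in avoids B) qc x (rcons s y).

(** [t] lists the positions after the start, so that [belast x t] is the path without its last
    point; for [x] in [B] only the empty [t] remains. *)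
Definition first_hits B x : set (seq S) :=
  [set t | last x t \in B /\ avoids B (belast x t)].

Definition hitting B x : \bar R := \esum_(t in first_hits B x) qc x t.

Lemma qchain_ge0 x t : 0 <= qc x t.
Proof. by elim: t x => [|y t IH] x //=; rewrite mule_ge0. Qed.
Hint Resolve qchain_ge0 : core.

Lemma qchain_cat x s t : qc x (s ++ t) = qc x s * qc (last x s) t.
Proof. by elim: s x => [|y s IH] x /=; rewrite ?mul1e// IH muleA. Qed.

Lemma qchain_rcons x s y : qc x (rcons s y) = qc x s * q (last x s) y.
Proof. by rewrite -cats1 qchain_cat /= mule1. Qed.

Lemma taboo_ge0 B x y : 0 <= taboo B x y.
Proof. exact: esum_ge0. Qed.

Lemma hitting_ge0 B x : 0 <= hitting B x.
Proof. exact: esum_ge0. Qed.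
Hint Resolve taboo_ge0 hitting_ge0 : core.

Lemma Qpow_qchain n x y :
  Qpow p d n x y = \esum_(t in [set t | size t = n /\ last x t = y]) qc x t.
Proof.
elim: n x => [|n IH] x /=.
  have [<-|xy] := eqVneq x y.
    by rewrite (esum_single (x := [::]))//= => -[|a t] [].
  by rewrite esum1// => -[|a t] [//= _ /eqP]; rewrite (negPf xy).
under eq_esum => z _ do rewrite IH -esumZl//.
rewrite esum_esum; last by move=> *; rewrite mule_ge0.
apply/esym; apply: (esum_setbij (e := fun k => k.1 :: k.2)) => /=.
- by move=> [z t] [_ /= [-> ->]].
- by move=> [z t] [z' t'] _ _ [-> ->].
- by move=> [|z t] [//= [sz l]]; exists (z, t).
Qed.

Lemma gm_qchain x y : g x y = \esum_(t in [set t | last x t = y]) qc x t.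
Proof.
rewrite (esum_fiber (Q := [set: nat]) (f := size))//.
by apply: eq_esum => n _; rewrite Qpow_qchain; congr esum; apply/seteqP; split => t [].
Qed.

Lemma gm_ge0 x y : 0 <= g x y.
Proof. by rewrite gm_qchain; exact: esum_ge0. Qed.
Hint Resolve gm_ge0 : core.

Lemma gm_split x y : g x y =
  ((x == y)%:R)%:E + \esum_(t in [set t | last x t = y /\ t <> [::]]) qc x t.
Proof.
rewrite gm_qchain (esumID [set [::]])//; congr (_ + _).
have [xy|xy] := eqVneq x y; last first.
  by rewrite esum1// => t [/= + t0]; rewrite t0 /= => /eqP; rewrite (negPf xy).
by rewrite (esum_single (x := [::]))//= => t [_ ->].
Qed.

(** A nonempty path ending in a point of [B] must meet [B] after its start; cutting at the first
    such time leaves a taboo piece followed by an arbitrary path. The diagonal term is the empty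
    path. *)
Lemma gm_first_return B x z : B z ->
  g x z = ((x == z)%:R)%:E + \esum_(y in B) (taboo B x y * g y z).
Proof.
move=> Bz; rewrite gm_split; congr (_ + _).
under [RHS]eq_esum => y _ do rewrite gm_qchain.
rewrite esum_conv//.
rewrite (@esum_setbij _ _ _ (B `*`` (fun y => avoids B `*` [set t | last y t = z])) _
  (fun k => rcons k.2.1 k.1 ++ k.2.2)).
- by apply: eq_esum => -[y [s t]] _ /=; rewrite qchain_cat last_rcons.
- move=> [y [s t]] [/= By [_ /= lt]]; split; first by rewrite last_cat last_rcons.
  by case: s.
- move=> [y [s t]] [y' [s' t']] [/= By [As _]] [/= By' [As' _]] e.
  (* The cut is recovered from the concatenation: the length of the taboo piece is the index of the
     first entry in [B]. *)
  have F u v w : B u -> avoids B v -> find (fun z => z \in B) (rcons v u ++ w) = size v.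
    move=> Bu; elim: v => [|c v IH] /=; first by rewrite mem_set.
    by move=> /andP[/negPf -> /IH ->].
  have ss : size s = size s' by rewrite -(F _ _ t By As) e F.
  have /eqP := e; rewrite eqseq_cat ?size_rcons ?ss// => /andP[/eqP + /eqP ->].
  by move=> /rcons_inj[-> ->].
- move=> t [tz t0].
  have hB : has (fun z => z \in B) t.
    case/lastP: t tz t0 => // t u; rewrite last_rcons => -> _.
    by rewrite has_rcons mem_set.
  case: (split_find_nth x hB) tz t0 => y s t' yB hs; rewrite last_cat last_rcons => tz _.
  exists (y, (s, t')) => //; split; first exact: set_mem.
  by split => //=; rewrite /avoids /= all_predC.
Qed.

(** Mirror image of [gm_first_return]: a nonempty path that starts in [B] has a last visit to [B]
    before its final point, and what lies strictly between avoids [B]. *)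
Lemma gm_last_exit B x z : B x ->
  g x z = ((x == z)%:R)%:E + \esum_(y in B) (g x y * taboo B y z).
Proof.
move=> Bx; rewrite gm_split; congr (_ + _).
under [RHS]eq_esum => y _ do rewrite gm_qchain.
rewrite esum_conv//.
rewrite (@esum_setbij _ _ _ (B `*`` (fun y => [set t | last x t = y] `*` avoids B)) _
  (fun k => k.2.1 ++ rcons k.2.2 z)).
- by apply: eq_esum => -[y [t s]] [_ [/= <- _]] /=; rewrite qchain_cat.
- move=> [y [t s]] [/= By [/= lt _]]; split; first by rewrite last_cat last_rcons.
  by case: t {lt} => //; case: s.
- move=> [y [t s]] [y' [t' s']] [/= By [/= lt As]] [/= By' [/= lt' As']].
  rewrite -!rcons_cat => /rcons_inj[e].
  (* Read backwards and without its end [z], the path has its first entry in [B] at the cutting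
     point. *)
  have F v w : B (last x v) -> avoids B w ->
      find (fun z => z \in B) (rev ((x :: v) ++ w)) = size w.
    move=> Bv Aw; rewrite rev_cat find_cat has_rev size_rev.
    have /negPf -> : ~~ has (fun z => z \in B) w by rewrite -all_predC.
    by rewrite lastI rev_rcons /= mem_set// addn0.
  have ss : size s = size s'.
    by rewrite -(F t _ _ As) ?lt// cat_cons e -cat_cons F// lt'.
  have st : size t = size t'.
    by have := congr1 size e; rewrite !size_cat ss => /eqP; rewrite eqn_add2r => /eqP.
  have /eqP := e; rewrite eqseq_cat// => /andP[/eqP tt' /eqP ->].
  by rewrite tt' in lt *; rewrite -lt -lt'.
- move=> t [+ t0]; case/lastP: t t0 => // t w _; rewrite last_rcons => ->.
  suff [t' [s [-> lt As]]] : exists t' s, [/\ t = t' ++ s, B (last x t') & avoids B s].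
    by exists (last x t', (t', s)) => //=; rewrite rcons_cat.
  elim/last_ind: t => [|t u [t' [s [-> lt As]]]]; first by exists [::], [::].
  have [uB|uB] := boolP (u \in B).
    by exists (rcons (t' ++ s) u), [::]; rewrite cats0 last_rcons; split => //; exact: set_mem.
  exists t', (rcons s u); rewrite rcons_cat; split => //.
  by rewrite /avoids /= all_rcons uB.
Qed.

Lemma gm_step x y : g x y = ((x == y)%:R)%:E + \esum_(z in [set: S]) (g x z * q z y).
Proof.
rewrite gm_split; congr (_ + _).
under [RHS]eq_esum => z _ do rewrite gm_qchain -esumZr//.
rewrite esum_esum; last by move=> *; rewrite mule_ge0.
rewrite (@esum_setbij _ _ _ ([set: S] `*`` (fun z => [set t | last x t = z])) _
  (fun k => rcons k.2 y)).
- by apply: eq_esum => -[z t] [_ /= <-]; rewrite qchain_rcons.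
- by move=> [z t] [_ /= lt]; rewrite last_rcons; split => //; case: t {lt}.
- by move=> [z t] [z' t'] [_ /= <-] [_ /= <-] /rcons_inj[<-].
- move=> t [+ t0]; case/lastP: t t0 => // t w _; rewrite last_rcons => ->.
  by exists (last x t, t).
Qed.

Lemma taboo_step B x y : taboo B x y =
  q x y + \esum_(z in ~` B) (taboo B x z * q z y).
Proof.
rewrite /taboo (esumID [set [::]])//; congr (_ + _).
  by rewrite (esum_single (x := [::]))//= ?mule1// => t [_ ->].
under [RHS]eq_esum => z _ do rewrite -esumZr//.
rewrite esum_esum; last by move=> *; rewrite mule_ge0.
rewrite (@esum_setbij _ _ _ (~` B `*`` (fun z => avoids B)) _
  (fun k => rcons k.2 k.1)).
- by apply: eq_esum => -[z t] _ /=; rewrite qchain_rcons last_rcons.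
- move=> [z t] [/= nBz At]; split; last by case: t {At}.
  by rewrite /avoids /= all_rcons At andbT; apply/negP => /set_mem.
- by move=> [z t] [z' t'] _ _ /rcons_inj[<- <-].
- move=> t [+ /= t0]; case/lastP: t t0 => // t w _; rewrite /avoids /= all_rcons.
  move=> /andP[wB tB]; exists (w, t) => //; split => //=.
  by move=> /mem_set; apply/negP.
Qed.

Lemma hitting_in B x : B x -> hitting B x = 1.
Proof.
move=> Bx; rewrite /hitting (esum_single (x := [::]))//.
  by split => //=; exact: mem_set.
by move=> [//|y t] [_]; rewrite /avoids /= mem_set.
Qed.

(** Condition on the first step. This harmonicity off [B] is what makes the rows of [ph] sum to one
    there. *)
Lemma hitting_out B x : ~ B x ->
  hitting B x = \esum_(y in [set: S]) (q x y * hitting B y).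
Proof.
move=> nBx; under [RHS]eq_esum => z _ do rewrite /hitting -esumZl//.
rewrite esum_esum; last by move=> *; rewrite mule_ge0.
apply: (esum_setbij (e := fun k => k.1 :: k.2)) => /=.
- move=> [z t] [_ /= [lt At]]; split => //=.
  by rewrite /avoids /= memNset.
- by move=> [z t] [z' t'] _ _ [-> ->].
- move=> [|z t] [/= lt]; first by move/set_mem: lt.
  by rewrite /avoids /= => /andP[_ At]; exists (z, t).
Qed.

Lemma qchain_set_esum (T : choiceType) (x : S) (P : set (seq S)) (m : seq S -> T) :
  \esum_(n in [set: T]) \esum_(t in P `&` [set t | m t = n]) qc x t = \esum_(t in P) qc x t.
Proof. by rewrite [RHS](esum_fiber (Q := [set: T]) (f := m)). Qed.

Lemma entranceE B x y : entrance p d B x y =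
  \esum_(t in [set t | last x t = y /\ avoids B (belast x t)]) qc x t.
Proof.
rewrite /entrance /Qpath -(qchain_set_esum _ _ size); apply: eq_esum => m _.
congr esum; apply/seteqP; split => t /=.
- move=> [<- [+ A]]; rewrite -last_nth => lt; split => //; split => //.
  apply/(all_nthP x) => i; rewrite size_belast => im.
  apply/negP => /set_mem; have := A i im.
  by rewrite lastI nth_rcons size_belast im.
- move=> [[lt At] <-]; split => //; split; first by rewrite -last_nth.
  move=> i im Bi; have /(all_nthP x)/(_ i) := At; rewrite size_belast => /(_ im)/negP; apply.
  by apply/mem_set; move: Bi; rewrite lastI nth_rcons size_belast im.
Qed.

Lemma entrance_ge0 B x y : 0 <= entrance p d B x y.
Proof. by rewrite entranceE; exact: esum_ge0. Qed.

Lemma entrance_in B x y : B x -> entrance p d B x y = ((x == y)%:R)%:E.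
Proof.
move=> Bx; rewrite entranceE.
have [<-|xy] := eqVneq x y.
  by rewrite (esum_single (x := [::]))// => -[//|a t] [_]; rewrite /avoids /= mem_set.
rewrite esum1// => -[|a t] [/=]; first by move/eqP; rewrite (negPf xy).
by rewrite /avoids /= mem_set.
Qed.

Lemma entrance_out B x y : ~ B x -> B y -> entrance p d B x y = taboo B x y.
Proof.
move=> nBx By; rewrite entranceE; apply: (esum_setbij (e := fun s => rcons s y)) => /=.
- move=> s As; rewrite last_rcons belast_rcons; split => //.
  by rewrite /avoids /= memNset.
- by move=> s s' _ _ /rcons_inj[].
- move=> t [+ At]; case/lastP: t At => [|t w].
    by move=> _ /= xy; move: nBx; rewrite xy.
  rewrite last_rcons belast_rcons => + ->; rewrite /avoids /= => /andP[_ At].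
  by exists t.
Qed.

(** A return path is a word [rcons s y] with [s] off [B]. So the return kernel of (v) agrees, for
    targets in [B], with the kernel that enters [escape]. *)
Lemma QreturnE B x y : B y -> Qreturn p d B x y = taboo B x y.
Proof.
move=> By; rewrite /Qreturn /Qpath.
transitivity (\esum_(t in [set t | exists2 s, avoids B s & t = rcons s y]) qc x t); last first.
  apply: (esum_setbij (e := fun s => rcons s y)) => /=.
  - by move=> s As; exists s.
  - by move=> s s' _ _ /rcons_inj[].
  - by move=> t [s As ->]; exists s.
rewrite [RHS](esum_fiber (Q := [set n : nat | (0 < n)%N]) (f := size))//; last first.
  by move=> t [s _ ->]; rewrite /= size_rcons.
apply: eq_esum => n /= n0; congr esum; apply/seteqP; split => t /=.
- move=> [tn [_ [+ A]]]; rewrite -tn -last_nth => lt; split => //.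
  case/lastP: t lt tn A => [|t w]; first by move=> _ /= n00; rewrite -n00 in n0.
  rewrite last_rcons size_rcons => -> tn A; exists t => //.
  apply/(all_nthP x) => i im; apply/negP => /set_mem.
  have := A i.+1; rewrite -tn /= ltnS im => /(_ isT).
  by rewrite /= nth_rcons im.
- move=> [[s As ->] <-]; split => //; rewrite size_rcons /= nth_rcons ltnn eqxx; split => //.
  split => // -[//|i] /=; rewrite ltnS nth_rcons => im; rewrite im => Bi.
  by have /(all_nthP x)/(_ i im)/negP := As; apply; exact/mem_set.
Qed.

Lemma hitting_entrance B x : hitting B x = \esum_(y in B) entrance p d B x y.
Proof.
rewrite /hitting (esum_fiber (Q := B) (f := last x))//; last by move=> t [/set_mem].
apply: eq_esum => y By; rewrite entranceE; congr esum; apply/seteqP; split => t /=.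
- by move=> [[_ At] lt].
- by move=> [lt At]; split => //; split => //; rewrite lt mem_set.
Qed.

Lemma gm_entrance B x y : B y ->
  g x y = \esum_(z in B) (entrance p d B x z * g z y).
Proof.
move=> By; have [Bx|nBx] := pselect (B x).
  under eq_esum => z _ do rewrite entrance_in//.
  by rewrite esum_delta.
rewrite (gm_first_return _ By) (_ : x == y = false); last by apply/eqP => xy; rewrite xy in nBx.
by rewrite add0e; apply: eq_esum => z Bz; rewrite entrance_out.
Qed.

Lemma entrance_le_gm B x y : entrance p d B x y <= g x y.
Proof. by rewrite entranceE gm_qchain; apply: le_esum_subset => t []. Qed.

Lemma taboo_le_gm B x y : taboo B x y <= g x y.
Proof.
rewrite /taboo gm_qchain -(esum_image (avoids B) (fun s => rcons s y)); last first.
  by move=> s s' _ _ /rcons_inj[].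
by apply: le_esum_subset => _ [s _ <-] /=; rewrite last_rcons.
Qed.

Lemma q_le_gm x y : q x y <= g x y.
Proof.
rewrite gm_qchain; apply: le_trans (esum_ge_term _ (_ : _ [:: y])) => //=.
by rewrite mule1.
Qed.

Lemma hitting_lty B x : finite_set B -> (forall x y, g x y < +oo) ->
  hitting B x < +oo.
Proof.
move=> fB goo; rewrite hitting_entrance; apply: esum_fin => // y _.
  exact: entrance_ge0.
exact: le_lt_trans (entrance_le_gm _ _ _) (goo _ _).
Qed.

(** If [hitting] vanished, so would every entrance weight into [B], and by [gm_entrance] also
    [g x y] for each [y] in [B]. *)
Lemma hitting_gt0 B x : 0 < \esum_(y in B) g x y -> 0 < hitting B x.
Proof.
move=> gx; rewrite lt_neqAle hitting_ge0 andbT eq_sym; apply/eqP => h0.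
move: gx; rewrite esum1 ?ltxx// => y By; rewrite (gm_entrance _ By) esum1// => z Bz.
rewrite (esum_eq0 (P := B) (a := entrance p d B x)) ?mul0e// -?hitting_entrance//.
by move=> *; exact: entrance_ge0.
Qed.

End path_sums.

(** * The many-to-one formula *)

Section product_weights.
Context {R : realType}.

(** The value 0 for lists of different lengths lets the second list range over all lists, so that
    its sum factorises ([esum_zprod]). *)
Fixpoint zprod {A C : Type} (F : A -> C -> \bar R) (zs : seq A) (ss : seq C) : \bar R :=
  match zs, ss with
  | z :: zs', s :: ss' => F z s * zprod F zs' ss'
  | [::], [::] => 1
  | _, _ => 0
  end.

Lemma zprod_ge0 (A C : Type) (F : A -> C -> \bar R) zs ss :
  (forall z s, 0 <= F z s) -> 0 <= zprod F zs ss.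
Proof. by move=> F0; elim: zs ss => [|z zs IH] [|s ss] //=; rewrite mule_ge0. Qed.

Lemma zprod_size (A C : Type) (F : A -> C -> \bar R) zs ss :
  size ss != size zs -> zprod F zs ss = 0.
Proof.
elim: zs ss => [|z zs IH] [|s ss] //=; rewrite eqSS => /IH ->; exact: mule0.
Qed.

Lemma zprod_nth (A C : Type) (F : A -> C -> R) a0 c0 zs ss :
  size ss = size zs ->
  zprod (fun z s => (F z s)%:E) zs ss =
  (\prod_(0 <= j < size zs) F (nth a0 zs j) (nth c0 ss j))%R%:E.
Proof.
elim: zs ss => [|z zs IH] [|s ss] //= => [_|[/IH ->]]; first by rewrite big_nil.
by rewrite big_nat_recl//= EFinM.
Qed.

Lemma eq_zprod (A C : eqType) (F G : A -> C -> \bar R) zs ss :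
  (forall j a0 c0, (j < size zs)%N -> F (nth a0 zs j) (nth c0 ss j) = G (nth a0 zs j) (nth c0 ss j)) ->
  zprod F zs ss = zprod G zs ss.
Proof.
elim: zs ss => [|z zs IH] [|s ss] //= FG.
rewrite (FG 0%N z s)// IH// => j a0 c0 jz; exact: (FG j.+1).
Qed.

Lemma esum_seq_cons (C : countType) (a : seq C -> \bar R) :
  (forall s, 0 <= a s) ->
  \esum_(s in [set: seq C]) a s =
  a [::] + \esum_(c in [set: C]) \esum_(s in [set: seq C]) a (c :: s).
Proof.
move=> a0; rewrite (esumID [set [::]])//; congr (_ + _).
  by rewrite setTI esum_set1.
rewrite setTI esum_esum//; apply: (esum_setbij (e := fun k => k.1 :: k.2)) => //=.
- by move=> [x s] [y t] _ _ /= [-> ->].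
- by move=> [|c s] // _; exists (c, s).
Qed.

Lemma esum_zprod (A : Type) (C : countType) (F : A -> C -> \bar R) zs :
  (forall z s, 0 <= F z s) ->
  \esum_(ss in [set: seq C]) zprod F zs ss =
  foldr (fun z acc => (\esum_(s in [set: C]) F z s) * acc) 1 zs.
Proof.
move=> F0; elim: zs => [|z zs IH]; rewrite esum_seq_cons/=.
- by rewrite esum1 ?adde0// => c _; rewrite esum1.
- by case.
- rewrite add0e -IH -esumZr//; last by apply: esum_ge0 => *; exact: zprod_ge0.
  by apply: eq_esum => c _; rewrite esumZl// => *; exact: zprod_ge0.
- by move=> s; exact: (@zprod_ge0 _ _ F (z :: zs) s F0).
Qed.

End product_weights.

(** * The offspring law of a single individual *)

Section offspring_weights.
Context {R : realType} {S : countType} (p : S -> S -> R) (d : S -> nat -> R).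
Hypothesis ps : stochastic p.
Hypothesis dd : forall x, nat_distribution (d x).

Let p0 x y : (0 <= p x y)%R. Proof. by have [] := ps. Qed.
Let psum x : \esum_(y in [set: S]) (p x y)%:E = 1. Proof. by have [_] := ps. Qed.
Let d0 x m : (0 <= d x m)%R. Proof. by have [] := dd x. Qed.
Let dsum x : \esum_(m in [set: nat]) (d x m)%:E = 1. Proof. by have [_] := dd x. Qed.

(* Probability that an individual at z has exactly the children (s_0, ..., s_(m-1)). *)
Definition brood (z : S) (s : seq S) : R := (d z (size s) * \prod_(y <- s) p z y)%R.

Lemma brood_ge0 z s : (0 <= brood z s)%R.
Proof. by rewrite mulr_ge0// prodr_ge0. Qed.

Lemma esum_prodp z m :
  \esum_(s in [set s : seq S | size s = m]) (\prod_(y <- s) p z y)%R%:E = 1.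
Proof.
elim: m => [|m IH].
  by rewrite (esum_single (x := [::])) ?big_nil//= ?lee01// => -[|//].
rewrite -(psum z) (@esum_setbij _ _ _ ([set: S] `*`` (fun=> [set s : seq S | size s = m])) _ (fun k => k.1 :: k.2)) /=.
- rewrite -(@esum_esum _ _ _ _ _ (fun y s => (\prod_(y <- y :: s) p z y)%R%:E)); last first.
    by move=> *; rewrite lee_fin prodr_ge0.
  apply: eq_esum => y _; rewrite -[RHS]mule1 -IH -esumZl ?lee_fin//; last first.
    by move=> *; rewrite lee_fin prodr_ge0.
  by apply: eq_esum => s _; rewrite big_cons EFinM.
- by move=> [y s] [_ /= ->].
- by move=> [y s] [y' s'] _ _ [-> ->].
- by move=> [//|y s] [sm]; exists (y, s).
Qed.

Lemma esum_prodp_nth z m i x0 y : (i < m)%N ->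
  \esum_(s in [set s : seq S | size s = m /\ nth x0 s i = y]) (\prod_(y <- s) p z y)%R%:E = (p z y)%:E.
Proof.
elim: m i => [//|m IH] i im.
rewrite (@esum_setbij _ _ _ ([set: S] `*`` (fun a => [set s : seq S | size s = m /\ nth x0 (a :: s) i = y])) _ (fun k => k.1 :: k.2)) /=.
- rewrite -(@esum_esum _ _ _ _ _ (fun y s => (\prod_(y <- y :: s) p z y)%R%:E)); last first.
    by move=> *; rewrite lee_fin prodr_ge0.
  under eq_esum => a _.
    under eq_esum => s _ do rewrite big_cons EFinM.
    rewrite esumZl ?lee_fin//; last by move=> *; rewrite lee_fin prodr_ge0.
    over.
  case: i im => [_|i im] /=.
    rewrite (esum_single (x := y))//.
    + by rewrite (_ : [set s | _] = [set s : seq S | size s = m]) ?esum_prodp ?mule1//; apply/seteqP; split => s // [].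
    + by rewrite mule_ge0 ?lee_fin// esum_ge0// => *; rewrite lee_fin prodr_ge0.
    + move=> a _ ay; rewrite (_ : [set s | _] = set0) ?esum_set0 ?mule0//.
      by apply/seteqP; split => s // [].
  under eq_esum => a _ do rewrite IH//.
  rewrite esumZr ?lee_fin//; last by move=> *; rewrite lee_fin.
  by rewrite psum mul1e.
- by move=> [a s] [_ /= [-> <-]].
- by move=> [a s] [a' s'] _ _ [-> ->].
- by move=> [|a s] [//= [sm] ny]; exists (a, s).
Qed.

Lemma esum_brood z : \esum_(s in [set: seq S]) (brood z s)%:E = 1.
Proof.
rewrite (esum_fiber (Q := [set: nat]) (f := size))//; last by move=> s _; rewrite lee_fin brood_ge0.
rewrite -(dsum z); apply: eq_esum => m _.
rewrite -[RHS]mule1 -(esum_prodp z m) -esumZl ?lee_fin//; last by move=> *; rewrite lee_fin prodr_ge0.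
rewrite (_ : [set i | _] = [set s : seq S | size s = m]); last by apply/seteqP; split => s // [].
by apply: eq_esum => s /= <-; rewrite EFinM.
Qed.

(** A probability attached to the child index [i], so that summing over [i] gives an expected number
    of children at [y]; the default [x0] is never reached. *)
Definition nth_child x0 (z : S) (i : nat) (y : S) : \bar R :=
  \esum_(s in [set s : seq S | (i < size s)%N /\ nth x0 s i = y]) (brood z s)%:E.

Lemma nth_child_ge0 x0 z i y : 0 <= nth_child x0 z i y.
Proof. by apply: esum_ge0 => s _; rewrite lee_fin brood_ge0. Qed.

Lemma nth_childE x0 z i y :
  nth_child x0 z i y = \esum_(m in [set m | (i < m)%N]) (d z m * p z y)%:E.
Proof.
rewrite /nth_child (esum_fiber (Q := [set m | (i < m)%N]) (f := size)); first last.
- by move=> s _; rewrite lee_fin brood_ge0.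
- by move=> s [].
apply: eq_esum => m /= im.
rewrite EFinM -(esum_prodp_nth z x0 y im) -esumZl ?lee_fin//; last by move=> *; rewrite lee_fin prodr_ge0.
rewrite (_ : [set i | _] = [set s : seq S | size s = m /\ nth x0 s i = y]); last first.
  by apply/seteqP; split => s [] /=; [move=> [_ ny] sm|move=> sm ny; rewrite sm].
by apply: eq_esum => s /= [<-]; rewrite EFinM.
Qed.

(** By [nth_childE] the index [i] contributes for the brood sizes [m > i], so the sum over [i]
    counts each size [m] exactly [m] times: this produces [mean_offspring]. *)
Lemma esum_nth_child x0 z y :
  \esum_(i in [set: nat]) nth_child x0 z i y = qm p d z y.
Proof.
under eq_esum => i _ do rewrite nth_childE esum_mkcond.
rewrite esum_swap; last by move=> i m _ _; case: ifP => // _; rewrite lee_fin mulr_ge0.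
rewrite /qm /mean_offspring -esumZr ?lee_fin//; last by move=> m _; rewrite lee_fin mulr_ge0.
apply: eq_esum => m _.
rewrite (_ : esum _ _ = esum `I_m (fun=> (d z m * p z y)%:E)); last first.
  rewrite [RHS]esum_mkcond; apply: eq_esum => i _.
  by rewrite (_ : (m \in [set m0 | (i < m0)%N]) = (i \in `I_m))//; apply/idP/idP; rewrite !inE.
rewrite esum_fset//; last by move=> i _; rewrite lee_fin mulr_ge0.
rewrite -fsbig_ord /= sumEFin big_const_ord iter_addr_0.
by rewrite -EFinM -mulrA mulr_natl.
Qed.

End offspring_weights.

(** * Expected numbers of lineages in the branching chain *)

Section many_to_one.
Context {R : realType} {S : countType} (p : S -> S -> R) (d : S -> nat -> R).
Context (dO : measure_display) (O : measurableType dO) (P : probability O R).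
Context (Nf : seq nat -> O -> nat) (Xf : seq nat -> O -> S) (x : S).
Hypothesis ps : stochastic p.
Hypothesis dd : forall x, nat_distribution (d x).
Hypothesis bmc : is_BMC p d P Nf Xf x.

Let mN u m : measurable [set w | Nf u w = m]. Proof. by have [] := bmc. Qed.
Let mX u y : measurable [set w | Xf u w = y]. Proof. by have [_ []] := bmc. Qed.

Lemma mem_generation N k u : (u \in generation N k) = alive N u && (size u == k).
Proof.
elim: k u => [|k IH] u /=; first by rewrite inE; case: u => [|i u]//=; rewrite andbF.
apply/flattenP/idP => [[l /mapP[v vk ->] /mapP[i]]|].
  rewrite mem_iota add0n => /= iN ->; move: vk; rewrite IH => /andP[av sv] /=.
  by rewrite av iN eqSS.
case: u => [|i u] //=.
rewrite eqSS => /andP[/andP[au iN] su].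
exists [seq i :: u | i <- iota 0 (N u)]; first by apply/mapP; exists u; rewrite ?IH ?au.
by apply/mapP; exists i; rewrite // mem_iota.
Qed.

Lemma uniq_generation N k : uniq (generation N k).
Proof.
elim: k => [//|k IH] /=.
apply: allpairs_uniq_dep => //; first by move=> u _; exact: iota_uniq.
by move=> [u i] [v j] _ _ /= [-> ->].
Qed.

Lemma eq_generation n n' k :
  (forall u, alive n u -> (size u < k)%N -> n u = n' u) -> generation n k = generation n' k.
Proof.
elim: k => [//|k IH] nn' /=; rewrite -IH; last by move=> u au uk; apply: nn' => //; exact: ltnW.
congr flatten; apply/eq_in_map => u; rewrite mem_generation => /andP[au /eqP su].
by rewrite nn'// su.
Qed.

Lemma measurable_alive u : measurable [set w | alive (Nf^~ w) u].
Proof.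
elim: u => [|i u IH] /=; first by rewrite (_ : [set w | _] = setT)//; apply/seteqP; split.
rewrite (_ : [set w | _] = [set w | alive (Nf^~ w) u] `&` \bigcup_(m in [set m | (i < m)%N]) [set w | Nf u w = m]).
  by apply: measurableI => //; apply: bigcup_measurable.
apply/seteqP; split=> [w /= /andP[au iN]|w /= [au [m /= im Nm]]]; last by rewrite au Nm.
by split => //; exists (Nf u w).
Qed.

Lemma measurable_imply (A : Prop) (U V : set O) : measurable U -> measurable V ->
  measurable [set w | U w -> A -> V w].
Proof.
move=> mU mV; have [a|na] := pselect A; last first.
  by rewrite (_ : [set w | _] = setT)//; apply/seteqP; split => // w _ _ /na.
rewrite (_ : [set w | _] = ~` U `|` V); first by apply: measurableU => //; exact: measurableC.
apply/seteqP; split=> w /=; last by case=> // nU /nU.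
by move=> UV; have [/UV/(_ a)|] := pselect (U w); [right|left].
Qed.

Lemma measurable_bmc_event k n xs : measurable (bmc_event Nf Xf k n xs).
Proof.
rewrite (_ : bmc_event _ _ _ _ _ =
  \bigcap_u [set w | [set w | alive (Nf^~ w) u] w -> (size u < k)%N -> [set w | Nf u w = n u] w] `&`
  \bigcap_u [set w | [set w | alive (Nf^~ w) u] w -> (size u <= k)%N -> [set w | Xf u w = xs u] w]).
  apply: measurableI; apply: bigcap_countType_measurable => u _; apply: measurable_imply => //; exact: measurable_alive.
apply/seteqP; split=> w.
  by move=> [A1 A2]; split=> u _; [exact: A1|exact: A2].
by move=> [A1 A2]; split=> u; [exact: A1|exact: A2].
Qed.

(** Youngest position first, following the labels, in which a child of [u] is [i :: u]. Path words
    run the other way, hence the reversals below. *)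
Fixpoint lineage (X : seq nat -> S) (u : seq nat) : seq S :=
  X u :: (if u is _ :: u' then lineage X u' else [::]).

Lemma lineageE X u : lineage X u = X u :: (if u is _ :: u' then lineage X u' else [::]).
Proof. by case: u. Qed.

Lemma size_lineage X u : size (lineage X u) = (size u).+1.
Proof. by elim: u => //= i u ->. Qed.

Lemma nth_lineage X u x0 j : (j <= size u)%N -> nth x0 (lineage X u) j = X (drop j u).
Proof. by elim: u j => [|i u IH] [|j] //= ju; rewrite ?drop0//; exact: IH. Qed.

Definition line_event u l : set O :=
  [set w | alive (Nf^~ w) u /\ lineage (Xf^~ w) u = l].

Lemma measurable_lineage u l : measurable [set w | lineage (Xf^~ w) u = l].
Proof.
have mnil u' : measurable [set w | lineage (Xf^~ w) u' = [::]].
  by rewrite (_ : [set w | _] = set0)//; apply/seteqP; split => w //=; rewrite lineageE.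
elim: u l => [|i u IH] [|y l] //.
- case: l => [|z l]; last by rewrite (_ : [set w | _] = set0)//; apply/seteqP; split => w.
  by rewrite (_ : [set w | _] = [set w | Xf [::] w = y])//; apply/seteqP; split => w /= [->].
- rewrite (_ : [set w | _] = [set w | Xf (i :: u) w = y] `&` [set w | lineage (Xf^~ w) u = l]).
    exact: measurableI.
  by apply/seteqP; split => w /= [-> ->].
Qed.

Lemma measurable_line_event u l : measurable (line_event u l).
Proof. by apply: measurableI; [exact: measurable_alive|exact: measurable_lineage]. Qed.

(** Everything visible up to generation [k], as an element of a countable type, so that events can
    be split along it. Offspring numbers of generation [k] are masked by 0 because [bmc_event]
    leaves them free; this makes the fibres exactly events of that kind ([configP]). *)
Definition config k (w : O) : seq (seq nat * nat * S) :=
  [seq (v, if (size v < k)%N then Nf v w else 0%N, Xf v w) |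
     v <- flatten [seq generation (Nf^~ w) j | j <- iota 0 k.+1]].

Lemma mem_gens N k u : (u \in flatten [seq generation N j | j <- iota 0 k.+1]) =
  alive N u && (size u <= k)%N.
Proof.
apply/flattenP/idP => [[l /mapP[j jk ->]]|/andP[au uk]].
  by rewrite mem_generation => /andP[-> /eqP ->]; move: jk; rewrite mem_iota.
exists (generation N (size u)); last by rewrite mem_generation au eqxx.
by apply/mapP; exists (size u); rewrite // mem_iota.
Qed.

Lemma configP k w w0 : config k w = config k w0 <->
  bmc_event Nf Xf k (Nf^~ w0) (Xf^~ w0) w.
Proof.
split=> [e|[eN eX]]; last first.
  have eg : flatten [seq generation (Nf^~ w) j | j <- iota 0 k.+1] =
            flatten [seq generation (Nf^~ w0) j | j <- iota 0 k.+1].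
    congr flatten; apply/eq_in_map => j; rewrite mem_iota /= add0n ltnS => jk.
    by apply: eq_generation => u au uj; apply: eN => //; exact: leq_trans jk.
  rewrite /config -eg; apply/eq_in_map => u; rewrite mem_gens => /andP[au uk].
  by rewrite eX//; case: ifPn => // ?; rewrite eN.
have H u : alive (Nf^~ w) u -> (size u <= k)%N ->
    Xf u w = Xf u w0 /\ ((size u < k)%N -> Nf u w = Nf u w0).
  move=> au uk; have : (u, if (size u < k)%N then Nf u w else 0%N, Xf u w) \in config k w.
    by apply/mapP; exists u => //; rewrite mem_gens au.
  by rewrite e => /mapP[v _ [<- eN ->]]; split => // uk'; move: eN; rewrite uk'.
by split=> u au uk; [apply (H u au (ltnW uk))|apply (H u au uk)].
Qed.

Definition brood_at (w : O) (v : seq nat) : seq S := [seq Xf (i :: v) w | i <- iota 0 (Nf v w)].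

(** Prescribing the broods of generation [k] turns the event into a [bmc_event] of level [k.+1], and
    the one new factor in its law is the product of the brood weights. Both alternatives of the
    hypothesis give [ss] the length of the generation. *)
Lemma bmc_event_extend k n xs ss :
  bmc_event Nf Xf k n xs `&` [set w | map (brood_at w) (generation n k) = ss] !=set0 \/ size ss = size (generation n k) ->
  [/\ measurable (bmc_event Nf Xf k n xs `&` [set w | map (brood_at w) (generation n k) = ss])
    & P (bmc_event Nf Xf k n xs `&` [set w | map (brood_at w) (generation n k) = ss]) =
      P (bmc_event Nf Xf k n xs) *
      zprod (fun v s => (brood p d (xs v) s)%:E) (generation n k) ss].
Proof.
set gen := generation n k => H.
have {H} sz : size ss = size gen.
  by case: H => // -[w [_ /= <-]]; rewrite size_map.
(* [cs v] is the brood assigned to [v]; [n'] and [xs'] overwrite the given data at the offspring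
   numbers of generation [k] and the positions of generation [k.+1]. *)
pose cs v := nth [::] ss (index v gen).
pose n' u := if size u == k then size (cs u) else n u.
pose xs' v := if size v == k.+1 then nth x (cs (behead v)) (head 0%N v) else xs v.
have n'n u : size u <> k -> n' u = n u by rewrite /n'; case: eqP.
have xs'xs u : size u <> k.+1 -> xs' u = xs u by rewrite /xs'; case: eqP.
have evE : bmc_event Nf Xf k n xs `&` [set w | map (brood_at w) gen = ss] =
    bmc_event Nf Xf k.+1 n' xs'.
  apply/seteqP; split=> w.
    move=> [[eN eX] /= ess].
    have eg : generation (Nf^~ w) k = gen by exact: eq_generation.
    have ecs u : alive (Nf^~ w) u -> size u = k -> cs u = brood_at w u.
      move=> au uk; have ug : u \in gen by rewrite -eg mem_generation au uk eqxx.
      by rewrite /cs -ess (nth_map [::]) ?index_mem// nth_index.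
    split=> u au uk.
      rewrite /n'; case: eqP => [ek|nk]; first by rewrite ecs// size_map size_iota.
      by apply: eN => //; move: uk; rewrite ltnS leq_eqVlt => /orP[/eqP//|].
    rewrite /xs'; case: eqP => [ek|nk]; last first.
      by apply: eX => //; move: uk; rewrite leq_eqVlt => /orP[/eqP//|].
    case: u ek au {uk} => //= i u [uk] /andP[au iN].
    by rewrite ecs// /brood_at (nth_map 0%N) ?size_iota// nth_iota.
  move=> [eN eX].
  have E : bmc_event Nf Xf k n xs w.
    split=> u au uk.
      by rewrite eN// ?n'n//; [move=> e; rewrite e ltnn in uk|exact: leq_trans (ltnW uk) _].
    by rewrite eX// ?xs'xs//; [move=> e; rewrite e ltnn in uk|exact: leq_trans uk _].
  split=> //=.
  have eg : generation (Nf^~ w) k = gen by case: E => + _; exact: eq_generation.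
  apply: (@eq_from_nth _ [::]) => [|j]; rewrite size_map// => jg.
  have vg : nth [::] gen j \in gen by exact: mem_nth.
  rewrite (nth_map [::])//; set v := nth [::] gen j in vg *.
  have csv : cs v = nth [::] ss j by rewrite /cs index_uniq// uniq_generation.
  move: vg; rewrite -eg mem_generation => /andP[av /eqP sv].
  have Nv : Nf v w = size (cs v) by rewrite eN ?sv// /n' sv eqxx.
  rewrite -csv; apply: (@eq_from_nth _ x) => [|i]; rewrite size_map size_iota// Nv => iv.
  rewrite (nth_map 0%N) ?size_iota ?Nv// nth_iota// add0n.
  by rewrite eX//= ?sv ?av ?Nv//= /xs' /= sv eqxx.
rewrite evE; split; first exact: measurable_bmc_event.
have [_ [_ Pev]] := bmc; rewrite !Pev (zprod_nth _ [::] [::])//.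
rewrite big_ord_recr /= -EFinM mulrA; congr (_ * _)%R%:E.
- have -> : xs' [::] = xs [::] by rewrite xs'xs.
  congr (_ * _)%R.
  apply: eq_bigr => j _; rewrite (_ : generation n' j = generation n j); last first.
    apply: eq_generation => u _ uj; rewrite n'n// => uk.
    by have := ltn_trans uj (ltn_ord j); rewrite uk ltnn.
  apply: eq_big_seq => u; rewrite mem_generation => /andP[_ /eqP uj].
  have uk : size u <> k by move=> uk; have := ltn_ord j; rewrite -uj uk ltnn.
  have uk1 : size u <> k.+1 by move=> uk'; have := ltnW (ltn_ord j); rewrite -uj uk' ltnn.
  rewrite n'n// xs'xs//; congr (_ * _)%R; apply: eq_bigr => i _.
  by rewrite xs'xs//= => -[].
- rewrite (_ : generation n' k = gen); last first.
    by apply: eq_generation => u _ uk; rewrite n'n// => e; rewrite e ltnn in uk.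
  rewrite (big_nth [::]); apply: eq_big_nat => j jg.
  have vg : nth [::] gen j \in gen by exact: mem_nth.
  set v := nth [::] gen j in vg *.
  have csv : cs v = nth [::] ss j by rewrite /cs index_uniq// uniq_generation.
  have sv : size v = k by move: vg; rewrite mem_generation => /andP[_ /eqP].
  rewrite /brood -csv xs'xs ?sv; last by move=> /esym/eqP; rewrite gtn_eqF.
  rewrite /n' sv eqxx; congr (_ * _)%R.
  rewrite [RHS](big_nth x); apply: eq_big_nat => i iv.
  by rewrite /xs' /= sv eqxx.
Qed.

(** Sum [bmc_event_extend] over all lists of broods. The sum factorises over generation [k]: every
    individual other than [u] contributes total brood mass 1, and [u] contributes [nth_child]. *)
Lemma bmc_event_child k n xs u i y : alive n u -> size u = k ->
  measurable (bmc_event Nf Xf k n xs `&` [set w | (i < Nf u w)%N /\ Xf (i :: u) w = y]) ->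
  P (bmc_event Nf Xf k n xs `&` [set w | (i < Nf u w)%N /\ Xf (i :: u) w = y]) =
  P (bmc_event Nf Xf k n xs) * nth_child p d x (xs u) i y.
Proof.
set E := bmc_event _ _ _ _ _; set D := [set w | _] => au uk mED.
set gen := generation n k.
have ug : u \in gen by rewrite mem_generation au uk eqxx.
pose good s := (i < size s)%N && (nth x s i == y).
(* The condition on the child of [u] is absorbed in the weights: broods of [u] that violate it get
   weight 0. *)
pose F v s : \bar R := if (v == u) && ~~ good s then 0 else (brood p d (xs v) s)%:E.
have F0 v s : 0 <= F v s by rewrite /F; case: ifP => // _; rewrite lee_fin brood_ge0.
have key ss : [/\ measurable (E `&` D `&` [set w | map (brood_at w) gen = ss])
    & P (E `&` D `&` [set w | map (brood_at w) gen = ss]) = P E * zprod F gen ss].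
  have Dg w : map (brood_at w) gen = ss -> D w <-> good (nth [::] ss (index u gen)).
    move=> <-; rewrite (nth_map [::]) ?index_mem// nth_index// /good /brood_at size_map size_iota.
    rewrite /D /=; split.
      by move=> [iN Xy]; rewrite iN (nth_map 0%N) ?size_iota// nth_iota// add0n Xy eqxx.
    by move=> /andP[iN /eqP]; rewrite (nth_map 0%N) ?size_iota// nth_iota// add0n.
  have [szs|szs] := eqVneq (size ss) (size gen); last first.
    rewrite (_ : _ `&` [set w | _] = set0); last first.
      by apply/seteqP; split => w //= [_ e]; move: szs; rewrite -e size_map eqxx.
    by split => //; rewrite measure0 zprod_size// mule0.
  have [mE PE] := bmc_event_extend (xs := xs) (or_intror szs).
  have [gd|bd] := boolP (good (nth [::] ss (index u gen))).
    have -> : E `&` D `&` [set w | map (brood_at w) gen = ss] = E `&` [set w | map (brood_at w) gen = ss].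
      apply/seteqP; split=> [w [[]]//|w [Ew e]]; split => //; split => //.
      exact/(Dg w e).
    split => //; rewrite PE; congr (_ * _); apply: eq_zprod => j a0 c0 jg.
    rewrite /F; case: eqP => //= ju; have -> : nth c0 ss j = nth [::] ss (index u gen).
      by rewrite -ju index_uniq ?uniq_generation//; apply: set_nth_default; rewrite szs.
    by rewrite gd.
  have -> : E `&` D `&` [set w | map (brood_at w) gen = ss] = set0.
    by apply/seteqP; split => w // [[_ Dw] e]; move: bd; rewrite (iffLR (Dg w e)).
  split => //; rewrite measure0.
  suff -> : zprod F gen ss = 0 by rewrite mule0.
  have : F (nth [::] gen (index u gen)) (nth [::] ss (index u gen)) = 0.
    by rewrite /F nth_index// eqxx bd.
  have : (index u gen < size gen)%N by rewrite index_mem.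
  move: (index u gen) szs {Dg bd PE mE ug mED} => j.
  elim: gen ss j => [//|v gen IH] [//|s ss] [|j] /= szs jg Fj; first by rewrite Fj mul0e.
  by rewrite (IH ss j)// ?mule0//; case: szs.
rewrite (measure_partition P (f := fun w => map (brood_at w) gen)); last by move=> ss; have [] := key ss.
rewrite (eq_esum (b := fun ss => P E * zprod F gen ss)); last by move=> ss _; have [] := key ss.
rewrite esumZl//; last by move=> *; exact: zprod_ge0.
congr (_ * _); rewrite esum_zprod//.
have F1 v : v != u -> \esum_(s in [set: seq S]) F v s = 1.
  move=> vu; rewrite -(esum_brood ps dd (xs v)); apply: eq_esum => s _.
  by rewrite /F (negPf vu).
have Fu : \esum_(s in [set: seq S]) F u s = nth_child p d x (xs u) i y.
  rewrite /nth_child [RHS]esum_mkcond; apply: eq_esum => s _.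
  have -> : (s \in [set s0 | (i < size s0)%N /\ nth x s0 i = y]) = good s.
    apply/idP/idP; rewrite inE /good; first by move=> [-> ->]; rewrite eqxx.
    by move=> /andP[? /eqP].
  by rewrite /F eqxx; case: (good s).
have := uniq_generation n k; rewrite -/gen; move: ug; clear -F1 Fu.
have H1 gen' : u \notin gen' -> foldr (fun z acc => (\esum_(s in [set: seq S]) F z s) * acc) 1 gen' = 1.
  elim: gen' => //= v g IH; rewrite inE negb_or => /andP[uv /IH ->].
  by rewrite F1 ?mul1e// eq_sym.
elim: gen => //= v g IH; rewrite inE => /orP[/eqP <-|ug] /andP[vg ug'].
  by rewrite Fu H1// mule1.
by rewrite IH// F1 ?mul1e//; apply: contraNneq vg => ->.
Qed.

(** Split along [config]. On one [bmc_event] the lineage of [u] is either the prescribed one or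
    excluded, and in the first case [bmc_event_child] supplies the factor. *)
Lemma line_event_child u i y z l :
  P (line_event (i :: u) (y :: z :: l)) = P (line_event u (z :: l)) * nth_child p d x z i y.
Proof.
pose k := size u.
have key c : [/\ measurable (line_event (i :: u) (y :: z :: l) `&` [set w | config k w = c]),
    measurable (line_event u (z :: l) `&` [set w | config k w = c]) &
    P (line_event (i :: u) (y :: z :: l) `&` [set w | config k w = c]) =
    P (line_event u (z :: l) `&` [set w | config k w = c]) * nth_child p d x z i y].
  have [[w0 _ <-]|nc] := pselect (range (config k) c); last first.
    have -> : [set w | config k w = c] = set0.
      by apply/seteqP; split => w //= e; case: nc; exists w.
    by rewrite !setI0 measure0 mul0e.
  have -> : [set w | config k w = config k w0] = bmc_event Nf Xf k (Nf^~ w0) (Xf^~ w0).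
    by apply/seteqP; split => w /configP.
  set E := bmc_event _ _ _ _ _; have mE : measurable E by exact: measurable_bmc_event.
  have m1 : measurable (line_event (i :: u) (y :: z :: l) `&` E).
    by apply: measurableI => //; exact: measurable_line_event.
  have m2 : measurable (line_event u (z :: l) `&` E).
    by apply: measurableI => //; exact: measurable_line_event.
  split => //.
  have aE w : E w -> alive (Nf^~ w) u = alive (Nf^~ w0) u.
    move=> [eN _]; have eg : generation (Nf^~ w) k = generation (Nf^~ w0) k by exact: eq_generation.
    by have := mem_generation (Nf^~ w) k u; rewrite eg mem_generation eqxx !andbT.
  have lE w : E w -> alive (Nf^~ w) u -> lineage (Xf^~ w) u = lineage (Xf^~ w0) u.
    move=> [_ eX] au; have : (size u <= k)%N by [].
    elim: (u) au => [|j v IH] /=; first by move=> _ _; rewrite eX.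
    move=> /andP[av jN] vk; rewrite eX//=; last by rewrite av.
    by rewrite IH//; exact: ltnW.
  have [[au lu]|nal] := pselect (alive (Nf^~ w0) u /\ lineage (Xf^~ w0) u = z :: l).
    have e2 : line_event u (z :: l) `&` E = E.
      apply/seteqP; split => [w []//|w Ew]; split => //.
      by have au' := aE w Ew; split; rewrite ?lE// au'.
    have e1 : line_event (i :: u) (y :: z :: l) `&` E = E `&` [set w | (i < Nf u w)%N /\ Xf (i :: u) w = y].
      apply/seteqP; split => [w [[/= /andP[_ iN] [-> _]] Ew]//|w [Ew [iN Xy]]].
      have au' := aE w Ew; split => //; split => /=; first by rewrite au' au.
      by rewrite Xy lE ?au'// lu.
    rewrite e2 e1 bmc_event_child//; last by rewrite -e1.
    by rewrite (_ : Xf u w0 = z)//; move: lu; rewrite lineageE => -[].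
  rewrite (_ : _ `&` E = set0); last first.
    apply/seteqP; split => w // [[/= /andP[au iN] [_ lu]] Ew]; apply: nal.
    by rewrite -(aE w Ew) -(lE w Ew au).
  rewrite (_ : _ `&` E = set0) ?measure0 ?mul0e//.
  by apply/seteqP; split => w // [[/= au lu] Ew]; apply: nal; rewrite -(aE w Ew) -(lE w Ew au).
rewrite (measure_partition P (f := config k)); last by move=> c; have [] := key c.
rewrite [in RHS](measure_partition P (f := config k)); last by move=> c; have [] := key c.
rewrite -esumZr ?nth_child_ge0//.
by apply: eq_esum => c _; have [_ _] := key c.
Qed.

(** Induction on the path from its end: the last individual has a label [i :: u], the sum over [i]
    turns [nth_child] into a factor [qm], and the sum over [u] is the induction hypothesis. *)
Lemma many_to_one x' t :
  \esum_(u in [set: seq nat]) P (line_event u (rev (x' :: t))) =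
  ((x' == x)%:R)%:E * qchain p d x' t.
Proof.
have q0 a b : 0 <= qm p d a b.
  rewrite mule_ge0 ?lee_fin//; last by have [] := ps.
  by apply: esum_ge0 => m _; rewrite lee_fin mulr_ge0//; have [] := dd a.
elim/last_ind: t => [|t y IH].
  rewrite (esum_single (x := [::]))//=; last first.
    move=> u _ u0; rewrite (_ : line_event _ _ = set0) ?measure0//.
    apply/seteqP; split => w //= [_ /(congr1 size)]; rewrite size_lineage size_rev /=.
    by case: u u0.
  rewrite mule1; have [_ [_ Pev]] := bmc.
  have := Pev 0%N (fun=> 0%N) (fun=> x'); rewrite big_ord0 mulr1 => <-.
  congr (P _); apply/seteqP; split => w /=.
    move=> [_ [Xx]]; split => u au; first by [].
    by rewrite leqn0 size_eq0 => /eqP ->.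
  by move=> [_ eX]; split => //=; rewrite (eX [::]).
rewrite -rcons_cons rev_rcons qchain_rcons muleA -IH.
rewrite -esumZr//.
rewrite (esumID [set [::]])// setTI esum_set1// (_ : line_event [::] _ = set0); last first.
  apply/seteqP; split => w //= [_ /(congr1 size)] /=.
  by rewrite size_rev.
rewrite measure0 add0e setTI.
have -> : \esum_(u in ~` [set [::]]) P (line_event u (y :: rev (x' :: t))) =
    \esum_(u in [set: seq nat]) \esum_(i in [set: nat]) P (line_event (i :: u) (y :: rev (x' :: t))).
  rewrite esum_esum//; apply: (esum_setbij (e := fun k => k.2 :: k.1)) => //=.
  - by move=> [a b] [a' b'] _ _ [-> ->].
  - by move=> [//|i u] _; exists (u, i).
apply: eq_esum => u _; rewrite -(esum_nth_child ps dd x) -esumZl//; last first.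
  by move=> *; exact: nth_child_ge0.
apply: eq_esum => i _; rewrite (lastI x' t) rev_rcons.
exact: line_event_child.
Qed.

(** An individual is counted when its lineage has its head in [B] and its tail off [B]; reversed,
    such lists are the words of [first_hits]. The sum over their starting points collapses at [x],
    where the root sits. *)
Lemma integral_numH B : \int[P]_w numH Nf Xf B w = hitting p d B x.
Proof.
pose Hl : set (seq S) := [set l | exists y l', [/\ l = y :: l', B y & avoids B l']].
pose F u : set O := [set w | alive (Nf^~ w) u /\ Hl (lineage (Xf^~ w) u)].
have FE u : F u = \bigcup_(l in Hl) line_event u l.
  apply/seteqP; split => [w [au Hw]|w [l Hw [au lw]]]; first by exists (lineage (Xf^~ w) u).
  by split => //; rewrite lw.
have mF u : measurable (F u).
  by rewrite FE; apply: bigcup_countType_measurable => l _; exact: measurable_line_event.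
transitivity (\int[P]_w (\esum_(u in [set u | F u w]) 1)).
  apply: eq_integral => w _; rewrite /numH; congr esum; apply/seteqP; split => u /=.
    move=> [au [Bu Hu]]; split => //; exists (Xf u w).
    exists (if u is _ :: u' then lineage (Xf^~ w) u' else [::]); split => //; first exact: lineageE.
    case: u au Bu Hu => // i u au Bu Hu; apply/(all_nthP x) => j; rewrite size_lineage ltnS => ju.
    rewrite nth_lineage//; apply/negP => /set_mem; exact: (Hu j.+1).
  move=> [au [y [l' [e By Al]]]]; split => //; move: e; rewrite lineageE => -[ey el].
  split; first by rewrite ey.
  move=> [//|j]; case: u au ey el => // i u au ey el /= ju Bj.
  move/(all_nthP x): Al => /(_ j); rewrite -el size_lineage => /(_ ju)/negP; apply.
  by rewrite nth_lineage//; exact: mem_set.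
rewrite integral_esum_indic//.
under eq_esum => u _.
  rewrite FE measure_bigcup_esum; first last.
  - by move=> l l' _ _ [w [[_ <-] [_ <-]]].
  - by move=> *; exact: measurable_line_event.
  over.
rewrite esum_swap// /hitting.
rewrite [LHS](esum_setbij (P := [set k : S * seq S | first_hits B k.1 k.2]) (e := fun k => rev (k.1 :: k.2))).
- under eq_esum => k _ do rewrite many_to_one.
  rewrite (_ : [set k | _] = [set: S] `*`` (fun a => first_hits B a)); last first.
    by apply/seteqP; split => -[a t] //= [].
  have q0 a b : 0 <= qm p d a b.
    rewrite mule_ge0 ?lee_fin//; last by have [] := ps.
    by apply: esum_ge0 => m _; rewrite lee_fin mulr_ge0//; have [] := dd a.
  rewrite -(@esum_esum _ _ _ _ _ (fun a t => ((a == x)%:R)%:E * qchain p d a t)); last first.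
    by move=> *; rewrite mule_ge0 ?qchain_ge0.
  rewrite (esum_single (x := x))//.
  + by apply: eq_esum => t _; rewrite eqxx mul1e.
  + by apply: esum_ge0 => t _; rewrite mule_ge0 ?qchain_ge0.
  + by move=> a _ /eqP/negPf ax; rewrite esum1// => t _; rewrite ax mul0e.
- move=> [a t] [/= lt At]; rewrite lastI rev_rcons; exists (last a t), (rev (belast a t)).
  by split => //; [exact: set_mem|rewrite /avoids /= all_rev].
- by move=> [a t] [a' t'] _ _ /(congr1 rev); rewrite !revK => -[-> ->].
- move=> _ [y [l [-> By Al]]]; case/lastP: l Al => [_|l a].
    by exists (y, [::]) => //=; split => //=; exact: mem_set.
  rewrite /avoids /= all_rcons => /andP[aB Al].
  have e : rev (y :: rcons l a) = a :: rcons (rev l) y by rewrite rev_cons rev_rcons.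
  exists (a, rcons (rev l) y); last by rewrite /= -e revK.
  split => /=; first by rewrite last_rcons mem_set.
  by rewrite belast_rcons /avoids /= aB all_rev.
Qed.

End many_to_one.

(** * Kuznetsov measures: masses of cylinders and uniqueness *)

Section path_space.
Context {S : countType}.
Local Notation W := (@Wspace S).
Implicit Types (w : nat -> option S) (x y z : S) (r s t : seq S) (B : set S).

Lemma WcylP ys w : Wcyl ys w <-> mkseq w (size ys) = ys.
Proof.
split=> [H|H i iy]; last by rewrite -[in RHS]H nth_mkseq.
apply: (@eq_from_nth _ None) => [|i]; rewrite size_mkseq// => iy.
by rewrite nth_mkseq// H.
Qed.

Lemma measurable_Wcyl ys : measurable (Wcyl ys : set W).
Proof. by apply: sub_sigma_algebra; exists ys. Qed.

Lemma measurable_coord i (a : option S) : measurable ([set w | w i = a] : set W).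
Proof.
rewrite (_ : [set w | _] = \bigcup_(ys in [set ys | nth None ys i = a /\ size ys = i.+1]) Wcyl ys).
  by apply: bigcup_countType_measurable => ys _; exact: measurable_Wcyl.
apply/seteqP; split => [w /= <-|w [ys [/= <- sy] H]]; last by rewrite /= H// sy.
exists (mkseq w i.+1); first by split; rewrite ?size_mkseq ?nth_mkseq.
by apply/WcylP; rewrite size_mkseq.
Qed.

Lemma measurable_mkseq n ys : measurable ([set w | mkseq w n = ys] : set W).
Proof.
rewrite (_ : [set w | _] = if size ys == n then Wcyl ys else set0); last first.
  case: eqP => [<-|ny]; first by apply/seteqP; split => w /WcylP.
  by apply/seteqP; split => w //= /(congr1 size); rewrite size_mkseq => /esym.
by case: ifP => _ //; exact: measurable_Wcyl.
Qed.

Definition absorbing w := forall k, w k = None -> w k.+1 = None.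

Lemma measurable_inW : measurable (@inW S : set W).
Proof.
rewrite (_ : @inW S = ~` [set w : nat -> option S | w 0%N = None] `&`
  \bigcap_k (~` [set w | w k = None] `|` [set w | w k.+1 = None])).
  apply: measurableI; first by apply: measurableC; exact: measurable_coord.
  apply: bigcap_countType_measurable => k _; apply: measurableU; last exact: measurable_coord.
  by apply: measurableC; exact: measurable_coord.
apply/seteqP; split=> w [w0 H]; split=> // k.
- by move=> _; have [/H|] := pselect (w k = None); [right|left].
- by move=> wk; have [|] := H k I.
Qed.

Lemma absorbing_le w i j : absorbing w -> (i <= j)%N -> w i = None -> w j = None.
Proof.
move=> aw /subnK <-; elim: (j - i)%N => [//|n IH] wi.
by rewrite addSn aw// IH.
Qed.

Definition wshift n w : nat -> option S := fun k => w (n + k)%N.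

Lemma mkseq_add n m w : mkseq w (n + m) = mkseq w n ++ mkseq (wshift n w) m.
Proof.
rewrite /mkseq iotaD map_cat; congr (_ ++ _).
by rewrite add0n -{1}[n]addn0 iotaDl -map_comp.
Qed.

Lemma absorbing_shift n w : absorbing w -> absorbing (wshift n w).
Proof. by move=> aw k; rewrite /wshift addnS; exact: aw. Qed.

Lemma map_Some_inj : injective (map (@Some S)).
Proof. by apply: inj_map => x y []. Qed.

(** Index [n] stands for time [-n], so the least index in [B] is the latest visit; the word [z :: s]
    runs forwards in time, whence the reversal. *)
Lemma first_visit B w : absorbing w -> (exists n y, w n = Some y /\ B y) ->
  exists z s, [/\ B z, avoids B s & mkseq w (size s).+1 = map Some (rev (z :: s))].
Proof.
move=> aw [n [y [wn By]]].
pose P k := if w k is Some u then u \in B else false.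
have exP : exists k, P k by exists n; rewrite /P wn; exact: mem_set.
pose m := ex_minn exP.
have [Pm minm] : P m /\ forall k, P k -> (m <= k)%N by rewrite /m; case: ex_minnP.
have : exists z, w m = Some z /\ B z by move: Pm; rewrite /P; case: (w m) => // z /set_mem; exists z.
move=> [z [wm Bz]].
have [s es] : exists s, mkseq w m = map Some (rev s).
  exists (rev (pmap id (mkseq w m))); rewrite revK.
  have : all isSome (mkseq w m).
    apply/allP => _ /mapP[k + ->]; rewrite mem_iota /= add0n => km.
    case e : (w k) => //; have := absorbing_le aw (ltnW km) e; by rewrite wm.
  by elim: (mkseq w m) => //= -[a|//] l IH /= /IH <-.
have sm : size s = m by have := congr1 size es; rewrite size_mkseq size_map size_rev.
exists z, s; split => //.
  rewrite /avoids /= -all_rev; apply/(all_nthP z) => i; rewrite size_rev sm => im.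
  have : nth None (mkseq w m) i = Some (nth z (rev s) i).
    by rewrite es (nth_map z)// size_rev sm.
  rewrite nth_mkseq// => wi; apply/negP => Bi.
  by have := minm i; rewrite /P wi => /(_ Bi); rewrite leqNgt im.
by rewrite sm -addn1 mkseq_add es rev_cons map_rcons -cats1 /mkseq /= /wshift addn0 wm.
Qed.

Lemma mkseq_last w z s : mkseq w (size s).+1 = map Some (rev (z :: s)) ->
  w (size s) = Some z.
Proof.
move=> /(congr1 (fun l => nth None l (size s))); rewrite nth_mkseq// => ->.
by rewrite (nth_map z) ?size_rev//= nth_rev//= subnn.
Qed.

Lemma mkseq_nth w z s i : mkseq w (size s).+1 = map Some (rev (z :: s)) ->
  (i < size s)%N -> exists2 a, a \in s & w i = Some a.
Proof.
move=> e im; exists (nth z (rev s) i).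
  by rewrite -(mem_rev s) mem_nth ?size_rev.
have := congr1 (fun l => nth None l i) e.
rewrite nth_mkseq; last exact: ltnW.
by rewrite rev_cons (nth_map z) ?size_rcons ?size_rev ?ltnS ?(ltnW im)// nth_rcons size_rev im.
Qed.

Lemma first_visit_uniq B w z s z' s' : B z -> avoids B s -> B z' -> avoids B s' ->
  mkseq w (size s).+1 = map Some (rev (z :: s)) ->
  mkseq w (size s').+1 = map Some (rev (z' :: s')) -> z = z' /\ s = s'.
Proof.
move=> Bz As Bz' As' e e'.
have H u v a b : B a -> avoids B v -> mkseq w (size u).+1 = map Some (rev (a :: u)) ->
    mkseq w (size v).+1 = map Some (rev (b :: v)) -> ~ (size u < size v)%N.
  move=> Ba Av eu ev uv; have [c cv] := mkseq_nth ev uv; rewrite (mkseq_last eu) => -[ac].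
  by move/allP: Av => /(_ c cv); rewrite -ac mem_set.
have ss : size s = size s'.
  by case: (ltngtP (size s) (size s')) => // [/(H _ _ _ _ Bz As' e e')|/(H _ _ _ _ Bz' As e' e)].
have /map_Some_inj/(congr1 rev) : map Some (rev (z :: s)) = map Some (rev (z' :: s')).
  by rewrite -e -e' ss.
by rewrite !revK => -[].
Qed.

(** The word [x :: r] is spelled forwards, from time [- size r] to time 0; the path may or may not
    be alive before. *)
Definition cylW x r : set W :=
  [set w | inW w /\ mkseq w (size r).+1 = map Some (rev (x :: r))].

Definition pastW B x r : set W :=
  cylW x r `&` [set w | forall j, (size r < j)%N -> forall y, w j = Some y -> ~ B y].

Lemma measurable_cylW x r : measurable (cylW x r).
Proof. by apply: measurableI; [exact: measurable_inW|exact: measurable_mkseq]. Qed.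

Lemma measurable_avoid B (P : nat -> Prop) :
  measurable ([set w | forall j, P j -> forall y, w j = Some y -> ~ B y] : set W).
Proof.
rewrite (_ : [set w | _] = \bigcap_(j in P) \bigcap_(y in B) ~` [set w | w j = Some y]).
  apply: bigcap_countType_measurable => j _; apply: bigcap_countType_measurable => y _.
  by apply: measurableC; exact: measurable_coord.
apply/seteqP; split=> w H j Pj y.
- by move=> By /= wj; exact: H wj By.
- by move=> wj By; exact: (H j Pj y By).
Qed.

Lemma measurable_pastW B x r : measurable (pastW B x r).
Proof. by apply: measurableI; [exact: measurable_cylW|exact: measurable_avoid]. Qed.

Lemma cylW_cat x r z s w : cylW z (rcons s x ++ r) w <->
  [/\ cylW x r w & mkseq (wshift (size r).+1 w) (size s).+1 = map Some (rev (z :: s))].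
Proof.
rewrite /cylW /=.
have -> : (size (rcons s x ++ r)).+1 = ((size r).+1 + (size s).+1)%N.
  by rewrite size_cat size_rcons addnC -addSn.
have -> : rev (z :: rcons s x ++ r) = rev (x :: r) ++ rev (z :: s).
  by rewrite -rev_cat /= cat_rcons.
rewrite mkseq_add map_cat; split.
  move=> [iw /eqP]; rewrite eqseq_cat ?size_mkseq ?size_map ?size_rev//.
  by move=> /andP[/eqP e1 /eqP e2].
by move=> [[iw ->] ->].
Qed.

(** Split by the last visit to [B] before time [- size r]: either there is none, or the path comes
    from some [z] in [B] through a word [s] off [B]. *)
Lemma cylW_decomp B x r : cylW x r =
  pastW B x r `|` \bigcup_(k in B `*` avoids B) cylW k.1 (rcons k.2 x ++ r).
Proof.
apply/seteqP; split => [w cw|w [[]//|[[z s] _] /cylW_cat[]]//].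
have [H|H] := pselect (exists n y, wshift (size r).+1 w n = Some y /\ B y).
  have [[_ aw] _] := cw.
  have [z [s [Bz As e]]] := first_visit (absorbing_shift aw) H.
  by right; exists (z, s) => //; apply/cylW_cat.
left; split => // j rj y wj By; apply: H; exists (j - (size r).+1)%N, y.
by rewrite /wshift subnKC.
Qed.

Lemma cylW_decomp_disj B x r :
  trivIset (B `*` avoids B) (fun k => cylW k.1 (rcons k.2 x ++ r)).
Proof.
move=> [z s] [z' s'] [/= Bz As] [/= Bz' As'] [w [/cylW_cat[_ e] /cylW_cat[_ e']]].
by have [-> ->] := first_visit_uniq Bz As Bz' As' e e'.
Qed.

Lemma cylW_decomp_disj2 B x r : pastW B x r `&`
  \bigcup_(k in B `*` avoids B) cylW k.1 (rcons k.2 x ++ r) = set0.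
Proof.
apply/seteqP; split => // w [[_ H] [[z s] [/= Bz As] /cylW_cat[_ e]]].
by apply: (H _ _ _ (mkseq_last e) Bz); rewrite addSn ltnS leq_addr.
Qed.

(** For one-sided paths, the convergence to the cemetery at minus infinity that [inD] demands;
    automatic for a path with a birth time. *)
Definition transW : set W := [set w | forall x, exists N, forall k, (N <= k)%N -> w k <> Some x].

Lemma measurable_transW : measurable transW.
Proof.
rewrite (_ : transW = \bigcap_(x in [set: S]) \bigcup_N \bigcap_(k in [set k | (N <= k)%N]) ~` [set w | w k = Some x]).
  apply: bigcap_countType_measurable => x _; apply: bigcupT_measurable => N.
  apply: bigcap_countType_measurable => k _; apply: measurableC; exact: measurable_coord.
apply/seteqP; split=> w H x.
- by move=> _; have [N HN] := H x; exists N.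
- by have [N _ HN] := H x I; exists N.
Qed.

End path_space.

(** * Masses of path events under a Kuznetsov measure *)

Section kuznetsov.
Context {R : realType} {S : countType} (p : S -> S -> R) (d : S -> nat -> R).
Hypothesis q0 : forall x y, 0 <= qm p d x y.
Hypothesis goo : forall x y, gm p d x y < +oo.
Variable nu : S -> R.
Hypothesis nu0 : forall x, (0 <= nu x)%R.
Local Notation q := (qm p d).
Local Notation qc := (qchain p d).
Local Notation g := (gm p d).
Variable K : {measure set (@Wspace S) -> \bar R}.
Hypothesis HK : is_Kuznetsov p d nu K.
Implicit Types (w : nat -> option S) (x y z : S) (r s t : seq S) (B : set S).

Lemma Kuz_cylW x r : K (cylW x r) = (nu x)%:E * qc x r.
Proof.
have [_ [_ <-]] := HK; congr (K _).
have e i : (i <= size r)%N -> nth None (map Some (rev (x :: r))) i = Some (nth x (rev (x :: r)) i).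
  by move=> ir; rewrite (nth_map x)// size_rev.
apply/seteqP; split => w [iw H]; split => //.
  move=> i ir; have := congr1 (fun l => nth None l i) H.
  by rewrite nth_mkseq// e.
apply: (@eq_from_nth _ None); first by rewrite size_mkseq size_map size_rev.
by move=> i; rewrite size_mkseq => ir; rewrite nth_mkseq// H// e.
Qed.

(** The mass of [cylW_decomp], left in additive form; the subtraction that produces [escape] waits
    until the sums are known to be finite. *)
Lemma Kuz_pastW_taboo B x r :
  K (pastW B x r) + (\esum_(z in B) ((nu z)%:E * taboo p d B z x)) * qc x r = (nu x)%:E * qc x r.
Proof.
rewrite -Kuz_cylW (cylW_decomp B) measureU.
- congr (_ + _); rewrite [RHS](@measure_bigcup_esum _ _ _ K (S * seq S)%type (B `*` avoids B) (fun k => cylW k.1 (rcons k.2 x ++ r))).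
  + rewrite -esumZr ?qchain_ge0//; last by move=> *; rewrite mule_ge0 ?lee_fin ?taboo_ge0.
    under eq_esum => z _.
      rewrite /taboo -muleA -esumZr ?qchain_ge0//; last by move=> *; exact: qchain_ge0.
      rewrite -esumZl ?lee_fin//; last by move=> *; rewrite mule_ge0 ?qchain_ge0.
      over.
    rewrite esum_esum.
      apply: eq_esum => -[z s] _ /=.
      by rewrite Kuz_cylW qchain_cat// last_rcons.
    by move=> *; rewrite mule_ge0 ?lee_fin// mule_ge0// qchain_ge0.
  + by move=> *; exact: measurable_cylW.
  + exact: cylW_decomp_disj.
- exact: measurable_pastW.
- by apply: bigcup_countType_measurable => *; exact: measurable_cylW.
- exact: cylW_decomp_disj2.
Qed.

Lemma Kuz_coord k x z :
  K [set w | [/\ inW w, w 0%N = Some z & w k = Some x]] = (nu x)%:E * Qpow p d k x z.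
Proof.
rewrite Qpow_qchain// -esumZl ?lee_fin//; last by move=> *; exact: qchain_ge0.
under eq_esum => t _ do rewrite -Kuz_cylW.
rewrite -measure_bigcup_esum.
- congr (K _); apply/seteqP; split=> w.
    move=> [iw w0 wk].
    have aw := iw.2.
    have [t et] : exists t, mkseq w k = map Some (rev t).
      exists (rev (pmap id (mkseq w k))); rewrite revK.
      have : all isSome (mkseq w k).
        apply/allP => _ /mapP[i + ->]; rewrite mem_iota /= add0n => km.
        case e : (w i) => //; have := absorbing_le aw (ltnW km) e; by rewrite wk.
      by elim: (mkseq w k) => //= -[a|//] l IH /= /IH <-.
    have sm : size t = k by have := congr1 size et; rewrite size_mkseq size_map size_rev.
    have e : mkseq w (size t).+1 = map Some (rev (x :: t)).
      by rewrite sm -addn1 mkseq_add et rev_cons map_rcons -cats1 /mkseq /= /wshift addn0 wk.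
    exists t => //; split => //.
    have := congr1 (fun l => nth None l 0) e; rewrite nth_mkseq// w0.
    by rewrite (nth_map x) ?size_rev// lastI rev_rcons /= => -[].
  move=> [t [tk tz] [iw e]]; split => //; last by rewrite -tk (mkseq_last e).
  have := congr1 (fun l => nth None l 0) e; rewrite nth_mkseq// => ->.
  by rewrite (nth_map x) ?size_rev// lastI rev_rcons /= tz.
- by move=> *; exact: measurable_cylW.
- move=> t t' [st _] [st' _] [w [[_ e] [_ e']]].
  have /map_Some_inj/(congr1 rev) : map Some (rev (x :: t)) = map Some (rev (x :: t')).
    by rewrite -e -e' st st'.
  by rewrite !revK => -[].
Qed.

(** Borel-Cantelli. For a fixed position [z] at time 0, the masses of being at [x] at time [-k] add
    up over [k] to [nu x * g x z], which is finite; so almost no path ending in [z] is at [x]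
    infinitely often. The pairs are countable. *)
Lemma Kuz_transW : K (~` transW) = 0.
Proof.
have [N0 _] := HK.
pose F z x k : set (@Wspace S) := [set w | [/\ inW w, w 0%N = Some z & w k = Some x]].
have mF z x k : measurable (F z x k).
  rewrite (_ : F z x k = @inW S `&` ([set w | w 0%N = Some z] `&` [set w | w k = Some x])).
    by apply: measurableI; [exact: measurable_inW|apply: measurableI; exact: measurable_coord].
  by apply/seteqP; split => w /=; [case|move=> [? []]].
have mL z x : measurable (lim_sup_set (F z x)).
  by apply: bigcapT_measurable => n; apply: bigcup_measurable.
have L0 z x : K (lim_sup_set (F z x)) = 0.
  apply: lim_sup_set_cvg0 => //.
  rewrite nneseries_esumT//.
  under eq_esum => k _ do rewrite Kuz_coord.
  rewrite esumZl ?lee_fin//; last by move=> k _; rewrite Qpow_qchain//; apply: esum_ge0 => *; exact: qchain_ge0.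
  have := goo x z; rewrite /gm.
  have : 0 <= g x z by exact: gm_ge0.
  rewrite /gm; case: (esum _ _) => // b _ _; exact: ltry.
apply/eqP; rewrite eq_le measure_ge0 andbT.
have N0' : K (~` @inW S `|` \bigcup_(k in [set: S * S]) lim_sup_set (F k.1 k.2)) = 0.
  apply/eqP; rewrite eq_le measure_ge0 andbT.
  apply: le_trans (measureU2 _ _ _) _.
  - by apply: measurableC; exact: measurable_inW.
  - by apply: bigcup_countType_measurable => *.
  - rewrite [X in X + _]N0 add0e.
    by rewrite [leLHS](@measure0_bigcup _ _ _ K (S * S)%type setT (fun k => lim_sup_set (F k.1 k.2)))// => *.
rewrite -N0'; apply: le_measure; rewrite ?inE.
- by apply: measurableC; exact: measurable_transW.
- apply: measurableU; first by apply: measurableC; exact: measurable_inW.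
  by apply: bigcup_countType_measurable => *.
- move=> w nT; have [iw|] := pselect (inW w); last by left.
  right; move/existsNP: nT => [x /forallNP nx].
  case e0 : (w 0%N) => [z|]; last by have := iw.1.
  exists (z, x) => // n _ /=; have /existsNP[k /not_implyP[nk /contrapT wk]] := nx n.
  by exists k.
Qed.

End kuznetsov.

(** * Uniqueness of the Kuznetsov measure *)

Section kuznetsov_uniqueness.
Context {R : realType} {S : countType} (p : S -> S -> R) (d : S -> nat -> R).
Variables (nu : S -> R) (K1 K2 : {measure set (@Wspace S) -> \bar R}).
Hypothesis HK1 : is_Kuznetsov p d nu K1.
Hypothesis HK2 : is_Kuznetsov p d nu K2.

Lemma option_seq_cases (ys : seq (option S)) :
  (exists l, ys = map Some l) \/ exists l zs, ys = map Some l ++ None :: zs.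
Proof.
elim: ys => [|[a|] ys [[l ->]|[l [zs ->]]]].
- by left; exists [::].
- by left; exists (a :: l).
- by right; exists (a :: l), zs.
- by right; exists [::], (map Some l).
- by right; exists [::], (map Some l ++ None :: zs).
Qed.

Lemma Kuz_inW (K : {measure set (@Wspace S) -> \bar R}) A : is_Kuznetsov p d nu K ->
  measurable A -> K A = K (@inW S `&` A).
Proof.
move=> [N0 _] mA; rewrite setIC -[X in A `&` X]setCK measureI_null//.
by apply: measurableC; exact: measurable_inW.
Qed.

(** Words of states are decided by the marginals, and words of states followed only by [None] by the
    birth masses [nu_pot]; words with a state after a [None], or with [None] at time 0, miss [inW].
    The empty word is excluded because its cylinder is the whole space. *)
Lemma Kuz_Wcyl ys : ys <> [::] -> K1 (Wcyl ys) = K2 (Wcyl ys).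
Proof.
move=> y0; rewrite !(Kuz_inW (A := Wcyl ys))//; try exact: measurable_Wcyl.
have [[l e]|[l [zs e]]] := option_seq_cases ys.
  case/lastP: l e y0 => [->//|l x] -> _.
  have -> : @inW S `&` Wcyl (map Some (rcons l x)) = cylW x (rev l).
    rewrite /cylW size_rev rev_cons revK; apply/seteqP; split=> w [iw].
      by move/WcylP; rewrite size_map size_rcons.
    by move=> e; split => //; apply/WcylP; rewrite size_map size_rcons.
  by rewrite (Kuz_cylW HK1) (Kuz_cylW HK2).
case/lastP: l e y0 => [|l x] e _.
  rewrite e (_ : _ `&` _ = set0) ?measure0//; apply/seteqP; split => // w [[w0 _] /(_ 0%N isT)] /=.
  exact: w0.
have [zN|] := boolP (all (pred1 None) zs).
  have -> : @inW S `&` Wcyl ys = [set w | inW w /\ forall i, w i = nth None (map Some (rev (x :: rev l))) i].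
    rewrite rev_cons revK e; apply/seteqP; split=> w [iw H]; split => // i.
      have [il|li] := ltnP i (size (map Some (rcons l x))).
        rewrite H; first by rewrite nth_cat il.
        by rewrite size_cat (leq_trans il)// leq_addr.
      rewrite nth_default//; apply: (absorbing_le iw.2 li).
      by rewrite H; [rewrite nth_cat ltnn subnn|rewrite size_cat /= addnS ltnS leq_addr].
    move=> il; rewrite H nth_cat; case: ltnP => // li.
    rewrite [LHS]nth_default//; case: (i - _)%N => [//|k] /=.
    have [kz|kz] := ltnP k (size zs); last by rewrite nth_default.
    by move/all_nthP: zN => /(_ None k kz)/eqP.
  have [_ [-> _]] := HK1; by have [_ [-> _]] := HK2.
move=> /allPn[[a|//] /(nthP None)[k kz za] _].
rewrite (_ : _ `&` _ = set0) ?measure0//; apply/seteqP; split => // w [iw]; rewrite e => H.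
have HN : w (size (map Some (rcons l x))) = None.
  by rewrite H; [rewrite nth_cat ltnn subnn|rewrite size_cat /= addnS ltnS leq_addr].
have := absorbing_le iw.2 (leq_addr k.+1 _) HN.
rewrite H; last by rewrite size_cat ltn_add2l.
by rewrite nth_cat ltnNge leq_addr /= addKn /= za.
Qed.

Lemma Kuz_unique A : measurable A -> K1 A = K2 A.
Proof.
(* The empty word stays out of the pi-system; cylinders of length one have finite mass ([nu x], or 0
   for [None]) and cover the space. *)
pose G : set (set (@Wspace S)) := [set A | A = set0 \/ exists2 ys, ys <> [::] & A = Wcyl ys].
pose gk n : set (@Wspace S) := if pickle_inv n is Some a then Wcyl [:: a : option S] else set0.
move=> mA; apply: (g_sigma_algebra_measure_unique G _ gk) => //.
- by move=> _ [->|[ys _ ->]]; [exact: measurable0|exact: measurable_Wcyl].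
- by move=> n; rewrite /gk; case: pickle_inv => [a|]; [right; exists [:: a]|left].
- apply/seteqP; split => // w _; exists (pickle (w 0%N)) => //.
  by rewrite /gk pickleK_inv => -[].
- move=> _ _ [->|[ys y0 ->]] [->|[zs z0 ->]]; rewrite ?set0I ?setI0; try by left.
  have [sz|sz] := leqP (size ys) (size zs).
    have [e|ne] := eqVneq (take (size ys) zs) ys.
      right; exists zs => //; apply/seteqP; split => [w []//|w Hz]; split => // i iy.
      by rewrite Hz ?(leq_trans iy)// -[in RHS]e nth_take.
    left; apply/seteqP; split => // w [Hy Hz]; move/eqP: ne; apply.
    apply: (@eq_from_nth _ None) => [|i]; rewrite size_take_min (minn_idPl sz)// => iy.
    by rewrite nth_take// -Hy// Hz// (leq_trans iy).
  have [e|ne] := eqVneq (take (size zs) ys) zs.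
    right; exists ys => //; apply/seteqP; split => [w []//|w Hz]; split => // i iy.
    by rewrite Hz ?(leq_trans iy) ?(ltnW sz)// -[in RHS]e nth_take.
  left; apply/seteqP; split => // w [Hy Hz]; move/eqP: ne; apply.
  apply: (@eq_from_nth _ None) => [|i]; rewrite size_take_min (minn_idPl (ltnW sz))// => iy.
  by rewrite nth_take// -Hz// Hy// (leq_trans iy)// ltnW.
- by move=> _ [->|[ys y0 ->]]; [rewrite !measure0|exact: Kuz_Wcyl].
- move=> n; rewrite /gk; case: pickle_inv => [[x|]|]; last by rewrite measure0 ltry.
    rewrite (Kuz_inW HK1); last exact: measurable_Wcyl.
    rewrite (_ : _ `&` _ = cylW x [::]); last first.
      by apply/seteqP; split => w [iw]; [move/WcylP|move=> e; split => //; apply/WcylP].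
    by rewrite (Kuz_cylW HK1) /= mule1 ltry.
  rewrite (Kuz_inW HK1); last exact: measurable_Wcyl.
  rewrite (_ : _ `&` _ = set0) ?measure0 ?ltry//.
  by apply/seteqP; split => // w [[w0 _] /(_ 0%N isT)] /=; exact: w0.
- move: A mA; apply: smallest_sub; first exact: smallest_sigma_algebra.
  move=> _ [ys ->]; have [->|/eqP y0] := eqVneq ys [::].
    rewrite (_ : Wcyl [::] = setT); last by apply/seteqP; split.
    exact: (@measurableT _ (g_sigma_algebraType G)).
  by apply: sub_sigma_algebra; right; exists ys.
Qed.

End kuznetsov_uniqueness.

(** * Existence of the Kuznetsov measure *)

Section measure_constructions.
Context {R : realType}.

Lemma pushforward_ex d d' (T : measurableType d) (T' : measurableType d')
    (m : {measure set T -> \bar R}) (f : T -> T') : measurable_fun setT f ->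
  exists M : {measure set T' -> \bar R}, forall A, M A = m (f @^-1` A).
Proof.
move=> mf.
by exists (measure_function_pushforward__canonical__measure_function_Measure m mf).
Qed.

Lemma measure_mix_ex d (T : measurableType d) (I : countType) (c : I -> R)
    (m : I -> {measure set T -> \bar R}) : (forall i, 0 <= c i)%R ->
  exists M : {measure set T -> \bar R}, forall A, M A = \esum_(i in [set: I]) (c i)%:E * m i A.
Proof.
move=> c0.
pose F n : {measure set T -> \bar R} :=
  if pickle_inv n is Some i then mscale (NngNum (c0 i)) (m i) else mzero.
exists (mseries F 0) => A; change (\sum_(n <oo) F n A = \esum_(i in [set: I]) (c i)%:E * m i A).
rewrite nneseries_esumT//.
rewrite (esumID (pickle @` [set: I]))// setTI.
rewrite [X in _ + X]esum1 ?adde0.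
  rewrite esum_image; last by move=> x y _ _; exact: (pcan_inj pickleK).
  by apply: eq_esum => i _; rewrite /F pickleK_inv.
move=> n [_ nI]; rewrite /F; case e : (pickle_inv n) => [i|//]; case: nI; exists i => //.
by have := @pickle_invK I n; rewrite /= /oapp e.
Qed.

End measure_constructions.

(* A trajectory of a Markov chain is read off a uniform u in [0,1[: the unit interval is cut
   into pieces of lengths k a b, and the relative position of u in its piece drives the rest.
   Cylinders then correspond to intervals. *)
Section nested_intervals.
Context {R : realType} {T : countType} (k : T -> T -> R).
Hypothesis k0 : forall a b, (0 <= k a b)%R.
Hypothesis k1 : forall a, \esum_(b in [set: T]) (k a b)%:E = 1.

Let kn a n : R := if pickle_inv n is Some b then k a b else 0%R.
Let cumn a n : R := (\sum_(0 <= i < n) kn a i)%R.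
Let cum a (b : T) := cumn a (pickle b).
Definition in_piece a b (u : R) := (cum a b <= u < cum a b + k a b)%R.

Let kn0 a n : (0 <= kn a n)%R.
Proof. by rewrite /kn; case: pickle_inv. Qed.

Let cumn_le a : {homo cumn a : m n / (m <= n)%N >-> (m <= n)%R}.
Proof.
move=> m n mn; rewrite /cumn [leRHS](big_cat_nat (n := m))//= lerDl sumr_ge0//.
Qed.

Let cumnS a b : cumn a (pickle b).+1 = (cum a b + k a b)%R.
Proof. by rewrite /cumn big_nat_recr//= /kn pickleK_inv. Qed.

Let kn_sum a : \sum_(n <oo) (kn a n)%:E = 1.
Proof.
rewrite nneseries_esumT; last by move=> n; rewrite lee_fin.
rewrite (esumID (pickle @` [set: T])) ?setTI; last by move=> n _; rewrite lee_fin.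
rewrite [X in _ + X]esum1 ?adde0.
  rewrite esum_image; last by move=> x y _ _; exact: (pcan_inj pickleK).
  by rewrite -(k1 a); apply: eq_esum => i _; rewrite /kn pickleK_inv.
move=> n nI; rewrite /kn; case e : (pickle_inv n) => [i|//]; case: nI; exists i => //.
by have := @pickle_invK T n; rewrite /= /oapp e.
Qed.

Let cumn_le1 a n : (cumn a n <= 1)%R.
Proof.
rewrite -lee_fin -(kn_sum a) /cumn -sumEFin.
by apply: nneseries_lim_ge => i _; rewrite lee_fin.
Qed.

Lemma in_piece_uniq a b b' u : in_piece a b u -> in_piece a b' u -> b = b'.
Proof.
have H c c' : in_piece a c u -> in_piece a c' u -> ~ (pickle c < pickle c')%N.
  move=> /andP[_ uc] /andP[cu _] cc.
  have := lt_le_trans uc (le_trans _ cu); rewrite ltxx => F.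
  suff // : false by []. 
  by apply: F; rewrite -cumnS; exact: cumn_le.
move=> h h'; apply: (pcan_inj pickleK).
by case: (ltngtP (pickle b) (pickle b')) => // [/(H _ _ h h')|/(H _ _ h' h)].
Qed.

(** The cumulated lengths tend to 1, so some partial sum exceeds [u]. The least such index ends the
    piece of [u]; its length is positive, hence the index is the code of a state. *)
Lemma in_piece_cover a u : (0 <= u < 1)%R -> exists b, in_piece a b u.
Proof.
move=> /andP[u0 u1].
have [N uN] : exists N, (u < cumn a N)%R.
  apply: contrapT => /forallNP H.
  have : (1 : \bar R) <= u%:E.
    rewrite -(kn_sum a); apply: lime_le.
      by apply: is_cvg_nneseries => i _ _; rewrite lee_fin.
    apply: nearW => n; rewrite sumEFin lee_fin leNgt; apply/negP; exact: H.
  by rewrite lee_fin leNgt u1.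
have exN : exists n, (u < cumn a n)%R by exists N.
case: (ex_minnP exN) => -[|n] un minn.
  by move: un; rewrite /cumn big_geq// ltNge u0.
have nu : (cumn a n <= u)%R by rewrite leNgt; apply/negP => /minn; rewrite ltnn.
have : (0 < kn a n)%R.
  by have := le_lt_trans nu un; rewrite /cumn big_nat_recr//= ltrDl.
rewrite /kn; case e : (pickle_inv n) => [b|]; last by rewrite ltxx.
have pb : pickle b = n by have := @pickle_invK T n; rewrite /= /oapp e.
by move=> _; exists b; rewrite /in_piece -cumnS /cum pb nu.
Qed.

Lemma in_piece_unit a b u : in_piece a b u -> (0 <= u < 1)%R.
Proof.
move=> /andP[bu ub]; apply/andP; split.
  by apply: le_trans bu; rewrite /cum /cumn sumr_ge0.
by apply: lt_le_trans ub _; rewrite -cumnS.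
Qed.

Definition piece a u : T := xget a [set b | in_piece a b u].
Definition piece_pos a u : R := ((u - cum a (piece a u)) / k a (piece a u))%R.

Lemma pieceE a b u : in_piece a b u -> piece a u = b.
Proof.
move=> H; rewrite /piece; case: xgetP => [c _ /= Hc|/(_ b)//].
exact: in_piece_uniq H.
Qed.

Fixpoint trajectory a u n : T :=
  if n is n'.+1 then trajectory (piece a u) (piece_pos a u) n' else a.

Fixpoint chain_weight a s : R :=
  if s is b :: s' then (k a b * chain_weight b s')%R else 1%R.

Lemma chain_weight_ge0 a s : (0 <= chain_weight a s)%R.
Proof. by elim: s a => [|b s IH] a //=; rewrite mulr_ge0. Qed.

Lemma chain_weight_rcons a s b :
  chain_weight a (rcons s b) = (chain_weight a s * k (last a s) b)%R.
Proof. by elim: s a => [|c s IH] a /=; rewrite ?mulr1 ?mul1r// IH mulrA. Qed.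

Lemma mkseq_trajectory a u n : mkseq (trajectory a u) n.+1 =
  a :: mkseq (trajectory (piece a u) (piece_pos a u)) n.
Proof. by rewrite /mkseq /= -[1%N]addn0 iotaDl -map_comp. Qed.

(** On the piece of [b] the map [piece_pos a] is affine onto the unit interval, so the interval of
    the remaining word, starting at [L], pulls back to one starting at [cum a b + k a b * L], with
    length scaled by [k a b]. *)
Lemma trajectory_interval s a : exists L, forall u,
  ((0 <= u < 1)%R /\ mkseq (trajectory a u) (size s).+1 = a :: s) <->
  (L <= u < L + chain_weight a s)%R.
Proof.
elim: s a => [|b s IH] a.
  by exists 0%R => u /=; rewrite add0r; split => [[]|].
have [L HL] := IH b; exists (cum a b + k a b * L)%R => u; rewrite mkseq_trajectory [chain_weight _ _]/=.
have pos : in_piece a b u -> (0 < k a b)%R.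
  by move=> /andP[x y]; have := le_lt_trans x y; rewrite ltrDl.
have posE : in_piece a b u -> (L <= piece_pos a u < L + chain_weight b s)%R =
   (cum a b + k a b * L <= u < cum a b + k a b * L + k a b * chain_weight b s)%R.
  move=> H; have kp := pos H; rewrite /piece_pos (pieceE H).
  rewrite ler_pdivlMr// ltr_pdivrMr// lerBrDl ltrBlDl.
  by rewrite [(L * _)%R]mulrC [((L + _) * _)%R]mulrC mulrDr addrA.
split.
  move=> [u01 e0].
  have e : mkseq (trajectory (piece a u) (piece_pos a u)) (size s).+1 = b :: s := congr1 behead e0.
  have pb : piece a u = b := congr1 (head a) e.
  have [b' Hb'] := in_piece_cover a u01; have Hb : in_piece a b u by rewrite -pb (pieceE Hb').
  rewrite -posE//; apply/HL; rewrite -pb e; split => //; last by rewrite pb.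
  have kp := pos Hb; rewrite /piece_pos pb ler_pdivlMr// ltr_pdivrMr// mul0r mul1r.
  by move: Hb => /andP[x y]; rewrite subr_ge0 x ltrBlDl.
move=> Hu.
(* A piece of length 0 would make the half-open interval containing [u] empty. *)
have kp : (0 < k a b)%R.
  rewrite lt_neqAle k0 andbT eq_sym; apply/eqP => kz.
  by move: Hu; rewrite kz !mul0r !addr0 => /andP[x /(le_lt_trans x)]; rewrite ltxx.
have : (L <= (u - cum a b) / k a b < L + chain_weight b s)%R.
  rewrite ler_pdivlMr// ltr_pdivrMr// lerBrDl ltrBlDl.
  by rewrite [(L * _)%R]mulrC [((L + _) * _)%R]mulrC mulrDr addrA.
move=> /HL[v01 e].
have Hb : in_piece a b u.
  move: v01; rewrite ler_pdivlMr// ltr_pdivrMr// mul0r mul1r subr_ge0 ltrBlDl.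
  by rewrite /in_piece.
split; first exact: in_piece_unit Hb.
by rewrite /piece_pos (pieceE Hb) e.
Qed.

End nested_intervals.

Section markov_measure.
Context {R : realType} {S : countType} (k : option S -> option S -> R).
Hypothesis k0 : forall a b, (0 <= k a b)%R.
Hypothesis k1 : forall a, \esum_(b in [set: option S]) (k a b)%:E = 1.

(** The law of [trajectory] under Lebesgue measure on the unit interval: the mass of a cylinder is
    the length of its interval. *)
Lemma markov_measure_ex (a : option S) :
  exists M : {measure set (@Wspace S) -> \bar R},
    (forall s, M (Wcyl (a :: s)) = (chain_weight k a s)%:E) /\
    (forall b s, b <> a -> M (Wcyl (b :: s)) = 0).
Proof.
(* [f] has to be measurable on the whole line. Outside the unit interval, which has no mass for the
   restricted measure, it is constant; so preimages of cylinders are treated inside and outside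
   separately. *)
pose f (u : measurableTypeR R) : @Wspace S :=
  if (0 <= u < 1)%R then trajectory k a u else (fun=> a).
have fpre s : exists L, f @^-1` (Wcyl (a :: s)) `&` `[0%R, 1%R[ = `[L, (L + chain_weight k a s)%R[%classic.
  have [L HL] := trajectory_interval k0 k1 s a; exists L.
  apply/seteqP; split=> u /=; rewrite !in_itv /=.
    move=> [/WcylP + u01]; rewrite /f u01 => e.
    by apply/HL.
  by move=> /HL[u01 e]; split => //; apply/WcylP; rewrite /f u01.
have fpre0 b s : b <> a -> f @^-1` (Wcyl (b :: s)) = set0.
  move=> ba; apply/seteqP; split => // u /= /(_ 0%N isT) /=.
  by rewrite /f; case: ifP => _ /= ab; apply: ba.
have mitv (L L' : R) : measurable (`[L, L'[%classic : set (measurableTypeR R)) by exact: measurable_itv.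
have m01 := mitv 0%R 1%R.
have mf : measurable_fun setT f.
  apply: (@measurability _ _ (measurableTypeR R) (@Wspace S) setT f (@Wgen S) erefl).
  move=> _ [_ [ys ->] <-].
  rewrite setTI; case: ys => [|b s].
    by rewrite (_ : Wcyl [::] = setT) ?preimage_setT//; apply/seteqP; split.
  have [ba|/fpre0->//] := pselect (b = a); subst b.
  rewrite -(setUIDK (f @^-1` (Wcyl (a :: s))) `[0%R, 1%R[) .
  apply: measurableU; first by have [L ->] := fpre s.
  have [H|H] := pselect (Wcyl (a :: s) (fun=> a)).
    rewrite (_ : _ `\` _ = ~` `[0%R, 1%R[); first exact: measurableC.
    apply/seteqP; split => u; first by case.
    by move=> nu; split => //=; rewrite /f; move: nu; rewrite /= in_itv /=; case: ifP.
  rewrite (_ : _ `\` _ = set0)//; apply/seteqP; split => // u [/= + nu].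
  by rewrite /f; move: nu; rewrite /= in_itv /=; case: ifP.
have [M HM] := pushforward_ex (mrestr (@lebesgue_measure R) m01) mf.
exists M; split => [s|b s /fpre0 e].
  rewrite HM /= /mrestr; have [L ->] := fpre s.
  rewrite lebesgue_measure_itv /= lte_fin ltrDl.
  case: ifPn => [_|]; first by rewrite -EFinD addrAC subrr add0r.
  rewrite -leNgt => le0; congr EFin; apply/eqP; rewrite eq_le le0 andbT.
  by rewrite chain_weight_ge0.
by rewrite HM e measure0.
Qed.

End markov_measure.

(** * Time reversal with respect to [nu] *)

Section kuznetsov_existence.
Context {R : realType} {S : countType} (p : S -> S -> R) (d : S -> nat -> R).
Hypothesis q0 : forall x y, 0 <= qm p d x y.
Hypothesis qoo : forall x y, qm p d x y < +oo.
Variable nu : S -> R.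
Hypothesis nuE : Q_excessive p d nu.
Local Notation q := (qm p d).
Local Notation qc := (qchain p d).

Let nu0 x : (0 <= nu x)%R. Proof. by case: nuE. Qed.
Let qf x y : (0 <= fine (q x y))%R. Proof. exact: fine_ge0. Qed.
Let qfE x y : (fine (q x y))%:E = q x y.
Proof. by rewrite fineK// ge0_fin_numE. Qed.

Lemma measK_ge0 y : 0 <= measK nu q y.
Proof. by apply: esum_ge0 => x _; rewrite mule_ge0 ?lee_fin. Qed.

Lemma measK_fin y : measK nu q y \is a fin_num.
Proof. by rewrite ge0_fin_numE ?measK_ge0// (le_lt_trans (nuE.2 y))// ltry. Qed.

Lemma nu_pot_ge0 x : 0 <= nu_pot p d nu x.
Proof. by rewrite /nu_pot sube_ge0 ?nuE.2// measK_fin. Qed.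

Lemma nu_pot_fin x : nu_pot p d nu x \is a fin_num.
Proof. by rewrite /nu_pot fin_numB measK_fin. Qed.

Lemma nu_pot_sum x : nu_pot p d nu x + measK nu q x = (nu x)%:E.
Proof. by rewrite /nu_pot subeK// measK_fin. Qed.

(* time reversal of q with respect to nu, killed with probability nu_pot / nu *)
Definition reversed (a b : option S) : R :=
  match a, b with
  | Some x, Some y => if nu x == 0%R then 0%R else (nu y * fine (q y x) / nu x)%R
  | Some x, None => if nu x == 0%R then 1%R else (fine (nu_pot p d nu x) / nu x)%R
  | None, Some _ => 0%R
  | None, None => 1%R
  end.

Lemma reversed_ge0 a b : (0 <= reversed a b)%R.
Proof.
case: a b => [x|] [y|] //=; case: ifP => // _; rewrite divr_ge0 ?mulr_ge0//.
by rewrite fine_ge0// nu_pot_ge0.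
Qed.

Lemma esum_option (a : option S -> \bar R) : (forall b, 0 <= a b) ->
  \esum_(b in [set: option S]) a b = a None + \esum_(y in [set: S]) a (Some y).
Proof.
move=> a0; rewrite (esumID [set None])//; congr (_ + _).
  by rewrite setTI esum_set1.
rewrite setTI; apply: (esum_setbij (e := Some)) => //.
  by move=> x y _ _ [].
by move=> [y _|/(_ erefl)//]; exists y.
Qed.

Lemma reversed_sum a : \esum_(b in [set: option S]) (reversed a b)%:E = 1.
Proof.
rewrite esum_option; last by move=> b; rewrite lee_fin reversed_ge0.
case: a => [x|] /=; last by rewrite esum1 ?adde0.
have [_|nx] := eqVneq (nu x) 0%R; first by rewrite esum1 ?adde0.
have np : (0 < nu x)%R by rewrite lt_neqAle eq_sym nx nu0.
rewrite EFinM fineK ?nu_pot_fin//.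
under eq_esum => y _ do rewrite EFinM EFinM qfE.
rewrite esumZr ?lee_fin ?invr_ge0//; last by move=> y _; rewrite mule_ge0 ?lee_fin.
rewrite -ge0_muleDl ?nu_pot_ge0 ?measK_ge0//.
by rewrite nu_pot_sum -EFinM divff.
Qed.

(** Detailed balance. The convention made in [reversed] where [nu y = 0] does no harm: excessiveness
    then forces [nu x * q x y = 0] for every [x]. *)
Lemma nu_reversed x y : (nu y * reversed (Some y) (Some x) = nu x * fine (q x y))%R.
Proof.
rewrite /=; have [ny|ny] := eqVneq (nu y) 0%R; last by rewrite mulrC divfK.
rewrite mulr0; apply/esym/EFin_inj; rewrite EFinM qfE.
have H : measK nu q y = 0.
  apply/eqP; rewrite eq_le measK_ge0 andbT -[0]/(0%R%:E) -ny; exact: nuE.2.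
by apply: (esum_eq0 _ H) => // i _; rewrite mule_ge0 ?lee_fin.
Qed.

Lemma nu_reversed_pot x : (nu x * reversed (Some x) None = fine (nu_pot p d nu x))%R.
Proof.
rewrite /=; have [ny|ny] := eqVneq (nu x) 0%R; last by rewrite mulrC divfK.
rewrite mulr1 ny; apply/esym/EFin_inj; rewrite fineK ?nu_pot_fin//.
apply/eqP; rewrite eq_le nu_pot_ge0 andbT.
by rewrite -[leRHS]/(0%R%:E) -ny -(nu_pot_sum x) leeDl ?measK_ge0.
Qed.

Lemma Kuznetsov_exists : exists K : {measure set (@Wspace S) -> \bar R}, is_Kuznetsov p d nu K.
Proof.
(* The reversed chain is started at time 0 from each [x], and these laws are mixed with weights
   [nu x]. *)
have /choice[M HM] (x : S) := markov_measure_ex reversed_ge0 reversed_sum (Some x).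
have [K HK] := measure_mix_ex M nu0.
have HN s : K (Wcyl (None :: s)) = 0.
  by rewrite HK esum1// => x _; rewrite (HM x).2// mule0.
have HS x s : K (Wcyl (Some x :: s)) = (nu x * chain_weight reversed (Some x) s)%R%:E.
  rewrite HK (esum_single (x := x))//.
  - by rewrite (HM x).1 EFinM.
  - by rewrite mule_ge0 ?lee_fin.
  - by move=> y _ yx; rewrite (HM y).2 ?mule0// => -[/esym].
have HR a s b : K (Wcyl (rcons (a :: s) b)) = K (Wcyl (a :: s)) * (reversed (last a s) b)%:E.
  case: a => [x|]; last by rewrite rcons_cons !HN mul0e.
  by rewrite rcons_cons !HS chain_weight_rcons -EFinM mulrA.
(* Each reversed step from [y] to [x] trades [nu y] for [nu x * q x y], so the weight [nu] travels
   to the start of the word. *)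
have Hrev x r : K (Wcyl (map Some (rev (x :: r)))) = (nu x)%:E * qc x r.
  elim: r x => [|y r IH] x; first by rewrite HS /= mulr1 mule1.
  rewrite rev_cons map_rcons.
  have e0 := IH y; move: e0; case e : (map Some (rev (y :: r))) => [|a s] e0.
    by move/(congr1 size): e; rewrite size_map size_rev.
  rewrite HR e0.
  have -> : last a s = Some y.
    by have := congr1 (last None) e; rewrite rev_cons map_rcons last_rcons /= => <-.
  by rewrite muleAC -EFinM nu_reversed EFinM qfE -muleA.
(* A path fails to be in [inW] by being at the cemetery at time 0 or by showing a state right after
   a [None]; both kinds of cylinders have weight 0. *)
have KN0 : K (~` @inW S) = 0.
  rewrite (_ : ~` _ = Wcyl [:: None] `|` \bigcup_(k in [set: S * seq (option S)]) Wcyl (rcons (rcons k.2 None) (Some k.1))).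
    apply/eqP; rewrite eq_le measure_ge0 andbT.
    apply: le_trans (measureU2 _ _ _) _.
    - exact: measurable_Wcyl.
    - by apply: bigcup_countType_measurable => *; exact: measurable_Wcyl.
    - rewrite [X in X + _]HN add0e.
      rewrite [leLHS](@measure0_bigcup _ _ _ K (S * seq (option S))%type setT (fun k => Wcyl (rcons (rcons k.2 None) (Some k.1))))//.
        by move=> *; exact: measurable_Wcyl.
      by move=> [x [|a s]] _ /=; rewrite ?HN// HR last_rcons /= mule0.
  apply/seteqP; split=> w.
    move=> nW; have [w0|w0] := pselect (w 0%N = None).
      by left => -[|//] _.
    right; have /existsNP[n /not_implyP[wn]] : ~ forall n, w n = None -> w n.+1 = None.
      by move=> H; apply: nW; split.
    case e : (w n.+1) => [x|//] _; exists (x, mkseq w n) => //=.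
    apply/WcylP; rewrite !size_rcons size_mkseq /mkseq -!cats1.
    rewrite -addn2 iotaD map_cat -catA /= add0n wn.
    by rewrite e.
  move=> [/(_ 0%N isT)/= w0 [//]|[[x s] _ /= H] [_ aw]].
  have w1 := H (size s); have w2 := H (size s).+1.
  move: w1 w2; rewrite !size_rcons !nth_rcons !size_rcons ltnn eqxx !ltnS leqnn ltnn eqxx.
  move=> /(_ (leqnSn _)) w1 /(_ isT).
  by rewrite (aw _ w1).
have KI (A : set (@Wspace S)) : measurable A -> K (@inW S `&` A) = K A.
  move=> mA; rewrite setIC -[X in A `&` X]setCK measureI_null//.
  by apply: measurableC; exact: measurable_inW.
exists K; split => //; split => x r.
  (* Birth at [x] means [None] at the next index, a reversed step whose cost turns [nu x] into
     [nu_pot]. *)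
  rewrite (_ : [set w | _] = @inW S `&` Wcyl (rcons (map Some (rev (x :: r))) None)).
    rewrite KI; last exact: measurable_Wcyl.
    have e0 := Hrev x r; move: e0; case e : (map Some (rev (x :: r))) => [|a s] e0.
      by move/(congr1 size): e; rewrite size_map size_rev.
    rewrite HR e0.
    have -> : last a s = Some x.
      by have := congr1 (last None) e; rewrite rev_cons map_rcons last_rcons /= => <-.
    by rewrite muleAC -EFinM nu_reversed_pot fineK ?nu_pot_fin.
  apply/seteqP; split=> w [iw H]; split => // i.
    move=> _; rewrite H nth_rcons; case: ltnP => // il.
    by rewrite nth_default//; case: ifP.
  have [il|il] := ltnP i (size (map Some (rev (x :: r)))).
    by rewrite H; [rewrite nth_rcons il|rewrite size_rcons ltnW].
  rewrite nth_default//; apply: (absorbing_le iw.2 il).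
  by rewrite H; [rewrite nth_rcons ltnn eqxx|rewrite size_rcons].
rewrite -Hrev -KI; last exact: measurable_Wcyl.
congr (K _); apply/seteqP; split=> w [iw H]; split => // i.
  rewrite size_map size_rev /= ltnS => ir.
  by rewrite H// (nth_map x)// size_rev.
move=> ir; rewrite H; last by rewrite size_map size_rev.
by rewrite (nth_map x)// size_rev.
Qed.

End kuznetsov_existence.

(** * Balayage *)

Local Notation elts B := (finmap.enum_fset (fset_set B)).

Section finite_sums.
Context {R : realType} {T : choiceType}.

Lemma esum_finite_real (B : set T) (a : T -> R) : finite_set B ->
  (forall x, B x -> 0 <= a x)%R ->
  \esum_(x in B) (a x)%:E = (\sum_(x <- elts B) a x)%R%:E.
Proof.
move=> fB a0; rewrite esum_fset//; last by move=> x /[!inE] /a0; rewrite lee_fin.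
by rewrite fsbig_finite//= sumEFin.
Qed.

Lemma eq_sum_finite (B : set T) (a b : T -> R) : finite_set B ->
  (forall x, B x -> a x = b x) ->
  (\sum_(x <- elts B) a x = \sum_(x <- elts B) b x)%R.
Proof.
by move=> fB ab; apply: eq_big_seq => x; rewrite in_fset_set// inE; exact: ab.
Qed.

Lemma sum_finite_ge0 (B : set T) (a : T -> R) : finite_set B ->
  (forall x, B x -> 0 <= a x)%R -> (0 <= \sum_(x <- elts B) a x)%R.
Proof.
by move=> fB a0; rewrite big_seq sumr_ge0// => x; rewrite in_fset_set// inE; exact: a0.
Qed.

Lemma sum_finite_delta (B : set T) (a : T -> R) x : finite_set B ->
  (\sum_(w <- elts B) a w * (w == x)%:R = if x \in B then a x else 0)%R.
Proof.
move=> fB; case: ifPn => xB; last first.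
  rewrite big_seq big1// => w; rewrite in_fset_set// => wB.
  by case: eqP => [wx|]; rewrite ?mulr0//; rewrite wx (negPf xB) in wB.
rewrite (bigD1_seq x) ?finmap.fset_uniq ?in_fset_set//= eqxx mulr1 big1 ?addr0// => w /negPf ->.
by rewrite mulr0.
Qed.

End finite_sums.

Section balayage.
Context {R : realType} {S : countType} (p : S -> S -> R) (d : S -> nat -> R).
Hypothesis q0 : forall x y, 0 <= qm p d x y.
Hypothesis goo : forall x y, gm p d x y < +oo.
Implicit Types (B : set S) (x y z : S) (nu mu e : S -> R).
Local Notation q := (qm p d).
Local Notation g := (gm p d).
Let gr x y : R := fine (g x y).
Let tr B x y : R := fine (taboo p d B x y).
Let er B x y : R := fine (entrance p d B x y).
Let qr x y : R := fine (q x y).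

Let grE x y : g x y = (gr x y)%:E.
Proof. by rewrite /gr fineK// ge0_fin_numE ?gm_ge0. Qed.
Let gr0 x y : (0 <= gr x y)%R. Proof. by rewrite fine_ge0 ?gm_ge0. Qed.
Let trE B x y : taboo p d B x y = (tr B x y)%:E.
Proof.
by rewrite /tr fineK// ge0_fin_numE ?taboo_ge0// (le_lt_trans (taboo_le_gm _ _ _ _))// goo.
Qed.
Let tr0 B x y : (0 <= tr B x y)%R. Proof. by rewrite fine_ge0 ?taboo_ge0. Qed.
Let erE B x y : entrance p d B x y = (er B x y)%:E.
Proof.
by rewrite /er fineK// ge0_fin_numE ?entrance_ge0// (le_lt_trans (entrance_le_gm _ _ _ _))// goo.
Qed.
Let er0 B x y : (0 <= er B x y)%R. Proof. by rewrite fine_ge0 ?entrance_ge0. Qed.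
Let qrE x y : q x y = (qr x y)%:E.
Proof. by rewrite /qr fineK// ge0_fin_numE// (le_lt_trans (q_le_gm _ _ _))// goo. Qed.
Let qr0 x y : (0 <= qr x y)%R. Proof. exact: fine_ge0. Qed.

(* nu-mass of the Kuznetsov paths at x whose past never met B *)
Definition escape B nu x : R :=
  (nu x - \sum_(z <- elts B) nu z * fine (taboo p d B z x))%R.

Definition potential B e x : R :=
  (\sum_(z <- elts B) e z * fine (g z x))%R.

Let gr_first_return B x z : finite_set B -> B z ->
  gr x z = ((x == z)%:R + \sum_(y <- elts B) tr B x y * gr y z)%R.
Proof.
move=> fB Bz; apply: EFin_inj; rewrite -grE (gm_first_return q0 x Bz) EFinD.
congr (_ + _); rewrite -esum_finite_real//; last by move=> *; rewrite mulr_ge0.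
by apply: eq_esum => y _; rewrite trE grE EFinM.
Qed.

Let gr_last_exit B x z : finite_set B -> B x ->
  gr x z = ((x == z)%:R + \sum_(y <- elts B) gr x y * tr B y z)%R.
Proof.
move=> fB Bx; apply: EFin_inj; rewrite -grE (gm_last_exit q0 z Bx) EFinD.
congr (_ + _); rewrite -esum_finite_real//; last by move=> *; rewrite mulr_ge0.
by apply: eq_esum => y _; rewrite trE grE EFinM.
Qed.

Let gr_entrance B x z : finite_set B -> B z ->
  gr x z = (\sum_(y <- elts B) er B x y * gr y z)%R.
Proof.
move=> fB Bz; apply: EFin_inj; rewrite -grE (gm_entrance q0 x Bz).
rewrite -esum_finite_real//; last by move=> *; rewrite mulr_ge0.
by apply: eq_esum => y _; rewrite erE grE EFinM.
Qed.

Lemma escape_taboo B nu x : finite_set B -> (forall x, 0 <= nu x)%R ->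
  (escape B nu x)%:E + \esum_(z in B) ((nu z)%:E * taboo p d B z x) = (nu x)%:E.
Proof.
move=> fB nu0; under eq_esum => z _ do rewrite trE -EFinM.
rewrite esum_finite_real//; last by move=> *; rewrite mulr_ge0.
by rewrite -EFinD /escape subrK.
Qed.

Lemma eq_escape B nu nu' x : finite_set B -> (forall z, B z -> nu z = nu' z) ->
  nu x = nu' x -> escape B nu x = escape B nu' x.
Proof.
by move=> fB e ex; rewrite /escape ex; congr (_ - _)%R; apply: eq_sum_finite => // z Bz; rewrite e.
Qed.

Lemma escapeD B nu nu' x :
  escape B (fun y => nu y + nu' y)%R x = (escape B nu x + escape B nu' x)%R.
Proof.
rewrite /escape addrACA -opprD -big_split/=; congr (_ + _ - _)%R.
by apply: eq_bigr => z _; rewrite mulrDl.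
Qed.

Lemma escapeZ B c nu x : escape B (fun y => c * nu y)%R x = (c * escape B nu x)%R.
Proof.
rewrite /escape mulrBr mulr_sumr; congr (_ - _)%R.
by apply: eq_bigr => z _; rewrite mulrA.
Qed.

(** As matrices on [B], with T for [taboo], [gr_first_return] reads G = I + TG, so (I - T)G = I. *)
Lemma potential_escape B nu z : finite_set B -> B z ->
  potential B (escape B nu) z = nu z.
Proof.
move=> fB Bz; rewrite /potential /escape.
under eq_bigr => x _ do rewrite mulrBl mulr_suml.
rewrite sumrB exchange_big /=.
rewrite [X in (_ - X)%R](eq_bigr (fun w => nu w * gr w z - nu w * (w == z)%:R))%R.
  by rewrite sumrB sum_finite_delta// mem_set// opprB addrC subrK.
move=> w _; rewrite [in RHS](gr_first_return w fB Bz) mulrDr addrC addKr mulr_sumr.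
by apply: eq_bigr => y _; rewrite mulrA.
Qed.

(** The other order, G(I - T) = I, from [gr_last_exit]; that identity also holds for targets off
    [B], where it gives 0. *)
Lemma escape_potential B e x : finite_set B ->
  escape B (potential B e) x = if x \in B then e x else 0%R.
Proof.
move=> fB; rewrite -sum_finite_delta// /escape /potential.
under [in X in (_ - X)%R]eq_bigr => z _ do rewrite mulr_suml.
rewrite exchange_big /= -sumrB; apply: eq_sum_finite => // w Bw.
rewrite -/(gr w x) [in LHS](gr_last_exit x fB Bw) mulrDr -addrA mulr_sumr.
rewrite -[RHS]addr0; congr (_ + _)%R; apply/eqP; rewrite subr_eq0; apply/eqP.
by apply: eq_bigr => y _; rewrite mulrA.
Qed.

(** Off [B] the potential of [escape B nu] is exactly the term that [escape] subtracts: expand G at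
    the last exit from [B], then use [potential_escape] on [B]. *)
Lemma escape_decomp B nu x : finite_set B ->
  nu x = ((if x \in B then 0 else escape B nu x) + potential B (escape B nu) x)%R.
Proof.
move=> fB; case: ifPn => xB; first by rewrite add0r potential_escape//; exact: set_mem.
rewrite [X in (_ + X)%R](_ : _ = \sum_(z <- elts B) nu z * tr B z x)%R; last first.
  transitivity (\sum_(z <- elts B) \sum_(y <- elts B) escape B nu z * gr z y * tr B y x)%R.
    apply: eq_sum_finite => // z Bz; rewrite -/(gr z x) [in LHS](gr_last_exit x fB Bz).
    rewrite (_ : z == x = false) ?add0r ?mulr_sumr; last by apply/eqP => zx; rewrite -zx mem_set in xB.
    by apply: eq_bigr => y _; rewrite mulrA.
  rewrite exchange_big; apply: eq_sum_finite => // y By /=.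
  by rewrite -mulr_suml -[in RHS](potential_escape nu fB By).
by rewrite /escape subrK.
Qed.

Lemma potential_inj B e nu : finite_set B ->
  (forall z, B z -> potential B e z = nu z) -> forall x, B x -> escape B nu x = e x.
Proof.
move=> fB H x Bx; rewrite -(eq_escape (nu := potential B e))//; last exact: H.
by rewrite escape_potential// mem_set.
Qed.

(** The number is the mass of [pastW B x [::]] under a Kuznetsov measure of [nu]. *)
Lemma escape_ge0 B nu x : finite_set B -> Q_excessive p d nu -> (0 <= escape B nu x)%R.
Proof.
move=> fB nuE.
have qoo a b : q a b < +oo by rewrite qrE ltry.
have [K HK] := Kuznetsov_exists q0 qoo nuE.
have := Kuz_pastW_taboo q0 nuE.1 HK B x [::]; rewrite /= !mule1.
rewrite -(escape_taboo x fB nuE.1).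
under eq_esum => z _ do rewrite trE -EFinM.
rewrite esum_finite_real//; last by move=> *; rewrite mulr_ge0 ?nuE.1.
move=> /(congr1 (fun u => u - (\sum_(z <- elts B) nu z * tr B z x)%R%:E)).
by rewrite !addeK// => e; rewrite -lee_fin -e.
Qed.

Lemma qchain_fin x t : qchain p d x t \is a fin_num.
Proof. by elim: t x => [|y t IH] x //=; rewrite fin_numM// qrE. Qed.

Lemma Kuz_pastW B nu x r (K : {measure set (@Wspace S) -> \bar R}) :
  finite_set B -> Q_excessive p d nu -> is_Kuznetsov p d nu K ->
  K (pastW B x r) = (escape B nu x)%:E * qchain p d x r.
Proof.
move=> fB nuE HK; have := Kuz_pastW_taboo q0 nuE.1 HK B x r.
rewrite -(escape_taboo x fB nuE.1).
under eq_esum => z _ do rewrite trE -EFinM.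
rewrite esum_finite_real//; last by move=> *; rewrite mulr_ge0 ?nuE.1.
have qf := qchain_fin x r.
rewrite muleDl//; set T := (X in _ + X = _).
have Tf : T \is a fin_num by rewrite fin_numM.
by move=> /(congr1 (fun u => u - T)); rewrite !addeK.
Qed.

(** Once the finite term [T] is added, the claim becomes nu Q <= nu: [taboo_step] spreads the taboo
    sum over points off [B], where together with [escape] it restores [nu]. *)
Lemma escape_step B nu y : finite_set B -> Q_excessive p d nu ->
  \esum_(x in ~` B) ((escape B nu x)%:E * q x y) <= (escape B nu y)%:E.
Proof.
move=> fB nuE; have nu0 := nuE.1.
pose T := \esum_(z in B) ((nu z)%:E * taboo p d B z y).
have T0 : T \is a fin_num.
  rewrite /T; under eq_esum => z _ do rewrite trE -EFinM.
  by rewrite esum_finite_real// => *; rewrite mulr_ge0.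
rewrite -(leeD2rE _ _ T0) [leRHS]escape_taboo//; apply: le_trans (nuE.2 y).
rewrite /measK [leRHS](esumID B); last by move=> *; rewrite mule_ge0 ?lee_fin.
rewrite !setTI /T; under [X in _ + X <= _]eq_esum => z _.
  rewrite taboo_step// ge0_muleDr//; last by apply: esum_ge0 => *; rewrite mule_ge0 ?taboo_ge0.
  rewrite -esumZl ?lee_fin//; last by move=> *; rewrite mule_ge0 ?taboo_ge0.
  over.
rewrite esumD; first last.
- by move=> *; apply: esum_ge0 => *; rewrite mule_ge0 ?lee_fin// mule_ge0 ?taboo_ge0.
- by move=> *; rewrite mule_ge0 ?lee_fin.
rewrite addeCA; apply: leeD => //.
rewrite esum_swap; last by move=> *; rewrite mule_ge0 ?lee_fin// mule_ge0 ?taboo_ge0.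
rewrite -esumD; first last.
- by move=> *; apply: esum_ge0 => *; rewrite mule_ge0 ?lee_fin// mule_ge0 ?taboo_ge0.
- by move=> *; rewrite mule_ge0 ?lee_fin ?escape_ge0.
apply: le_esum => x _.
under eq_esum => z _ do rewrite muleA.
rewrite esumZr//; last by move=> *; rewrite mule_ge0 ?lee_fin ?taboo_ge0.
rewrite -ge0_muleDl ?lee_fin ?escape_ge0//; last by apply: esum_ge0 => *; rewrite mule_ge0 ?lee_fin ?taboo_ge0.
by rewrite escape_taboo.
Qed.

Lemma potential_ge0 B e x : finite_set B -> (forall x, 0 <= e x)%R -> (0 <= potential B e x)%R.
Proof. by move=> fB e0; apply: sum_finite_ge0 => // z _; apply: mulr_ge0 => //; exact: gr0. Qed.

Lemma potentialE B e x : finite_set B -> (forall x, 0 <= e x)%R ->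
  (potential B e x)%:E = \esum_(z in B) ((e z)%:E * g z x).
Proof.
move=> fB e0; under eq_esum => z _ do rewrite grE -EFinM.
by rewrite esum_finite_real// => *; rewrite mulr_ge0.
Qed.

(** The right side of (ii) with [e] for mu / h, recalling that h is 1 on [B]. *)
Definition from_escape B e x : R :=
  ((if x \in B then 0 else e x) + potential B e x)%R.

Lemma escape_from_escape B e x : finite_set B -> escape B (from_escape B e) x = e x.
Proof.
move=> fB.
(* [escape B _ x] depends only on the values at [x] and on [B], so off [B] the summand [e] may be
   kept at the single point [x]. *)
rewrite (eq_escape (nu' := fun y => (if y == x then (if x \in B then 0 else e x) else 0) + potential B e y)%R)//.
- rewrite escapeD escape_potential//.
  rewrite /escape eqxx big_seq big1 ?subr0; first by case: ifP => _; rewrite ?add0r ?addr0.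
  move=> z; rewrite in_fset_set// => zB; case: eqP => [zx|_]; last by rewrite mul0r.
  by rewrite -zx zB mul0r.
- move=> z Bz; rewrite /from_escape mem_set//; case: eqP => // zx.
  by rewrite -zx mem_set.
- by rewrite /from_escape eqxx.
Qed.

Lemma from_escape_excessive B e : finite_set B -> (forall x, 0 <= e x)%R ->
  (forall y, \esum_(x in ~` B) ((e x)%:E * q x y) <= (e y)%:E) ->
  Q_excessive p d (from_escape B e).
Proof.
move=> fB e0 eq; split => [x|y].
  by rewrite addr_ge0 ?potential_ge0//; case: ifP.
(* Mass balance from G = I + GQ: applying Q to the potential removes [e] on [B]. The hypothesis on
   [e] then bounds the contribution of the points off [B]. *)
have fE : measK (from_escape B e) q y + (if y \in B then e y else 0%R)%:E =
    \esum_(x in ~` B) ((e x)%:E * q x y) + (potential B e y)%:E.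
  rewrite /measK /from_escape.
  under eq_esum => x _.
    rewrite EFinD ge0_muleDl ?lee_fin ?potential_ge0//; last by case: ifP.
    over.
  rewrite esumD; first last.
  - by move=> *; rewrite mule_ge0 ?lee_fin ?potential_ge0.
  - by move=> x _; rewrite mule_ge0// lee_fin; case: ifP.
  rewrite -addeA; congr (_ + _).
    rewrite [RHS]esum_mkcond; apply: eq_esum => x _; rewrite in_setC.
    by case: ifP => //=; rewrite mul0e.
  under eq_esum => x _.
    rewrite potentialE// -esumZr//; last by move=> *; rewrite mule_ge0 ?lee_fin ?gm_ge0.
    over.
  rewrite esum_swap; last by move=> *; rewrite mule_ge0// mule_ge0 ?lee_fin ?gm_ge0.
  rewrite potentialE// addeC.
  under [RHS]eq_esum => z _.
    rewrite gm_step// ge0_muleDr//; last by apply: esum_ge0 => *; rewrite mule_ge0 ?gm_ge0.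
    over.
  rewrite esumD; first last.
  - by move=> *; rewrite mule_ge0 ?lee_fin// esum_ge0// => *; rewrite mule_ge0 ?gm_ge0.
  - by move=> *; rewrite mule_ge0 ?lee_fin.
  congr (_ + _).
    under eq_esum => z _ do rewrite -EFinM.
    by rewrite esum_finite_real ?sum_finite_delta// => *; rewrite mulr_ge0.
  apply: eq_esum => z _; rewrite -esumZl ?lee_fin//; last by move=> *; rewrite mule_ge0 ?gm_ge0.
  by apply: eq_esum => x _; rewrite -muleA.
have [By|/negPf nBy] := boolP (y \in B).
  rewrite By in fE; have ef : (e y)%:E \is a fin_num by [].
  rewrite -(leeD2rE _ _ ef) fE /from_escape By add0r addeC; exact: leeD.
by rewrite nBy adde0 in fE; rewrite fE /from_escape nBy EFinD; exact: leeD.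
Qed.

(** * Excessive measures of the h-transformed chain *)

Section norming.
Variables (B : set S) (h : S -> \bar R).
Hypothesis fB : finite_set B.
Hypothesis hoo : forall x, h x < +oo.
Hypothesis hgt0 : forall x, 0 < h x.
Hypothesis hB : forall x, B x -> h x = 1.
Let hr x : R := fine (h x).
Let hr0 x : (0 < hr x)%R.
Proof. by rewrite /hr fine_gt0// hgt0 hoo. Qed.
Let hn0 x : (hr x != 0)%R. Proof. by rewrite gt_eqF. Qed.

Lemma ph_in x y : B x -> ph p d B h x y = 0.
Proof. by move=> Bx; rewrite /ph asboolT. Qed.

Lemma ph_out x y : ~ B x -> ph p d B h x y = q x y * (fine (h y) / fine (h x))%:E.
Proof. by move=> Bx; rewrite /ph asboolF. Qed.

(** Conjugation by h: [mu] is excessive for [ph] exactly when mu / h satisfies the inequality of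
    [escape_step], which is also the hypothesis of [from_escape_excessive]. *)
Lemma measK_ph mu y : (forall x, 0 <= mu x)%R -> measK mu (ph p d B h) y =
  (\esum_(x in ~` B) ((mu x / hr x)%:E * q x y)) * (hr y)%:E.
Proof.
move=> mu0; rewrite -esumZr ?lee_fin ?ltW//; last first.
  by move=> *; rewrite mule_ge0 ?lee_fin ?divr_ge0// ltW.
rewrite /measK [RHS]esum_mkcond; apply: eq_esum => x _; rewrite in_setC.
case: ifPn => /= xB.
  rewrite ph_out; last by move=> /mem_set; exact/negP.
  rewrite qrE -!EFinM; congr EFin; rewrite -/(hr x) -/(hr y).
  by rewrite mulrA [(hr y / hr x)%R]mulrC !mulrA; congr (_ * _)%R; rewrite mulrAC.
by rewrite ph_in ?mule0//; apply: set_mem; rewrite negbK in xB.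
Qed.

Definition occupation_of nu x : R := (fine (h x) * escape B nu x)%R.

Lemma occupation_of_iso : cone_iso (Q_excessive p d) (Ph_excessive p d B h) eq
  (fun nu1 nu2 x => nu1 x + nu2 x)%R (fun c nu x => c * nu x)%R
  (fun f g k => k = (fun x => f x + g x)%R)
  (fun c f g => g = (fun x => c * f x)%R) occupation_of.
Proof.
have hK e x : (hr x * e x / hr x = e x)%R by rewrite mulrC mulrA mulVf ?mul1r.
split; [|split; [|split; [|split]]].
- move=> nu nuE; have mu0 x : (0 <= occupation_of nu x)%R.
    by apply: mulr_ge0; [exact/ltW/hr0|exact: escape_ge0].
  split=> // y; rewrite measK_ph//.
  under eq_esum => x _ do rewrite /occupation_of hK.
  rewrite /occupation_of mulrC EFinM; apply: lee_wpmul2r; first by rewrite lee_fin ltW.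
  exact: escape_step.
- move=> nu nu' _ _ e; apply/funext => x.
  have ee y : escape B nu y = escape B nu' y.
    by have := congr1 (fun f => f y / hr y)%R e; rewrite /occupation_of !hK.
  rewrite (escape_decomp nu x fB) (escape_decomp nu' x fB) ee; congr (_ + _)%R.
  by apply: eq_bigr => z _; rewrite ee.
- move=> mu [mu0 muE]; pose e x := (mu x / hr x)%R.
  have e0 x : (0 <= e x)%R by rewrite divr_ge0// ltW.
  exists (from_escape B e); last first.
    by apply/funext => x; rewrite /occupation_of escape_from_escape// /e mulrC divfK.
  apply: from_escape_excessive => // y.
  have := muE y; rewrite measK_ph// /e EFinM lee_pdivlMr//.
- by move=> nu nu' _ _; apply/funext => x; rewrite /occupation_of escapeD mulrDr.
- by move=> c nu _ _; apply/funext => x; rewrite /occupation_of escapeZ mulrCA.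
Qed.

Lemma occupation_of_decomp nu x : Q_excessive p d nu -> (nu x)%:E =
  (if `[< B x >] then 0 else (occupation_of nu x / fine (h x))%:E) +
  \esum_(z in B) ((occupation_of nu z)%:E * g z x).
Proof.
move=> nuE; have e0 z : (0 <= escape B nu z)%R by exact: escape_ge0.
under eq_esum => z Bz do rewrite /occupation_of hB// mul1r.
rewrite -potentialE// [in LHS](escape_decomp nu x fB) EFinD; congr (_ + _).
rewrite /occupation_of -/(hr x); case: asboolP => Bx; first by rewrite mem_set.
by rewrite memNset// mulrC mulrA mulVf ?mul1r.
Qed.

End norming.

(** * Entrance families along an exhaustion by finite sets *)

Section entrance_families.
Variable Bn : nat -> set S.
Hypothesis fBn : forall n, finite_set (Bn n).
Hypothesis Bn_incr : forall n, Bn n `<=` Bn n.+1.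
Hypothesis Bn_cover : \bigcup_n Bn n = [set: S].

Lemma Bn_mono m n : (m <= n)%N -> Bn m `<=` Bn n.
Proof.
move=> /subnK <-; elim: (n - m)%N => // k IH; rewrite addSn.
by move=> x /IH; exact: Bn_incr.
Qed.

Lemma Bn_finite_cover (X : set S) : finite_set X -> exists n, X `<=` Bn n.
Proof.
move=> fX.
have /choice[N HN] (x : S) : exists n, Bn n x.
  by have : [set: S] x by []; rewrite -Bn_cover => -[n _ ?]; exists n.
exists (\max_(x <- elts X) N x)%N => x Xx.
apply: (Bn_mono (m := N x)) => //.
by apply: (@leq_bigmax_seq _ _ xpredT N x); rewrite // in_fset_set// inE.
Qed.

Definition entrance_family nu n x : R :=
  if x \in Bn n then escape (Bn n) nu x else 0%R.

Lemma entrance_family_ge0 nu n x : Q_excessive p d nu -> (0 <= entrance_family nu n x)%R.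
Proof. by move=> nuE; rewrite /entrance_family; case: ifP => // _; exact: escape_ge0. Qed.

Lemma potential_family nu n z : Bn n z ->
  potential (Bn n) (entrance_family nu n) z = nu z.
Proof.
move=> Bz; rewrite -[RHS](potential_escape nu (fBn n) Bz).
by apply: eq_sum_finite => // x Bx; rewrite /entrance_family mem_set.
Qed.

Lemma esum_support (n : nat) (mb : S -> R) (k : S -> \bar R) :
  (forall x, 0 <= mb x)%R -> (forall x, ~ Bn n x -> mb x = 0%R) -> (forall x, 0 <= k x) ->
  \esum_(x in [set: S]) ((mb x)%:E * k x) = \esum_(x in Bn n) ((mb x)%:E * k x).
Proof.
move=> mb0 mbN k0; rewrite [RHS]esum_mkcond; apply: eq_esum => x _.
case: ifPn => // /negP xB; rewrite mbN ?mul0e// => Bx; apply: xB; exact: mem_set.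
Qed.

(** Sweeping [mb] onto [Bn n] keeps its potential on [Bn n]: a path to a point of [Bn n] passes
    through its entrance point. *)
Lemma potential_entrance mb n z : Bn n z ->
  potential (Bn n.+1) mb z =
  potential (Bn n) (fun y => \sum_(x <- elts (Bn n.+1)) mb x * er (Bn n) x y)%R z.
Proof.
move=> Bz; rewrite /potential.
under [RHS]eq_bigr => y _ do rewrite mulr_suml.
rewrite exchange_big /=; apply: eq_bigr => x _.
rewrite -/(gr x z) (gr_entrance x (fBn n) Bz) mulr_sumr.
by apply: eq_bigr => y _; rewrite mulrA.
Qed.

Lemma consistent_real mb : consistent_entrance_family p d Bn mb ->
  [/\ forall n x, (0 <= mb n x)%R, forall n x, ~ Bn n x -> mb n x = 0%R &
   forall n y, Bn n y ->
     mb n y = (\sum_(x <- elts (Bn n.+1)) mb n.+1 x * er (Bn n) x y)%R].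
Proof.
move=> [mb0 [_ mbE]].
have mbN n x : ~ Bn n x -> mb n x = 0%R.
  move=> nB; apply: EFin_inj; rewrite mbE indicE (_ : x \in Bn n = false) ?mul0e//.
  by apply/negP => /set_mem.
split=> // n y By; apply: EFin_inj; rewrite mbE indicE mem_set// mul1e.
rewrite (esum_support (n := n.+1))//; [|exact: mbN|by move=> *; exact: entrance_ge0].
under eq_esum => x _ do rewrite erE -EFinM.
by rewrite esum_finite_real// => *; rewrite mulr_ge0.
Qed.

(** On [Bn n] both sides of the consistency relation have potential [nu], so [potential_inj]
    identifies them. *)
Lemma entrance_family_consistent nu : Q_excessive p d nu ->
  consistent_entrance_family p d Bn (entrance_family nu).
Proof.
move=> nuE; have mb0 n x := entrance_family_ge0 n x nuE.
have mbN n x : ~ Bn n x -> entrance_family nu n x = 0%R.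
  by move=> nB; rewrite /entrance_family (_ : x \in _ = false)//; apply/negP => /set_mem.
split=> //; split=> [n|n y].
  under eq_esum => x _ do rewrite -[X in EFin X]mulr1 EFinM.
  rewrite (esum_support (n := n))//; last by exact: mbN.
  apply: esum_fin => // x _; first by rewrite mule1 lee_fin.
  by rewrite mule1 ltry.
have [By|nBy] := pselect (Bn n y); last first.
  by rewrite mbN// indicE (_ : y \in _ = false) ?mul0e//; apply/negP => /set_mem.
rewrite indicE mem_set// mul1e (esum_support (n := n.+1))//; [|exact: mbN|by move=> *; exact: entrance_ge0].
under eq_esum => x _ do rewrite erE -EFinM.
rewrite esum_finite_real//; last by move=> *; rewrite mulr_ge0.
congr EFin; rewrite {1}/entrance_family mem_set//.
apply: (potential_inj (e := fun y => (\sum_(x <- elts (Bn n.+1)) entrance_family nu n.+1 x * er (Bn n) x y)%R) (fBn n) _ By) => z Bz.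
by rewrite -potential_entrance// potential_family//; exact: Bn_incr.
Qed.

Lemma entrance_family_surj mb : consistent_entrance_family p d Bn mb ->
  exists2 nu, Q_excessive p d nu & entrance_family nu = mb.
Proof.
move=> /consistent_real[mb0 mbN mbE].
have /choice[N HN] (x : S) : exists n, Bn n x.
  by have : [set: S] x by []; rewrite -Bn_cover => -[n _ ?]; exists n.
(* Any level whose set contains [x] would do: by [stepk] the potential at [x] no longer changes from
   there on. *)
pose nu x := potential (Bn (N x)) (mb (N x)) x.
have step n z : Bn n z -> potential (Bn n.+1) (mb n.+1) z = potential (Bn n) (mb n) z.
  by move=> Bz; rewrite potential_entrance//; apply: eq_sum_finite => // y By; rewrite mbE.
have stepk n k z : Bn n z -> potential (Bn (k + n)%N) (mb (k + n)%N) z = potential (Bn n) (mb n) z.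
  move=> Bz; elim: k => // k IH; rewrite addSn step//.
  by apply: (Bn_mono (m := n)) => //; rewrite leq_addl.
have nuP n z : Bn n z -> nu z = potential (Bn n) (mb n) z.
  move=> Bz; rewrite /nu; have [H|H] := leqP (N z) n.
    by rewrite -(subnK H) stepk.
  by rewrite -(subnK (ltnW H)) stepk.
have nu0 z : (0 <= nu z)%R by rewrite /nu potential_ge0.
exists nu; last first.
  apply/funext => n; apply/funext => x; rewrite /entrance_family.
  case: ifPn => xB; last by rewrite mbN// => Bx; move/negP: xB; apply; exact: mem_set.
  by apply: (potential_inj (fBn n)); [move=> z Bz; rewrite (nuP n)|exact: set_mem].
(* A finite partial sum of nu Q at [z] sees finitely many points; at a level containing them and
   [z], [nu] is a potential, and GQ <= G concludes. *)
split=> // z; apply: ge_ereal_sup => _ [X [fX _] <-].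
have [n Hn] := Bn_finite_cover (X := X `|` [set z]) ltac:(by rewrite finite_setU; split).
rewrite -esum_fset//; last by move=> *; rewrite mule_ge0 ?lee_fin.
rewrite (nuP n z); last by apply: Hn; right.
rewrite potentialE//; apply: (@le_trans _ _ (\esum_(x in X) \esum_(w in Bn n) ((mb n w)%:E * (g w x * q x z)))).
  apply: le_esum => x Xx; rewrite (nuP n x); last by apply: Hn; left.
  rewrite potentialE// -esumZr//; last by move=> *; rewrite mule_ge0 ?lee_fin ?gm_ge0.
  by apply: le_esum => w _; rewrite -muleA.
rewrite esum_swap; last by move=> *; rewrite mule_ge0 ?lee_fin// mule_ge0 ?gm_ge0.
apply: le_esum => w _; rewrite esumZl ?lee_fin//; last by move=> *; rewrite mule_ge0 ?gm_ge0.
apply: lee_wpmul2l; first by rewrite lee_fin.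
rewrite (gm_step q0 w z); apply: le_trans (le_esum_subset (Q := setT) _ _) _ => //.
by rewrite leeDr.
Qed.

Lemma entrance_family_iso : cone_iso (Q_excessive p d) (consistent_entrance_family p d Bn) eq
  (fun nu1 nu2 x => nu1 x + nu2 x)%R (fun c nu x => c * nu x)%R
  (fun f g k => k = (fun n x => f n x + g n x)%R)
  (fun c f g => g = (fun n x => c * f n x)%R) entrance_family.
Proof.
split; [exact: entrance_family_consistent|split; [|split; [exact: entrance_family_surj|split]]].
- move=> nu nu' _ _ e; apply/funext => x.
  have : [set: S] x by []; rewrite -Bn_cover => -[n _ Bx].
  by rewrite -(potential_family nu Bx) -(potential_family nu' Bx) e.
- move=> nu nu' _ _; apply/funext => n; apply/funext => x; rewrite /entrance_family.
  by case: ifP => _; rewrite ?addr0// escapeD.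
- move=> c nu _ _; apply/funext => n; apply/funext => x; rewrite /entrance_family.
  by case: ifP => _; rewrite ?mulr0// escapeZ.
Qed.

Lemma entrance_family_gm nu n y : Q_excessive p d nu -> Bn n y ->
  (nu y)%:E = \esum_(x in Bn n) ((entrance_family nu n x)%:E * g x y) /\
  (entrance_family nu n y)%:E = (nu y)%:E - \esum_(x in Bn n) ((nu x)%:E * Qreturn p d (Bn n) x y).
Proof.
move=> nuE By; split.
  by rewrite -potentialE ?potential_family// => x; exact: entrance_family_ge0.
rewrite /entrance_family mem_set//.
under eq_esum => x _ do rewrite QreturnE// trE -EFinM.
by rewrite esum_finite_real// => *; rewrite mulr_ge0 ?nuE.1.
Qed.

End entrance_families.

End balayage.

(** * Quasi-processes *)

Section quasi_paths.
Context {S : countType}.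
Implicit Types (v w : int -> option S) (C : set (int -> option S)) (x y z : S)
  (B : set S) (ys : seq (option S)) (m n t : int).

Definition spells v n ys := forall i, (i < size ys)%N -> v (n + i%:Z)%R = nth None ys i.

Lemma dclass_refl v : dclass v v.
Proof. by exists 0%R => n; rewrite addr0. Qed.

Lemma dclass_eq v w : dclass v w -> dclass w = dclass v.
Proof.
move=> [t tw]; apply/seteqP; split=> u [s us].
  by exists (s + t)%R => n; rewrite us tw addrA.
by exists (s - t)%R => n; rewrite us tw; congr v; lia.
Qed.

Lemma inD_dclass v w : dclass v w -> inD v -> inD w.
Proof.
move=> [t tw] [[n vn] [cv tr]]; split; [|split].
- by exists (n - t)%R; rewrite tw subrK.
- by move=> a b c abc; rewrite !tw; apply: cv; lia.
- move=> F /tr[N HN]; exists (N - t)%R => k kN x; rewrite tw; apply: HN; lia.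
Qed.

Lemma first_entrance_uniq B v m n : first_entrance B v m -> first_entrance B v n -> m = n.
Proof.
move=> [[x [vm Bx]] Hm] [[y [vn By]] Hn].
have [mn|nm|//] := ltrgtP m n; first by case: (Hn _ mn _ vm Bx).
by case: (Hm _ nm _ vn By).
Qed.

(** Up to some time [N] the path is off the finite set [B], so the first entrance is a minimum over
    natural numbers counted from [N]. *)
Lemma first_entrance_ex B v n x : finite_set B -> inD v -> v n = Some x -> B x ->
  exists m, first_entrance B v m.
Proof.
move=> fB [_ [_ tr]] vn Bx; have [N HN] := tr _ fB.
pose P (k : nat) := `[< exists y, v (N + k%:Z)%R = Some y /\ B y >].
have nN : (N < n)%R by rewrite ltNge; apply/negP => /HN/(_ _ vn); apply.
have exP : exists k, P k.
  exists `|n - N|%N; apply/asboolP; exists x; split => //; rewrite -vn; congr v; lia.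
case: (ex_minnP exP) => k /asboolP Pk mink.
exists (N + k%:Z)%R; split => // m mk y vm By.
have [mN|Nm] := leP m N; first by case: (HN _ mN _ vm By).
have /mink : P `|m - N|%N.
  by apply/asboolP; exists y; split => //; rewrite -vm; congr v; lia.
lia.
Qed.

(** Entrance times move along with shifts, so the existential over representatives can be tested on
    any one of them. *)
Lemma pi_cylP B ys v : inD v ->
  pi_cyl B ys (dclass v) <-> exists2 n, first_entrance B v n & spells v n ys.
Proof.
move=> iv; split=> [[_ [w [n [[t tw] [[[x [wn Bx]] fw] sw]]]]]|[n fn sn]].
  exists (n + t)%R.
    split; first by exists x; rewrite -tw.
    move=> m mn y vm; apply: (fw (m - t)%R); first by lia.
    by rewrite tw subrK.
  move=> i iy; rewrite -sw// tw; congr v; lia.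
split; first by exists v.
by exists v, n; split; first exact: dclass_refl.
Qed.

Lemma pi_cyl_Dstar B ys C : pi_cyl B ys C -> exists2 v, inD v & C = dclass v.
Proof. by move=> [[v [iv ->]] _]; exists v. Qed.

Lemma H_isE B x : H_is B x = pi_cyl B [:: Some x].
Proof.
apply/seteqP; split=> C [CD [w [n [Cw [fw wn]]]]]; split => //; exists w, n; split => //; split => //.
  by move=> [|//] _; rewrite addr0.
by have := wn 0%N isT; rewrite addr0.
Qed.

Lemma DstarBE B : finite_set B -> DstarB B = pi_cyl B [::].
Proof.
move=> fB; apply/seteqP; split=> C.
  move=> [[v [iv ->]] [w [vw [n [x [wn Bx]]]]]].
  have iw := inD_dclass vw iv; rewrite -(dclass_eq vw); apply/pi_cylP => //.
  by have [m fm] := first_entrance_ex fB iw wn Bx; exists m.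
move=> [CD [w [n [Cw [[[x [wn Bx]] _] _]]]]]; split => //.
by exists w; split => //; exists n, x.
Qed.

Lemma measurable_pi_cyl B ys : finite_set B -> measurable (pi_cyl B ys : set (@Dspace S)).
Proof. by move=> fB; apply: sub_sigma_algebra; exists B, ys. Qed.

Lemma DstarE : @Dstar S = \bigcup_(x in [set: S]) pi_cyl [set x] [::].
Proof.
apply/seteqP; split=> C.
  move=> [v [iv ->]]; have [n vn] := iv.1; case e : (v n) => [x|//].
  exists x => //; apply/pi_cylP => //.
  by have [m fm] := @first_entrance_ex [set x] _ _ _ (finite_set1 x) iv e erefl; exists m.
by move=> [x _ []].
Qed.

Lemma measurable_Dstar : measurable (@Dstar S : set (@Dspace S)).
Proof.
rewrite DstarE; apply: bigcup_countType_measurable => x _.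
by apply: measurable_pi_cyl; exact: finite_set1.
Qed.

Lemma pi_cyl_None B ys : pi_cyl B (None :: ys) = set0.
Proof.
apply/seteqP; split=> // C [_ [w [n [_ [[[x [wn _]] _] /(_ 0%N isT)]]]]].
by rewrite addr0 wn.
Qed.

Lemma pi_cyl_notin B x ys : ~ B x -> pi_cyl B (Some x :: ys) = set0.
Proof.
move=> nB; apply/seteqP; split=> // C [_ [w [n [_ [[[y [wn By]] _] /(_ 0%N isT)]]]]].
by rewrite addr0 wn => -[yx]; apply: nB; rewrite -yx.
Qed.

Lemma pi_cyl_nil B : pi_cyl B [::] = \bigcup_(x in B) pi_cyl B [:: Some x].
Proof.
apply/seteqP; split=> C.
  move=> [CD [w [n [Cw [fw _]]]]]; have [[x [wn Bx]] _] := fw; exists x => //.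
  split => //; exists w, n; split => //; split => // -[|//] _.
  by rewrite addr0.
by move=> [x Bx [CD [w [n [Cw [fw _]]]]]]; split => //; exists w, n.
Qed.

Lemma spells_segment v n x k : inD v -> v n <> None -> v (n + k%:Z)%R = Some x ->
  exists2 u : seq S, size u = k & forall i, (i < k)%N -> v (n + i%:Z)%R = Some (nth x u i).
Proof.
move=> [_ [cv _]] vn vk.
have vi i : (i <= k)%N -> v (n + i%:Z)%R <> None.
  by move=> ik; apply: (cv n _ (n + k%:Z)%R) => //; [lia|rewrite vk].
exists (mkseq (fun i => odflt x (v (n + i%:Z)%R)) k); first by rewrite size_mkseq.
move=> i ik; rewrite nth_mkseq//; have := vi i (ltnW ik).
by case: (v _).
Qed.

(** The larger set [B'] is entered no later than [B], and [u] is the word spelled between the two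
    entrances. Cylinders of different finite sets are compared in this way. *)
Lemma pi_cyl_refine B B' x ys : finite_set B' -> B `<=` B' -> B x ->
  pi_cyl B (Some x :: ys) =
  \bigcup_(u in avoids B) pi_cyl B' (map Some u ++ Some x :: ys).
Proof.
move=> fB' BB Bx; apply/seteqP; split=> C.
  move=> /[dup] /pi_cyl_Dstar[v iv ->] /(pi_cylP _ _ iv)[n fn sn].
  have vn : v n = Some x by have := sn 0%N isT; rewrite addr0.
  have [m fm] := first_entrance_ex fB' iv vn (BB _ Bx).
  have mn : (m <= n)%R.
    by rewrite leNgt; apply/negP => nm; case: (fm.2 _ nm _ vn (BB _ Bx)).
  have vm : v m <> None by have [[y [-> _]] _] := fm.
  have vk : v (m + `|n - m|%N%:Z)%R = Some x by rewrite -vn; congr v; lia.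
  have [u su Hu] := spells_segment iv vm vk.
  exists u.
    apply/(all_nthP x) => i iu; apply/negP => /set_mem.
    by apply: (fn.2 (m + i%:Z)%R); [lia|apply: Hu; rewrite -su].
  apply/pi_cylP => //; exists m => // i; rewrite size_cat size_map => iy.
  rewrite nth_cat size_map; case: ltnP => iu; first by rewrite Hu -?su// (nth_map x).
  by rewrite -sn; [congr v; lia|lia].
move=> [u Au] /[dup] /pi_cyl_Dstar[v iv ->] /(pi_cylP _ _ iv)[m fm sm].
apply/pi_cylP => //; exists (m + (size u)%:Z)%R; last first.
  move=> i iy; have := sm (size u + i)%N; rewrite size_cat size_map ltn_add2l => /(_ iy).
  by rewrite nth_cat size_map ltnNge leq_addr /= addKn => <-; congr v; lia.
split.
  exists x; split => //; have := sm (size u); rewrite size_cat size_map /= addnS ltnS leq_addr => /(_ isT).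
  by rewrite nth_cat size_map ltnn subnn.
move=> k km y vk By; have [kl|mk] := ltP k m; first exact: (fm.2 _ kl _ vk (BB _ By)).
have iu : (`|k - m|%N < size u)%N by lia.
have := sm `|k - m|%N; rewrite size_cat size_map => /(_ (ltn_addr _ iu)).
rewrite nth_cat size_map iu (nth_map x)// (_ : (m + `|k - m|%N%:Z)%R = k); last by lia.
rewrite vk => -[yu]; move/(all_nthP x): Au => /(_ _ iu)/negP; apply.
by rewrite -yu; exact: mem_set.
Qed.

Lemma pi_cyl_refine_disj B B' x ys : B x ->
  trivIset (avoids B) (fun u => pi_cyl B' (map Some u ++ Some x :: ys)).
Proof.
move=> Bx u u' Au Au' [C [+ +]].
move=> /[dup] /pi_cyl_Dstar[v iv ->] /(pi_cylP _ _ iv)[m fm sm] /(pi_cylP _ _ iv)[m' fm' sm'].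
have mm := first_entrance_uniq fm fm'; subst m'.
have H a b : avoids B b -> spells v m (map Some a ++ Some x :: ys) ->
    spells v m (map Some b ++ Some x :: ys) -> ~ (size a < size b)%N.
  move=> Ab sa sb ab.
  have := sa (size a); rewrite size_cat size_map /= addnS ltnS leq_addr => /(_ isT).
  have := sb (size a); rewrite size_cat size_map => /(_ (ltn_addr _ ab)) ->.
  rewrite !nth_cat !size_map ab ltnn subnn (nth_map x)//= => -[e].
  by move/(all_nthP x): Ab => /(_ _ ab); rewrite e mem_set.
have ss : size u = size u'.
  by case: (ltngtP (size u) (size u')) => // [/(H _ _ Au' sm sm')|/(H _ _ Au sm' sm)].
apply: (@eq_from_nth _ x) => // i iu.
have := sm i; rewrite size_cat size_map => /(_ (ltn_addr _ iu)).
have := sm' i; rewrite size_cat size_map -ss => /(_ (ltn_addr _ iu)) ->.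
by rewrite !nth_cat !size_map -ss iu !(nth_map x) -?ss// => -[].
Qed.

Lemma pi_cylI B ys zs : (size ys <= size zs)%N ->
  pi_cyl B ys `&` pi_cyl B zs = if take (size ys) zs == ys then pi_cyl B zs else set0.
Proof.
move=> yz; case: eqP => [e|ne].
  apply/seteqP; split=> [C []//|C Cz]; split => //; move: Cz.
  move=> [CD [w [n [Cw [fw sw]]]]]; split => //; exists w, n; split => //; split => // i iy.
  by rewrite sw ?(leq_trans iy)// -[in RHS]e nth_take.
apply/seteqP; split=> // C [+ +].
move=> /[dup] /pi_cyl_Dstar[v iv ->] /(pi_cylP _ _ iv)[m fm sm] /(pi_cylP _ _ iv)[m' fm' sm'].
have mm := first_entrance_uniq fm fm'; subst m'; apply: ne.
apply: (@eq_from_nth _ None); rewrite size_take_min (minn_idPl yz)// => i iy.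
by rewrite nth_take// -sm// sm'// (leq_trans iy).
Qed.

End quasi_paths.

(** * A quasi-process is determined by its cylinders along an exhaustion *)

Section quasi_process_uniqueness.
Context {R : realType} {S : countType}.
Variables (eta1 eta2 : {measure set (@Dspace S) -> \bar R}) (Bn : nat -> set S).
Hypothesis fBn : forall n, finite_set (Bn n).
Hypothesis Bn_incr : forall n, Bn n `<=` Bn n.+1.
Hypothesis Bn_cover : \bigcup_n Bn n = [set: S].
Hypothesis eta1N : eta1 (~` @Dstar S) = 0.
Hypothesis eta2N : eta2 (~` @Dstar S) = 0.
Hypothesis eta12 : forall n ys, eta1 (pi_cyl (Bn n) ys) = eta2 (pi_cyl (Bn n) ys).
Hypothesis eta_oo : forall n, eta1 (pi_cyl (Bn n) [::]) < +oo.

(** [setT] is included as a cover for the measures restricted to [pi_cyl (Bn n) [::]], which are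
    finite. By [pi_cyl_refine] the generated sigma-algebras grow with [n]. *)
Let gen n : set (set (@Dspace S)) :=
  [set A | A = set0 \/ A = setT \/ exists ys, A = pi_cyl (Bn n) ys].

Let gen_pi_cyl n B ys : B `<=` Bn n -> <<s gen n >> (pi_cyl B ys : set (@Dspace S)).
Proof.
move=> BB.
have bc (I : countType) (P : set I) (F : I -> set (@Dspace S)) :
    (forall i, P i -> <<s gen n >> (F i)) -> <<s gen n >> (\bigcup_(i in P) F i).
  exact: (@bigcup_countType_measurable _ (g_sigma_algebraType (gen n))).
have g0 : <<s gen n >> (set0 : set (@Dspace S)) by apply: sub_sigma_algebra; left.
have key x zs : <<s gen n >> (pi_cyl B (Some x :: zs) : set (@Dspace S)).
  have [Bx|nBx] := pselect (B x); last by rewrite pi_cyl_notin.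
  rewrite (pi_cyl_refine _ (fBn n) BB Bx); apply: bc => u _.
  by apply: sub_sigma_algebra; right; right; exists (map Some u ++ Some x :: zs).
case: ys => [|[x|] ys]; [|exact: key|by rewrite pi_cyl_None].
by rewrite pi_cyl_nil; apply: bc => x _; exact: key.
Qed.

Let gen_le m n : (m <= n)%N -> <<s gen m >> `<=` <<s gen n >>.
Proof.
move=> mn; apply: smallest_sub; first exact: smallest_sigma_algebra.
move=> _ [->|[->|[ys ->]]].
- by apply: sub_sigma_algebra; left.
- by apply: sub_sigma_algebra; right; left.
- apply: gen_pi_cyl; exact: Bn_mono.
Qed.

Let gen_measurable n : <<s gen n >> `<=` @measurable _ (@Dspace S).
Proof.
apply: smallest_sub; first exact: sigma_algebra_measurable.
move=> _ [->|[->|[ys ->]]]; [exact: measurable0|exact: measurableT|exact: measurable_pi_cyl].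
Qed.

Let gen_agree n A : <<s gen n >> A -> A `<=` pi_cyl (Bn n) [::] -> eta1 A = eta2 A.
Proof.
move=> gA AD.
have mD : measurable (pi_cyl (Bn n) [::] : set (@Dspace S)) by exact: measurable_pi_cyl.
have sub ys : pi_cyl (Bn n) ys `<=` pi_cyl (Bn n) [::].
  by move=> C [CD [w [m [Cw [fw _]]]]]; split => //; exists w, m.
suff : mrestr eta1 mD A = mrestr eta2 mD A by rewrite /mrestr !setIidl.
apply: (@g_sigma_algebra_measure_unique _ _ _ (gen n) _ (fun=> setT)) => //.
- by apply: subset_trans (@gen_measurable n); exact: sub_sigma_algebra.
- by move=> _; right; left.
- by apply/seteqP; split => // C _; exists 0%N.
- move=> X Y [->|[->|[ys ->]]]; rewrite ?set0I ?setTI//; first by left.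
  move=> [->|[->|[zs ->]]]; rewrite ?setI0 ?setIT//; first by left.
    by right; right; exists ys.
  have [yz|zy] := leqP (size ys) (size zs).
    by rewrite pi_cylI//; case: ifP => _; [right; right; exists zs|left].
  by rewrite setIC pi_cylI ?(ltnW zy)//; case: ifP => _; [right; right; exists ys|left].
- move=> X [->|[->|[ys ->]]]; rewrite ?measure0//= /mrestr ?setTI ?eta12//.
  by rewrite setIidl// eta12.
- by move=> _; rewrite /= /mrestr setTI.
Qed.

(** The pi-system consists of sets inside some [pi_cyl (Bn n) [::]]; these have finite mass and
    exhaust [Dstar], and the null complement of [Dstar] completes the cover. *)
Lemma quasi_process_unique A : measurable A -> eta1 A = eta2 A.
Proof.
move=> mA.
pose G : set (set (@Dspace S)) := [set A |
  A = ~` @Dstar S \/ exists2 n, <<s gen n >> A & A `<=` pi_cyl (Bn n) [::]].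
pose gk n : set (@Dspace S) := if n is k.+1 then pi_cyl (Bn k) [::] else ~` @Dstar S.
have Gpi n B ys : B `<=` Bn n -> finite_set B -> G (pi_cyl B ys).
  move=> BB fB; right; exists n; first exact: gen_pi_cyl.
  move=> C /[dup] /pi_cyl_Dstar[v iv ->] /(pi_cylP _ _ iv)[m [[x [vm Bx]] _] _].
  apply/pi_cylP => //; have [k fk] := first_entrance_ex (fBn n) iv vm (BB _ Bx).
  by exists k.
have pD n : pi_cyl (Bn n) [::] `<=` @Dstar S by move=> C [].
apply: (@g_sigma_algebra_measure_unique _ _ _ G _ gk) => //.
- move=> X [->|[n gX _]]; last exact: gen_measurable gX.
  by apply: measurableC; exact: measurable_Dstar.
- by move=> [|n]; [left|apply: (Gpi n)].
- apply/seteqP; split => // C _; have [[v [iv ->]]|nD] := pselect (Dstar C); last by exists 0%N.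
  have [m vm] := iv.1; case e : (v m) => [x|//].
  have : [set: S] x by []; rewrite -Bn_cover => -[n _ Bx].
  exists n.+1 => //; apply/pi_cylP => //.
  by have [k fk] := first_entrance_ex (fBn n) iv e Bx; exists k.
- have e0 n (X : set (@Dspace S)) : X `<=` pi_cyl (Bn n) [::] -> ~` @Dstar S `&` X = set0.
    by move=> XD; apply/seteqP; split => // C [nC /XD/pD].
  have G0 : G set0 by right; exists 0%N => //; apply: sub_sigma_algebra; left.
  move=> X Y [->|[n gX Xn]] [->|[k gY Yk]].
  + by left; rewrite setIid.
  + by rewrite (e0 k).
  + by rewrite setIC (e0 n).
  + right; have [nk|kn] := leqP n k.
      exists k; last by move=> C [_ /Yk].
      apply: (@measurableI _ (g_sigma_algebraType (gen k))) => //; exact: gen_le gX.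
    exists n; last by move=> C [/Xn].
    apply: (@measurableI _ (g_sigma_algebraType (gen n))) => //; exact: gen_le (ltnW kn) _ gY.
- move=> X [->|[n gX Xn]]; first by rewrite [LHS]eta1N [RHS]eta2N.
  exact: gen_agree gX Xn.
- by move=> [|n] //=; rewrite [ltLHS]eta1N.
- move: A mA; apply: smallest_sub; first exact: smallest_sigma_algebra.
  move=> _ [B [ys [fB ->]]]; apply: sub_sigma_algebra.
  by have [n Hn] := Bn_finite_cover Bn_incr Bn_cover fB; exact: (Gpi n).
Qed.

End quasi_process_uniqueness.

(** * From one-sided paths to classes modulo time shift *)

Section embedding.
Context {S : countType}.
Local Notation W := (@Wspace S).
Implicit Types (w : nat -> option S) (x y z : S) (r s t : seq S) (B : set S).

Lemma embW_neg w k : embW w (- k%:Z)%R = w k.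
Proof. by rewrite /embW oppr_le0 lez_nat leq0n abszN. Qed.

Lemma embW_pos w n : (0 < n)%R -> embW w n = None.
Proof. by rewrite /embW lt_def => /andP[/negPf n0 n1]; rewrite le_eqVlt n0 /= ltNge n1. Qed.

Lemma embW_Some w n x : embW w n = Some x -> exists2 k : nat, n = (- k%:Z)%R & w k = Some x.
Proof.
have [n0|n0] := leP n 0%R; last by rewrite embW_pos.
by move=> e; exists `|n|%N; [lia|rewrite -embW_neg -e; congr embW; lia].
Qed.

Lemma inD_embW w : inW w -> inD (embW w) <-> transW w.
Proof.
move=> [w0 aw]; split=> [[_ [_ tr]] x|tr].
  have [N HN] := tr [set x] (finite_set1 x).
  exists `|N|%N => k kN wk; apply: (HN (- k%:Z)%R _ x) => //; first by lia.
  by rewrite embW_neg.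
split; [|split].
- by exists 0%R; rewrite -oppr0 (embW_neg w 0).
- move=> a b c abc.
  case ea : (embW w a) => [x|//] _; case ec : (embW w c) => [y|//] _.
  have [i ai wi] := embW_Some ea; have [j cj wj] := embW_Some ec.
  have -> : b = (- `|b|%N%:Z)%R by lia.
  rewrite embW_neg => bN; have := absorbing_le aw (_ : `|b| <= i)%N bN.
  by rewrite wi => H; have : None = Some x by rewrite -H//; lia.
- move=> F fF; have /choice[N HN] := tr.
  exists (- (\max_(x <- elts F) N x)%N%:Z)%R => n nN x e Fx.
  have [k nk wk] := embW_Some e; apply: (HN x k _ wk).
  have xF : x \in elts F by rewrite in_fset_set// inE.
  have := @leq_bigmax_seq _ (elts F) xpredT N x xF isT.
  by rewrite nk lerN2 lez_nat in nN; move=> H; exact: leq_trans H nN.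
Qed.

(** The default [set0] is no shift class and lies in no [pi_cyl], so preimages of cylinders contain
    only transient paths of [inW]. *)
Definition to_quasi (w : W) : @Dspace S :=
  if `[< inW w /\ transW w >] then dclass (embW w) else set0.

Lemma to_quasi_in w : inW w -> transW w -> to_quasi w = dclass (embW w).
Proof. by move=> iw tw; rewrite /to_quasi asboolT. Qed.

(** Past its end, [l] counts as being at the cemetery, because an embedded path stops at time 0;
    [ys] may also stop before [l] does. *)
Definition fits (ys : seq (option S)) (l : seq S) :=
  forall i, (i < size ys)%N -> nth None ys i = nth None (map Some l) i.

Lemma cylW_nth x r w i : cylW x r w -> (i <= size r)%N -> w i = Some (nth x (rev (x :: r)) i).
Proof.
move=> [_ e] ir; have := congr1 (fun l => nth None l i) e.
by rewrite nth_mkseq// (nth_map x)// size_rev.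
Qed.

Lemma embW_cylW x r w i : cylW x r w ->
  embW w (- (size r)%:Z + i%:Z)%R = nth None (map Some (x :: r)) i.
Proof.
move=> cw; have [ir|ri] := leqP i (size r).
  have -> : (- (size r)%:Z + i%:Z)%R = (- (size r - i)%N%:Z)%R by lia.
  rewrite embW_neg (cylW_nth cw) ?leq_subr// nth_rev; last by rewrite /= ltnS leq_subr.
  by rewrite (nth_map x)//= subSS subKn.
by rewrite embW_pos ?nth_default ?size_map//; lia.
Qed.

Lemma absorbing_segment w k x : absorbing w -> w k = Some x ->
  exists2 r, size r = k & mkseq w k.+1 = map Some (rev (x :: r)).
Proof.
move=> aw wk.
have [t et] : exists t, mkseq w k = map Some (rev t).
  exists (rev (pmap id (mkseq w k))); rewrite revK.
  have : all isSome (mkseq w k).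
    apply/allP => _ /mapP[i + ->]; rewrite mem_iota /= add0n => km.
    case e : (w i) => //; have := absorbing_le aw (ltnW km) e; by rewrite wk.
  by elim: (mkseq w k) => //= -[a|//] l IH /= /IH <-.
have sm : size t = k by have := congr1 size et; rewrite size_mkseq size_map size_rev.
exists t => //.
by rewrite -addn1 mkseq_add et rev_cons map_rcons -cats1 /mkseq /= /wshift addn0 wk.
Qed.

Lemma to_quasi_pi_cyl B ys : to_quasi @^-1` (pi_cyl B ys) =
  (\bigcup_(k in [set k : S * seq S | B k.1 /\ fits ys (k.1 :: k.2)]) pastW B k.1 k.2)
  `&` transW.
Proof.
apply/seteqP; split=> w /=.
  rewrite /to_quasi; case: asboolP => [[iw tw]|_]; last first.
    by move=> [[v [[[n vn] _] e]]]; have := dclass_refl v; rewrite -e.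
  have iD := (inD_embW iw).2 tw.
  move=> /(pi_cylP _ _ iD)[n [[x [en Bx]] fn] sn]; split => //.
  have [k nk wk] := embW_Some en.
  have [r sr er] := absorbing_segment iw.2 wk.
  have cw : cylW x r w by split => //; rewrite sr.
  exists (x, r) => /=; [split=> //|split=> //].
    by move=> i iy; rewrite -sn// nk -sr -(embW_cylW _ cw).
  move=> j rj y wj; apply: (fn (- j%:Z)%R); first by rewrite nk; lia.
  by rewrite embW_neg.
move=> [[[x r] [/= Bx fx] [cw pw]] tw]; have iw := cw.1.
rewrite to_quasi_in//; apply/(pi_cylP _ _ ((inD_embW iw).2 tw)).
exists (- (size r)%:Z)%R; last by move=> i iy; rewrite (embW_cylW _ cw) fx.
split.
  exists x; split => //; have := embW_cylW 0 cw; by rewrite addr0.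
move=> m mr y em; have [k mk wk] := embW_Some em.
by apply: (pw k) => //; lia.
Qed.

Lemma measurable_to_quasi : measurable_fun setT to_quasi.
Proof.
apply: (@measurability _ _ W (@Dspace S) setT to_quasi (@Dgen S) erefl).
move=> _ [_ [B [ys [fB ->]]] <-]; rewrite setTI to_quasi_pi_cyl.
apply: measurableI; last exact: measurable_transW.
by apply: bigcup_countType_measurable => *; exact: measurable_pastW.
Qed.

Lemma measurable_TB0 B : measurable (TB0 B).
Proof.
rewrite (_ : TB0 B = @inW S `&` ((\bigcup_(x in B) [set w : nat -> option S | w 0%N = Some x]) `&`
   [set w : nat -> option S | forall k, (0 < k)%N -> forall x, w k = Some x -> ~ B x])).
  apply: measurableI; first exact: measurable_inW.
  apply: measurableI; last exact: measurable_avoid.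
  by apply: bigcup_countType_measurable => x _; exact: measurable_coord.
apply/seteqP; split=> w.
  by move=> [iw [[x [wx Bx]] H]]; split => //; split => //; exists x.
by move=> [iw [[x Bx wx] H]]; split => //; split => //; exists x.
Qed.

Lemma proj_preimageE B A :
  TB0 B `&` proj_preimage A = to_quasi @^-1` A `&` (TB0 B `&` transW).
Proof.
apply/seteqP; split=> w.
  move=> [Tw [iD Aw]]; have tw := (inD_embW Tw.1).1 iD.
  by split => //=; rewrite to_quasi_in//; exact: Tw.1.
move=> [/= + [Tw tw]]; rewrite to_quasi_in//; last exact: Tw.1.
by move=> Aw; split => //; split => //; apply/inD_embW => //; exact: Tw.1.
Qed.

Lemma cylW_head x r w : cylW x r w -> w 0%N = Some (last x r).
Proof.
by move=> /cylW_nth/(_ (leq0n _)) ->; rewrite lastI rev_rcons.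
Qed.

Lemma cylW_tail x r w i : cylW x r w -> (0 < i <= size r)%N ->
  exists2 a, a \in belast x r & w i = Some a.
Proof.
move=> cw /andP[i0 ir]; rewrite (cylW_nth cw ir) lastI rev_rcons.
case: i i0 ir => // i _ ir /=; exists (nth x (rev (belast x r)) i) => //.
by rewrite -mem_rev mem_nth// size_rev size_belast.
Qed.

(** The requirement that [B] is met at time 0 and not before splits at time [- size r]: from then on
    the word first hits [B] at its end, and the earlier past avoids [B] along with [B']. *)
Lemma TB0_pastW B B' x r w :
  TB0 B w /\ pastW B' x r w <-> first_hits B x r /\ pastW (B `|` B') x r w.
Proof.
split=> [[[iw [[y [wy By]] H]] [cw pw]]|[[lB Ab] [cw pw]]].
  split; [split|split => //].
  - by rewrite (cylW_head cw) in wy; case: wy => ->; exact: mem_set.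
  - apply/allP => a ab; apply/negP => /set_mem.
    have ia : (index a (rev (belast x r)) < size r)%N.
      by rewrite -[size r](size_belast x) -[size _]size_rev index_mem mem_rev.
    apply: (H (index a (rev (belast x r))).+1) => //.
    rewrite (cylW_nth cw)//= lastI rev_rcons /= nth_index// mem_rev//.
  - move=> j rj z wj [Bz|Bz]; last exact: (pw j rj z wj Bz).
    by apply: (H j _ z) => //; exact: leq_ltn_trans rj.
split; last by split => // j rj z wj Bz; apply: (pw j rj z wj); right.
split; first exact: cw.1; split.
  by exists (last x r); split; [exact: cylW_head|exact: set_mem].
move=> k k0 z wk Bz; have [kr|rk] := leqP k (size r).
  have [a ab wa] := cylW_tail cw (introT andP (conj k0 kr)).
  move/allP: Ab => /(_ _ ab)/negP; apply; apply/mem_set.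
  by move: wa; rewrite wk => -[<-].
by apply: (pw k rk z wk); left.
Qed.

(** The double complement is the form in which [measureI_null] discards the paths that are not
    transient. *)
Lemma TB0_pi_cyl B B' ys : to_quasi @^-1` (pi_cyl B' ys) `&` (TB0 B `&` transW) =
  (\bigcup_(k in [set k : S * seq S | B' k.1 /\ (first_hits B k.1 k.2 /\ fits ys (k.1 :: k.2))])
     pastW (B `|` B') k.1 k.2) `&` ~` ~` transW.
Proof.
rewrite setCK to_quasi_pi_cyl; apply/seteqP; split=> w.
  move=> [[[[x r] [/= Bx fx] pw] _] [Tw tw]]; split => //.
  by have [fh pw'] := (TB0_pastW B B' x r w).1 (conj Tw pw); exists (x, r).
move=> [[[x r] [/= Bx [fh fx]] pw] tw].
have [Tw pw'] := (TB0_pastW B B' x r w).2 (conj fh pw).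
by split => //; split => //; exists (x, r).
Qed.

Lemma pastW_disj B (P : set (S * seq S)) : (forall k, P k -> B k.1) ->
  trivIset P (fun k => pastW B k.1 k.2).
Proof.
move=> PB [x r] [x' r'] /PB/= Bx /PB/= Bx' [w [[cw pw] [cw' pw']]].
have H a s t : B a -> cylW a s w -> (forall j, (size t < j)%N -> forall y, w j = Some y -> ~ B y) ->
    ~ (size t < size s)%N.
  by move=> Ba [_ ca] pb ts; apply: (pb _ ts a) => //; exact: mkseq_last ca.
have ss : size r = size r'.
  case: (ltngtP (size r) (size r')) => // [|].
    by move/(H x' r' r Bx' cw' pw).
  by move/(H x r r' Bx cw pw').
have [_ e] := cw; have [_ e'] := cw'.
have /map_Some_inj/(congr1 rev) : map Some (rev (x :: r)) = map Some (rev (x' :: r')).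
  by rewrite -e -e' ss.
by rewrite !revK => -[-> ->].
Qed.

End embedding.

(** * The quasi-process of a Kuznetsov measure *)

Section quasi_process_of_kuznetsov.
Context {R : realType} {S : countType} (p : S -> S -> R) (d : S -> nat -> R).
Hypothesis q0 : forall x y, 0 <= qm p d x y.
Hypothesis goo : forall x y, gm p d x y < +oo.
Variable B : set S.
Hypothesis fB : finite_set B.
Hypothesis hgt0 : forall x, 0 < hitting p d B x.
Local Notation q := (qm p d).
Local Notation qc := (qchain p d).
Local Notation h := (hitting p d B).
Local Notation P_h := (ph p d B h).
Implicit Types (x y z : S) (r s t : seq S) (ys : seq (option S)).

Let hoo x : h x < +oo. Proof. exact: hitting_lty. Qed.
Let hE x : (fine (h x))%:E = h x.
Proof. by rewrite fineK// ge0_fin_numE ?hitting_ge0. Qed.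
Let hf0 x : (0 < fine (h x))%R. Proof. by rewrite fine_gt0// hgt0 hoo. Qed.
Let hn0 x : (fine (h x) != 0)%R. Proof. by rewrite gt_eqF. Qed.

Let hK x a : h x * (a / fine (h x))%:E = a%:E.
Proof. by rewrite -{1}[h x]hE -EFinM mulrC divfK. Qed.

Lemma Kext_ph_in x : B x -> Kext P_h (Some x) None = 1.
Proof.
by move=> Bx /=; rewrite esum1 ?sube0// => y _; rewrite /ph asboolT.
Qed.

Lemma Kext_ph_out x : ~ B x -> Kext P_h (Some x) None = 0.
Proof.
move=> nBx /=; under eq_esum => y _ do rewrite /ph asboolF// EFinM muleA hE.
rewrite esumZr ?lee_fin ?invr_ge0 ?ltW//; last by move=> y _; rewrite mule_ge0 ?hitting_ge0.
by rewrite -hitting_out// -hE -EFinM divff// subee.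
Qed.

(* h-transform: [h x] is the total q-weight of the paths from x stopped on first hitting B, so
   prescribing the beginning s of such a path costs exactly the P_h-probability of s. *)
Lemma first_hits_fits x (s : seq (option S)) :
  \esum_(r in [set r | first_hits B x r /\ fits s r]) qc x r =
  h x * chainw (Kext P_h) (Some x) s.
Proof.
elim: s x => [|b s IH] x.
  rewrite /= mule1; congr esum; apply/seteqP; split => r; first by case.
  by move=> fr; split.
have [Bx|nBx] := pselect (B x).
  have fn r : first_hits B x r -> r = [::].
    by case: r => // a r [_]; rewrite /avoids /= mem_set.
  rewrite hitting_in// mul1e [chainw _ _ _]/=.
  (* From a point of [B] the transformed chain goes to the cemetery and stays there, so the only
     continuations with mass are words of [None]. *)
  have cN l : chainw (Kext P_h) None l = (all (pred1 None) l)%:R%:E.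
    by elim: l => [|[a|] l IHl] //=; rewrite ?mul0e// mul1e IHl.
  have [aN|naN] := boolP (all (pred1 None) (b :: s)).
    rewrite (esum_single (x := [::])) //=.
    - move: aN => /= /andP[/eqP -> aN].
      by rewrite [X in X * _](Kext_ph_in Bx) cN aN mule1.
    - split; first by split => //=; exact: mem_set.
      move=> i ib; rewrite [RHS]nth_default//.
      by move/all_nthP: aN => /(_ None _ ib)/eqP.
    - by move=> r [/fn].
  rewrite (_ : [set r | _] = set0) ?esum_set0; last first.
    apply/seteqP; split => // r [/fn -> fr]; move/negP: naN; apply.
    by apply/(all_nthP None) => i ib; rewrite fr// nth_default.
  move: naN; case: b => [a _|/=]; first by rewrite /= /ph asboolT// mul0e.
  by move=> /negPf naN; rewrite cN naN mule0.
have nE r : first_hits B x r -> r <> [::].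
  by move=> [+ _] r0; rewrite r0 /= => /set_mem.
case: b => [y|].
  have phE : P_h x y = q x y * (fine (h y) / fine (h x))%:E by rewrite /ph asboolF.
  rewrite [chainw _ _ _]/= phE muleA.
  have -> : h x * (q x y * (fine (h y) / fine (h x))%:E) = q x y * h y by rewrite muleCA hK hE.
  rewrite -muleA -IH -esumZl//; last by move=> *; exact: qchain_ge0.
  apply: (esum_setbij (e := cons y)).
  - move=> r [[lr Ar] fr]; split.
      by split => //; rewrite /avoids /= memNset.
    by move=> [|i] //= iy; exact: fr.
  - by move=> r r' _ _ [].
  - move=> r [fh fr]; case: r fh fr => [/nE//|a r] [lr /= /andP[_ Ar]] fr.
    have [ya] := fr 0%N isT; subst a; exists r => //; split => // i iy.
    exact: (fr i.+1).
rewrite [chainw _ _ _]/= [X in _ * (X * _)](Kext_ph_out nBx) mul0e mule0.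
rewrite (_ : [set r | _] = set0) ?esum_set0//; apply/seteqP; split => // r [/nE r0 fr].
by case: r r0 fr => // a r _ /(_ 0%N isT).
Qed.

Variable nu : S -> R.
Hypothesis nuE : Q_excessive p d nu.
Variable K : {measure set (@Wspace S) -> \bar R}.
Hypothesis HK : is_Kuznetsov p d nu K.
Variable eta : {measure set (@Dspace S) -> \bar R}.
Hypothesis etaE : forall A, eta A = K (to_quasi @^-1` A `&` (TB0 B `&` transW)).

Let esc B' x := escape p d (B `|` B') nu x.
Let fBU B' : finite_set B' -> finite_set (B `|` B').
Proof. by move=> fB'; rewrite finite_setU. Qed.
Let esc0 B' x : finite_set B' -> (0 <= esc B' x)%R.
Proof. by move=> fB'; apply: escape_ge0 => //; exact: fBU. Qed.

(** A class of the cylinder comes from a past off [B] and [B'], the entrance point [x], and a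
    continuation [r] to the first hit of [B]; the mass is [escape] times [qchain]. *)
Lemma quasi_pi_cyl B' ys : finite_set B' ->
  eta (pi_cyl B' ys) = \esum_(x in B')
    ((esc B' x)%:E * \esum_(r in [set r | first_hits B x r /\ fits ys (x :: r)]) qc x r).
Proof.
move=> fB'; rewrite etaE TB0_pi_cyl measureI_null; first last.
- exact: (Kuz_transW q0 goo nuE.1 HK).
- by apply: measurableC; exact: measurable_transW.
- by apply: bigcup_countType_measurable => *; exact: measurable_pastW.
rewrite measure_bigcup_esum; first last.
- by apply: pastW_disj => -[x r] [Bx _]; right.
- by move=> *; exact: measurable_pastW.
under [RHS]eq_esum => x _.
  rewrite -esumZl ?lee_fin ?esc0//; last by move=> *; exact: qchain_ge0.
  over.
rewrite esum_esum; last by move=> *; rewrite mule_ge0 ?lee_fin ?esc0 ?qchain_ge0.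
rewrite (_ : [set k | _] = B' `*`` (fun x => [set r | first_hits B x r /\ fits ys (x :: r)])).
  apply: eq_esum => -[x r] _ /=.
  by rewrite (Kuz_pastW q0 goo _ _ (fBU fB') nuE HK).
by apply/seteqP; split => -[x r].
Qed.

Lemma quasi_H_is B' x : finite_set B' ->
  eta (H_is B' x) = if `[< B' x >] then (esc B' x)%:E * h x else 0.
Proof.
move=> fB'; rewrite H_isE quasi_pi_cyl//.
have F0 y r : fits [:: Some x] (y :: r) <-> y = x.
  by split=> [/(_ 0%N isT) [<-]//|-> [|]].
have n0 y : 0 <= (esc B' y)%:E * \esum_(r in [set r | first_hits B y r /\ fits [:: Some x] (y :: r)]) qc y r.
  by rewrite mule_ge0 ?lee_fin ?esc0// esum_ge0// => *; exact: qchain_ge0.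
case: asboolP => Bx; last first.
  rewrite esum1// => y By; rewrite (_ : [set r | _] = set0) ?esum_set0 ?mule0//.
  by apply/seteqP; split => // r [_ /F0 yx]; apply: Bx; rewrite -yx.
rewrite (esum_single (x := x))//; last first.
  move=> y _ yx; rewrite (_ : [set r | _] = set0) ?esum_set0 ?mule0//.
  by apply/seteqP; split => // r [_ /F0].
congr (_ * _); congr esum; apply/seteqP; split => r; first by case.
by move=> fh; split => //; exact/F0.
Qed.

(** By [first_hits_fits], the weights of the continuations from [x] are [h x] times the cylinder
    probabilities of the transformed chain, and [escape] times [h] is the entrance law. *)
Lemma quasi_process_of_Kuznetsov : quasi_process P_h eta.
Proof.
split.
  rewrite etaE (_ : _ `&` _ = set0) ?measure0//; apply/seteqP; split => // w [/= + [Tw tw]].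
  rewrite to_quasi_in//; last exact: Tw.1.
  by apply; exists (embW w); split => //; apply/inD_embW => //; exact: Tw.1.
move=> B' fB'.
have hit x : 0 <= (esc B' x)%:E * h x by rewrite mule_ge0 ?lee_fin ?esc0 ?hitting_ge0.
have nilE : eta (pi_cyl B' [::]) = \esum_(x in B') ((esc B' x)%:E * h x).
  rewrite quasi_pi_cyl//; apply: eq_esum => x _; congr (_ * _); congr esum.
  by apply/seteqP; split => r; [case|move=> fh; split].
split.
  rewrite DstarBE// nilE; apply: esum_fin => // x _.
  by rewrite -hE -EFinM ltry.
case=> [|[x|] ys].
- rewrite nilE [RHS]/= [LHS]esum_mkcond; apply: eq_esum => x _.
  by rewrite quasi_H_is.
- rewrite [RHS]/= quasi_H_is// quasi_pi_cyl//.
  have F0 y r : fits (Some x :: ys) (y :: r) <-> y = x /\ fits ys r.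
    split=> [fr|[-> fr] [|i] //=]; last exact: fr.
    split; first by have [] := fr 0%N isT.
    by move=> i iy; exact: (fr i.+1).
  case: asboolP => Bx; last first.
    rewrite mul0e esum1// => y By; rewrite (_ : [set r | _] = set0) ?esum_set0 ?mule0//.
    by apply/seteqP; split => // r [_ /F0[yx _]]; apply: Bx; rewrite -yx.
  rewrite (esum_single (x := x))//.
  + rewrite -muleA -first_hits_fits; congr (_ * _); congr esum.
    by apply/seteqP; split => r [fh fr]; split => //; [have /F0[] := fr|apply/F0].
  + by rewrite mule_ge0 ?lee_fin ?esc0// esum_ge0// => *; exact: qchain_ge0.
  + move=> y _ yx; rewrite (_ : [set r | _] = set0) ?esum_set0 ?mule0//.
    by apply/seteqP; split => // r [_ /F0[]].
- by rewrite pi_cyl_None measure0.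
Qed.

End quasi_process_of_kuznetsov.

(** * Occupation measures *)

Section integral_null.
Context d (T : measurableType d) (R : realType) (mu : {measure set T -> \bar R}).
Import HBNNSimple.

(* [occupation] reads a class through a representative picked by choice, so its measurability
   off [Dstar] is out of reach; it only has to agree with a good function off a null set. *)
Lemma ge0_integral_null_eq (N : set T) (f g : T -> \bar R) :
  measurable N -> mu N = 0 -> (forall x, 0 <= g x) -> (forall x, g x <= f x) ->
  (forall x, ~ N x -> f x = g x) -> \int[mu]_x f x = \int[mu]_x g x.
Proof.
move=> mN N0 g0 gf fg.
have f0 x : 0 <= f x by exact: le_trans (gf x).
rewrite !ge0_integralTE//; apply/eqP; rewrite eq_le; apply/andP; split; last first.
  apply: ereal_sup_le => _ [s sg <-]; exists s => // x; exact: le_trans (gf x).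
apply: ge_ereal_sup => _ [s sf <-]; apply: ereal_sup_ubound.
have mNC : measurable (~` N) by exact: measurableC.
have pE x : proj_nnsfun s mNC x = if x \in ~` N then s x else 0%R.
  by have := congr1 (fun u => u x) (@mrestrict _ _ _ s _ mNC); rewrite patchE => <-.
(* A simple function below [f] is cut to 0 on the null set: it then lies below [g] and keeps its
   integral. *)
exists (proj_nnsfun s mNC).
  move=> x; rewrite pE; case: ifPn => [/[!inE] nN|_]; last exact: g0.
  by rewrite -fg.
rewrite -integralT_nnsfun -[RHS]integralT_nnsfun.
rewrite [RHS](ge0_negligible_integral mN)//; last 2 first.
- exact/measurable_EFinP/measurable_funP.
- by move=> x _; rewrite lee_fin.
rewrite setTD [RHS]integral_mkcond; apply: eq_integral => x _.
by rewrite patchE pE; case: ifP.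
Qed.

End integral_null.

Section occupation_counts.
Context {S : countType}.
Implicit Types (v : int -> option S) (x : S) (k n : nat).

(** Visits to [x] are numbered by their delay [k] after the first visit, which is invariant under
    shifts; their number becomes a measurable function of the class. *)
Definition revisit x k : set (@Dspace S) :=
  \bigcup_(ys in [set ys | nth None ys k = Some x /\ size ys = k.+1]) pi_cyl [set x] ys.

Lemma measurable_revisit x k : measurable (revisit x k).
Proof.
apply: bigcup_countType_measurable => ys _; apply: measurable_pi_cyl; exact: finite_set1.
Qed.

Lemma revisitP x k v : inD v -> revisit x k (dclass v) <->
  exists2 n, first_entrance [set x] v n & v (n + k%:Z)%R = Some x.
Proof.
move=> iv; split=> [[ys [yk sy] /(pi_cylP _ _ iv)[n fn sn]]|[n fn vn]].
  by exists n => //; rewrite sn ?sy.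
exists (mkseq (fun i => v (n + i%:Z)%R) k.+1).
  by split; rewrite ?size_mkseq ?nth_mkseq.
apply/(pi_cylP _ _ iv); exists n => // i; rewrite size_mkseq => ik.
by rewrite nth_mkseq.
Qed.

Lemma revisit_Dstar x k : revisit x k `<=` @Dstar S.
Proof. by move=> C [ys _ []]. Qed.

Context {R : realType}.

Lemma revisit_count x v : inD v ->
  \esum_(k in [set k | revisit x k (dclass v)]) (1 : \bar R) =
  \esum_(n in [set n : int | v n = Some x]) 1.
Proof.
move=> iv; have [[n0 vn0]|nv] := pselect (exists n : int, v n = Some x); last first.
  have -> : [set k | revisit x k (dclass v)] = set0.
    apply/seteqP; split => // k /(revisitP _ _ iv)[n _ vn].
    by apply: nv; exists (n + k%:Z)%R.
  have -> : [set n : int | v n = Some x] = set0.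
    by apply/seteqP; split => // n vn; apply: nv; exists n.
  by rewrite !esum_set0.
have [m fm] := @first_entrance_ex _ [set x] _ _ _ (finite_set1 x) iv vn0 erefl.
have mE k : revisit x k (dclass v) <-> v (m + k%:Z)%R = Some x.
  rewrite (revisitP _ _ iv); split=> [[n fn]|vm]; last by exists m.
  by rewrite (first_entrance_uniq fm fn).
have ge (j : int) : v j = Some x -> (m <= j)%R.
  by move=> vj; rewrite leNgt; apply/negP => jm; exact: (fm.2 j jm x vj).
apply/esym; apply: (@esum_bij R _ _ _ _ (fun k : nat => (m + k%:Z)%R) (fun n : int => `|n - m|%N) (fun=> 1)).
- by move=> k /mE.
- by move=> j /= vj; apply/mE; rewrite -vj; congr v; have := ge j vj; lia.
- by move=> k _; lia.
- by move=> j /= vj; have := ge j vj; lia.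
Qed.

Lemma occupation_dclass x v : inD v ->
  @occupation R S x (dclass v) = \esum_(k in [set k | revisit x k (dclass v)]) 1.
Proof.
move=> iv; rewrite /occupation; set u := xget point (dclass v).
have vu : dclass v u by apply: (@xgetPex _ point (dclass v)); exists v; exact: dclass_refl.
by rewrite -(dclass_eq vu) revisit_count//; exact: inD_dclass vu iv.
Qed.

Lemma embW_count x (w : nat -> option S) :
  \esum_(n in [set n : int | embW w n = Some x]) (1 : \bar R) =
  \esum_(k in [set k | w k = Some x]) 1.
Proof.
apply: (@esum_bij R _ _ _ _ (fun k : nat => (- k%:Z)%R) (fun n : int => `|n|%N) (fun=> 1)).
- by move=> k /=; rewrite embW_neg.
- by move=> n /= /embW_Some[k -> wk]; rewrite abszN.
- by move=> k _; rewrite abszN.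
- by move=> n /= /embW_Some[k -> wk]; lia.
Qed.

End occupation_counts.

Section occupation_measure.
Context {R : realType} {S : countType} (p : S -> S -> R) (d : S -> nat -> R).
Hypothesis q0 : forall x y, 0 <= qm p d x y.
Hypothesis goo : forall x y, gm p d x y < +oo.
Variable B : set S.
Hypothesis fB : finite_set B.
Variable nu : S -> R.
Hypothesis nuE : Q_excessive p d nu.
Variable K : {measure set (@Wspace S) -> \bar R}.
Hypothesis HK : is_Kuznetsov p d nu K.
Variable eta : {measure set (@Dspace S) -> \bar R}.
Hypothesis etaE : forall A, eta A = K (to_quasi @^-1` A `&` (TB0 B `&` transW)).
Implicit Types (x : S) (w : nat -> option S).

(** The word from [x] to time 0 is a first hit of [B] of length [k], and the past contributes
    [escape]; [TB0_pastW] is applied with an empty second set. *)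
Let K_TB0_coord x k :
  K (TB0 B `&` transW `&` [set w | w k = Some x]) =
  \esum_(r in [set r | first_hits B x r /\ size r = k]) ((escape p d B nu x)%:E * qchain p d x r).
Proof.
rewrite (_ : _ `&` [set w | _] = (\bigcup_(r in [set r | first_hits B x r /\ size r = k]) pastW (B `|` set0) x r) `&` ~` ~` transW).
  rewrite measureI_null; first last.
  - exact: (Kuz_transW q0 goo nuE.1 HK).
  - by apply: measurableC; exact: measurable_transW.
  - by apply: bigcup_countType_measurable => *; exact: measurable_pastW.
  rewrite measure_bigcup_esum; first last.
  - move=> r r' [_ sr] [_ sr'] [w [[[_ e] _] [[_ e'] _]]].
    have /map_Some_inj/(congr1 rev) : map Some (rev (x :: r)) = map Some (rev (x :: r')).
      by rewrite -e -e' sr sr'.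
    by rewrite !revK => -[].
  - by move=> *; exact: measurable_pastW.
  by apply: eq_esum => r _; rewrite setU0 (Kuz_pastW q0 goo _ _ fB nuE HK).
rewrite setCK; apply/seteqP; split=> w.
  move=> [[Tw tw] wk]; split => //.
  have [r sr er] := absorbing_segment Tw.1.2 wk.
  have pw : pastW set0 x r w by split; [split; [exact: Tw.1|rewrite sr]|move=> j _ y _ []].
  by have [fh pw'] := (TB0_pastW B set0 x r w).1 (conj Tw pw); exists r.
move=> [[r [fh sr] pw] tw].
have [Tw pw'] := (TB0_pastW B set0 x r w).2 (conj fh pw).
split => //=; rewrite -sr; have [[_ e] _] := pw; exact: mkseq_last e.
Qed.

(** Add over [k] the mass of being at [x] at time [-k]: the continuations of all lengths sum to
    [hitting], the past gives [escape]. *)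
Lemma occupation_integral x :
  \int[eta]_C occupation x C = hitting p d B x * (escape p d B nu x)%:E.
Proof.
have etaN : eta (~` @Dstar S) = 0.
  rewrite etaE (_ : _ `&` _ = set0) ?measure0//; apply/seteqP; split => // w [/= + [Tw tw]].
  rewrite to_quasi_in//; last exact: Tw.1.
  by apply; exists (embW w); split => //; apply/inD_embW => //; exact: Tw.1.
pose g C : \bar R := \esum_(k in [set k | revisit x k C]) 1.
have g0 C : 0 <= g C by apply: esum_ge0.
have gN C : ~ Dstar C -> g C = 0.
  move=> nC; rewrite /g (_ : [set k | _] = set0) ?esum_set0//.
  by apply/seteqP; split => // k /revisit_Dstar.
have gD C : Dstar C -> occupation x C = g C.
  by move=> [v [iv ->]]; rewrite occupation_dclass.
rewrite (@ge0_integral_null_eq _ _ _ eta (~` @Dstar S) _ g)//; first last.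
- by move=> C /contrapT; exact: gD.
- move=> C; have [CD|nD] := pselect (Dstar C); first by rewrite gD.
  by rewrite gN// /occupation esum_ge0.
- by apply: measurableC; exact: measurable_Dstar.
rewrite /g integral_esum_indic; last by move=> k; exact: measurable_revisit.
under eq_esum => k _ do rewrite etaE.
have mD : measurable (TB0 B `&` transW).
  by apply: measurableI; [exact: measurable_TB0|exact: measurable_transW].
(* Back to an integral over one-sided paths, where counting visits by delay becomes counting them by
   time. *)
rewrite -integral_esum_indic; last first.
  move=> k; apply: measurableI => //; rewrite -[X in measurable X]setTI.
  by apply: measurable_to_quasi => //; exact: measurable_revisit.
rewrite (eq_integral (fun w : @Wspace S => \esum_(k in [set k | (TB0 B `&` transW `&` [set w | w k = Some x]) w]) 1)); last first.
  move=> w _; have [[Tw tw]|nD] := pselect ((TB0 B `&` transW) w); last first.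
    rewrite [X in esum X _ = _](_ : _ = set0); last by apply/seteqP; split => // k [].
    rewrite [X in _ = esum X _](_ : _ = set0); last by apply/seteqP; split => // k [].
    by rewrite !esum_set0.
  have iw := Tw.1; have iD := (inD_embW iw).2 tw.
  rewrite [X in _ = esum X _](_ : _ = [set k | w k = Some x]); last first.
    by apply/seteqP; split => k; [case|move=> wk; split].
  rewrite -embW_count -revisit_count//; congr esum; apply/seteqP; split => k.
    by move=> [/=]; rewrite to_quasi_in.
  by move=> rk; split => //=; rewrite to_quasi_in.
rewrite integral_esum_indic; last by move=> k; apply: measurableI => //; exact: measurable_coord.
under eq_esum => k _ do rewrite K_TB0_coord.
rewrite -(@esum_fiber _ _ _ (first_hits B x))//; last first.
  by move=> r _; rewrite mule_ge0 ?lee_fin ?qchain_ge0// escape_ge0.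
by rewrite esumZl ?lee_fin ?escape_ge0// 1?muleC// => *; exact: qchain_ge0.
Qed.

End occupation_measure.

(** * Quasi-processes from entrance laws *)

Section quasi_process_surjectivity.
Context {R : realType} {S : countType} (p : S -> S -> R) (d : S -> nat -> R).
Hypothesis q0 : forall x y, 0 <= qm p d x y.
Hypothesis goo : forall x y, gm p d x y < +oo.
Variable B : set S.
Hypothesis fB : finite_set B.
Hypothesis hgt0 : forall x, 0 < hitting p d B x.
Variable Bn : nat -> set S.
Hypothesis fBn : forall n, finite_set (Bn n).
Hypothesis Bn_incr : forall n, Bn n `<=` Bn n.+1.
Hypothesis Bn_cover : \bigcup_n Bn n = [set: S].
Hypothesis BBn : forall n, B `<=` Bn n.
Local Notation h := (hitting p d B).
Local Notation P_h := (ph p d B h).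

Let hoo x : h x < +oo. Proof. exact: hitting_lty. Qed.
Let hE x : (fine (h x))%:E = h x.
Proof. by rewrite fineK// ge0_fin_numE ?hitting_ge0. Qed.
Let hf0 x : (0 < fine (h x))%R. Proof. by rewrite fine_gt0// hgt0 hoo. Qed.
Let hn0 x : (fine (h x) != 0)%R. Proof. by rewrite gt_eqF. Qed.

(** The quotients of [h] telescope as long as the path is off [B] before its last point. *)
Lemma chainw_ph x t : avoids B (belast x t) ->
  chainw (Kext P_h) (Some x) (map Some t) =
  qchain p d x t * (fine (h (last x t)) / fine (h x))%:E.
Proof.
elim: t x => [|y t IH] x; first by rewrite /= divff// mule1.
rewrite /avoids /= => /andP[xB At]; rewrite -/(chainw _ _ _) IH//.
rewrite /ph asboolF; last by move=> /mem_set; exact/negP.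
rewrite muleACA -EFinM; congr (_ * _%:E).
by rewrite mulrC mulrA divfK.
Qed.

Lemma quasi_process_eq (eta1 eta2 : {measure set (@Dspace S) -> \bar R}) :
  quasi_process P_h eta1 -> quasi_process P_h eta2 ->
  (forall n x, eta1 (H_is (Bn n) x) = eta2 (H_is (Bn n) x)) ->
  forall A, measurable A -> eta1 A = eta2 A.
Proof.
move=> [N1 Q1] [N2 Q2] H12; apply: (quasi_process_unique fBn Bn_incr Bn_cover N1 N2).
  move=> n ys; rewrite (Q1 _ (fBn n)).2 (Q2 _ (fBn n)).2.
  by congr markov_cyl; apply/funext => x; exact: H12.
by move=> n; rewrite -DstarBE//; exact: (Q1 _ (fBn n)).1.
Qed.

Variable eta : {measure set (@Dspace S) -> \bar R}.
Hypothesis Qeta : quasi_process P_h eta.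

Let eta_fin n x : eta (H_is (Bn n) x) \is a fin_num.
Proof.
rewrite ge0_fin_numE//; apply: le_lt_trans (Qeta.2 _ (fBn n)).1.
rewrite DstarBE// H_isE; apply: le_measure; rewrite ?inE; try exact: measurable_pi_cyl.
by move=> C [CD [w [m [Cw [fw _]]]]]; split => //; exists w, m.
Qed.

(** The entrance into [Bn n] is expressed through the one into [Bn n.+1]: refine the cylinder, use
    the Markov property at the larger set and telescope [h]; the kernel [entrance] remains. *)
Lemma quasi_entrance_consistent : consistent_entrance_family p d Bn
  (fun n x => fine (eta (H_is (Bn n) x)) / fine (h x))%R.
Proof.
have H0 n x : ~ Bn n x -> eta (H_is (Bn n) x) = 0.
  by move=> nB; rewrite H_isE pi_cyl_notin// measure0.
split=> [n x|]; first by rewrite divr_ge0// ?fine_ge0// ltW.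
split=> [n|n y].
  rewrite [ltLHS](_ : _ = \esum_(x in Bn n) (fine (eta (H_is (Bn n) x)) / fine (h x))%:E).
    by apply: esum_fin => // x _; rewrite ?ltry// lee_fin divr_ge0// ?fine_ge0// ltW.
  rewrite [RHS]esum_mkcond; apply: eq_esum => x _; case: ifPn => // /negP xB.
  by rewrite H0 ?mul0r// => Bx; apply: xB; exact: mem_set.
have [By|nBy] := pselect (Bn n y); last by rewrite H0// mul0r indicE memNset// mul0e.
rewrite indicE mem_set// mul1e EFinM fineK//.
rewrite H_isE (pi_cyl_refine _ (fBn n.+1) (@Bn_incr n) By) measure_bigcup_esum; first last.
- exact: pi_cyl_refine_disj.
- by move=> u _; exact: measurable_pi_cyl.
(* The word [u] followed by [y] is reread as a start [x] with a tail [t] ending in [y], the shape of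
   the paths in [entrance]. *)
have -> : \esum_(u in avoids (Bn n)) eta (pi_cyl (Bn n.+1) (map Some u ++ [:: Some y])) =
    \esum_(k in [set: S] `*`` (fun x => [set t | last x t = y /\ avoids (Bn n) (belast x t)]))
      eta (pi_cyl (Bn n.+1) (map Some (k.1 :: k.2))).
  rewrite (esum_setbij (P := [set: S] `*`` (fun x => [set t | last x t = y /\ avoids (Bn n) (belast x t)])) (e := fun k => belast k.1 k.2)).
  - by apply: eq_esum => -[x t] [_ /= [lt At]]; rewrite -[Some x :: _]/(map Some (x :: t)) (lastI x t) map_rcons cats1 lt.
  - by move=> [x t] [_ []].
  - move=> [x t] [x' t'] [_ /= [lt _]] [_ /= [lt' _]] e.
    by have [-> ->] : x :: t = x' :: t' by rewrite !lastI lt lt' e.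
  - move=> u Au; case e : (rcons u y) => [|x t]; first by case: u {Au} e.
    have /rcons_inj[eu ey] : rcons u y = rcons (belast x t) (last x t) by rewrite e lastI.
    by exists (x, t) => //=; split => //; split => //; rewrite -eu.
rewrite -(@esum_esum _ _ _ _ _ (fun x t => eta (pi_cyl (Bn n.+1) (map Some (x :: t)))))//.
rewrite -esumZr ?lee_fin ?invr_ge0 ?ltW//; last by move=> *; exact: esum_ge0.
apply: eq_esum => x _; rewrite (entranceE q0).
rewrite -esumZr ?lee_fin ?invr_ge0 ?ltW// -esumZl; first last.
- by move=> *; exact: qchain_ge0.
- by rewrite lee_fin divr_ge0// ?fine_ge0// ltW.
apply: eq_esum => t [lt At]; rewrite (Qeta.2 _ (fBn n.+1)).2 [LHS]/=.
(* Paths off [Bn n] are off [B]; this is why the exhaustion must consist of sets containing [B]. *)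
rewrite -/(map Some t) -/(Kext _) chainw_ph; last first.
  by apply: sub_all At => z; apply: contra => /set_mem/(@BBn n)/mem_set.
rewrite lt -(fineK (eta_fin _ _)); move: (fine (eta _)) (qchain _ _ _ _) => a b.
rewrite muleA (muleAC a%:E) (muleAC (a%:E * _)) -!EFinM; congr (_%:E * _).
by rewrite -mulrA mulrAC divff// mul1r.
Qed.

Lemma quasi_process_surj : exists2 nu, Q_excessive p d nu &
  forall n x, eta (H_is (Bn n) x) = if `[< Bn n x >] then (escape p d (Bn n) nu x)%:E * h x else 0.
Proof.
have [nu nuE e] := entrance_family_surj q0 goo fBn Bn_incr Bn_cover quasi_entrance_consistent.
exists nu => // n x; case: asboolP => Bx; last by rewrite H_isE pi_cyl_notin// measure0.
have := congr1 (fun f => f n x) e; rewrite /entrance_family mem_set// => ->.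
by rewrite EFinM fineK// -muleA -{2}[h x]hE -EFinM mulVf// mule1.
Qed.

End quasi_process_surjectivity.

(** * Linearity of the Kuznetsov measure in [nu] *)

Section kuznetsov_linearity.
Context {R : realType} {S : countType} (p : S -> S -> R) (d : S -> nat -> R).
Hypothesis q0 : forall x y, 0 <= qm p d x y.
Hypothesis qoo : forall x y, qm p d x y < +oo.

Lemma measK_add (nu nu' : S -> R) y : (forall x, 0 <= nu x)%R -> (forall x, 0 <= nu' x)%R ->
  measK (fun x => nu x + nu' x)%R (qm p d) y = measK nu (qm p d) y + measK nu' (qm p d) y.
Proof.
move=> nu0 nu0'; rewrite /measK -esumD; try by move=> *; rewrite mule_ge0 ?lee_fin.
by apply: eq_esum => x _; rewrite EFinD ge0_muleDl ?lee_fin.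
Qed.

Lemma measK_scale (c : R) (nu : S -> R) y : (0 <= c)%R -> (forall x, 0 <= nu x)%R ->
  measK (fun x => c * nu x)%R (qm p d) y = c%:E * measK nu (qm p d) y.
Proof.
move=> c0 nu0; rewrite /measK -esumZl ?lee_fin//; last by move=> *; rewrite mule_ge0 ?lee_fin.
by apply: eq_esum => x _; rewrite EFinM -muleA.
Qed.

Lemma Q_excessive_add (nu nu' : S -> R) : Q_excessive p d nu -> Q_excessive p d nu' ->
  Q_excessive p d (fun x => nu x + nu' x)%R.
Proof.
move=> [n0 nE] [n0' nE']; split=> [x|y]; first by rewrite addr_ge0.
by rewrite measK_add// EFinD leeD.
Qed.

Lemma Q_excessive_scale (c : R) (nu : S -> R) : (0 <= c)%R -> Q_excessive p d nu ->
  Q_excessive p d (fun x => c * nu x)%R.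
Proof.
move=> c0 [n0 nE]; split=> [x|y]; first by rewrite mulr_ge0.
by rewrite measK_scale// EFinM; apply: lee_wpmul2l.
Qed.

Lemma Kuznetsov_add (nu nu' : S -> R) (K K' : {measure set (@Wspace S) -> \bar R}) :
  Q_excessive p d nu -> Q_excessive p d nu' ->
  is_Kuznetsov p d nu K -> is_Kuznetsov p d nu' K' ->
  is_Kuznetsov p d (fun x => nu x + nu' x)%R (measure_add K K').
Proof.
move=> nuE nuE' [KN [KP KM]] [KN' [KP' KM']]; split; [|split].
- by rewrite [LHS]measure_addE [X in X + _]KN [X in _ + X]KN' adde0.
- move=> x r; rewrite [LHS]measure_addE [X in X + _]KP [X in _ + X]KP' -ge0_muleDl ?nu_pot_ge0//.
  congr (_ * _); rewrite /nu_pot measK_add; [|exact: nuE.1|exact: nuE'.1].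
  have F : measK nu (qm p d) x \is a fin_num by exact: measK_fin.
  have F' : measK nu' (qm p d) x \is a fin_num by exact: measK_fin.
  rewrite -(fineK F) -(fineK F') /=.
  by rewrite -!EFinD opprD addrACA.
- move=> x r; rewrite [LHS]measure_addE [X in X + _]KM [X in _ + X]KM' -ge0_muleDl ?lee_fin ?nuE.1 ?nuE'.1//.
Qed.

Lemma Kuznetsov_scale (c : R) (c0 : (0 <= c)%R) (nu : S -> R)
    (K : {measure set (@Wspace S) -> \bar R}) : Q_excessive p d nu ->
  is_Kuznetsov p d nu K -> is_Kuznetsov p d (fun x => c * nu x)%R (mscale (NngNum c0) K).
Proof.
move=> nuE [KN [KP KM]]; have scE A : mscale (NngNum c0) K A = c%:E * K A by [].
split; [|split].
- by rewrite [LHS]scE [X in _ * X]KN mule0.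
- move=> x r; rewrite [LHS]scE [X in _ * X]KP muleA; congr (_ * _).
  rewrite /nu_pot measK_scale//; last exact: nuE.1.
  by rewrite EFinM muleBr// fin_num_adde_defl// fin_numN (measK_fin q0 nuE).
- by move=> x r; rewrite [LHS]scE [X in _ * X]KM muleA EFinM.
Qed.

End kuznetsov_linearity.

Theorem mainTheorem9 (R : realType) (S : countType)
  (p : S -> S -> R) (d : S -> nat -> R)
  (dO : measure_display) (O : measurableType dO) (P : S -> probability O R)
  (Nf : seq nat -> O -> nat) (Xf : seq nat -> O -> S)
  (B : set S) (Bn : nat -> set S) :
  stochastic p ->
  (forall x, nat_distribution (d x)) ->
  (forall x y, gm p d x y < +oo) ->
  (forall x, is_BMC p d (P x) Nf Xf x) ->
  norming_region p d B ->
  (forall n, finite_set (Bn n)) ->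
  (forall n, Bn n `<=` Bn n.+1) ->
  \bigcup_n Bn n = [set: S] ->
  let h := hfun P Nf Xf B in
  exists (F1 : (S -> R) -> S -> R)
         (F2 : (S -> R) -> {measure set (@Dspace S) -> \bar R})
         (F3 : (S -> R) -> nat -> S -> R),
    cone_iso (Q_excessive p d) (Ph_excessive p d B h) eq
      (fun nu1 nu2 x => nu1 x + nu2 x)%R (fun c nu x => c * nu x)%R
      (fun f g k => k = (fun x => f x + g x)%R)
      (fun c f g => g = (fun x => c * f x)%R) F1 /\
    cone_iso (Q_excessive p d) (quasi_process (ph p d B h))
      (fun e1 e2 => forall A, measurable A -> e1 A = e2 A)
      (fun nu1 nu2 x => nu1 x + nu2 x)%R (fun c nu x => c * nu x)%R
      (fun e1 e2 e => forall A, measurable A -> e A = e1 A + e2 A)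
      (fun c e1 e => forall A, measurable A -> e A = c%:E * e1 A) F2 /\
    cone_iso (Q_excessive p d) (consistent_entrance_family p d Bn) eq
      (fun nu1 nu2 x => nu1 x + nu2 x)%R (fun c nu x => c * nu x)%R
      (fun f g k => k = (fun n x => f n x + g n x)%R)
      (fun c f g => g = (fun n x => c * f n x)%R) F3 /\
    forall nu : S -> R, Q_excessive p d nu ->
      let mu := F1 nu in
      let eta := F2 nu in
      let mb := F3 nu in
      (exists K, is_Kuznetsov p d nu K) /\
      (* (i) and first half of (iv) *)
      (forall K, is_Kuznetsov p d nu K ->
         (forall A, measurable A -> eta A = K (TB0 B `&` proj_preimage A)) /\
         (forall n x, (mb n x)%:E = K (TB0 (Bn n) `&` [set w | w 0%N = Some x]))) /\
      (* (ii) *)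
      (forall x, (nu x)%:E =
         (if `[< B x >] then 0 else (mu x / fine (h x))%:E) +
         \esum_(z in B) (mu z)%:E * gm p d z x) /\
      (* (iii) *)
      (forall x, (mu x)%:E = \int[eta]_C occupation x C) /\
      (* (iv), second half *)
      (forall n, B `<=` Bn n ->
         forall x, (mb n x)%:E = ((fine (h x))^-1)%:E * eta (H_is (Bn n) x)) /\
      (* (v) *)
      (forall n y, Bn n y ->
         (nu y)%:E = \esum_(x in Bn n) (mb n x)%:E * gm p d x y /\
         (mb n y)%:E = (nu y)%:E - \esum_(x in Bn n) (nu x)%:E * Qreturn p d (Bn n) x y).
Proof.
move=> ps dd goo bmc [fB gB] fBn Bn_incr Bn_cover h.
have q0 x y : 0 <= qm p d x y.
  rewrite mule_ge0 ?lee_fin//; last by have [] := ps.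
  by apply: esum_ge0 => m _; rewrite lee_fin mulr_ge0//; have [] := dd x.
have -> : h = hitting p d B.
  by apply/funext => x; exact: (integral_numH ps dd (bmc x)).
rewrite {h}; set h := hitting p d B.
have hoo x : h x < +oo by exact: hitting_lty.
have hgt0 x : 0 < h x by apply: hitting_gt0.
have hB x : B x -> h x = 1 by exact: hitting_in.
have hn0 x : (fine (h x) != 0)%R by rewrite gt_eqF// fine_gt0// hgt0 hoo.
have hE x : (fine (h x))%:E = h x by rewrite fineK// ge0_fin_numE ?hoo// ltW.
have qoo x y : qm p d x y < +oo by exact: le_lt_trans (q_le_gm q0 x y) (goo x y).
(* The zero measure is a filler for [nu] that are not excessive. *)
have /choice[KK HKK] nu : exists K : {measure set (@Wspace S) -> \bar R},
    Q_excessive p d nu -> is_Kuznetsov p d nu K.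
  have [nuE|nuE] := pselect (Q_excessive p d nu); last by exists mzero.
  by have [K HK] := Kuznetsov_exists q0 qoo nuE; exists K.
have mD : measurable (TB0 B `&` transW).
  by apply: measurableI; [exact: measurable_TB0|exact: measurable_transW].
have /choice[F2 HF2] nu : exists eta : {measure set (@Dspace S) -> \bar R},
    forall A, eta A = KK nu (to_quasi @^-1` A `&` (TB0 B `&` transW)).
  by have [M HM] := pushforward_ex (mrestr (KK nu) mD) (@measurable_to_quasi S); exists M.
have mpre A : measurable A -> measurable (to_quasi @^-1` A `&` (TB0 B `&` transW)).
  move=> mA; apply: measurableI => //; rewrite -[X in measurable X]setTI.
  exact: measurable_to_quasi.
(* By uniqueness the chosen measure can be exchanged for any Kuznetsov measure of [nu]; additivity
   and homogeneity of [F2] follow by taking sums and multiples. *)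
have F2K nu (K : {measure set (@Wspace S) -> \bar R}) A : Q_excessive p d nu ->
    is_Kuznetsov p d nu K -> measurable A -> F2 nu A = K (to_quasi @^-1` A `&` (TB0 B `&` transW)).
  move=> nuE HK mA; rewrite HF2; apply: (Kuz_unique (HKK _ nuE) HK); exact: mpre.
have F2H nu B' x : Q_excessive p d nu -> finite_set B' -> F2 nu (H_is B' x) =
    if `[< B' x >] then (escape p d (B `|` B') nu x)%:E * h x else 0.
  by move=> nuE fB'; rewrite (quasi_H_is q0 goo fB nuE (HKK _ nuE) (HF2 nu)).
have F2Q nu : Q_excessive p d nu -> quasi_process (ph p d B h) (F2 nu).
  by move=> nuE; exact: (quasi_process_of_Kuznetsov q0 goo fB hgt0 nuE (HKK _ nuE) (HF2 nu)).
(* Along these unions the entrance laws of a quasi-process, divided by [h], form a consistent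
   family, and the set under [escape] in [F2H] is [Cn n] itself. *)
pose Cn n := B `|` Bn n.
have fCn n : finite_set (Cn n) by rewrite finite_setU.
have Cn_incr n : Cn n `<=` Cn n.+1 by move=> x [Bx|/Bn_incr]; [left|right].
have Cn_cover : \bigcup_n Cn n = [set: S].
  by apply/seteqP; split => // x; rewrite -Bn_cover => -[n _ Bx]; exists n => //; right.
have BCn n : B `<=` Cn n by move=> x; left.
have BUC n : B `|` Cn n = Cn n by rewrite setUA setUid.
exists (occupation_of p d B h), F2, (entrance_family p d Bn).
split; first exact: occupation_of_iso.
split.
  split; [exact: F2Q|split; [|split; [|split]]].
  - move=> nu nu' nuE nuE' e.
    (* Equal quasi-processes have equal entrance laws; dividing by [h] gives equal entrance families
       along [Cn], and these determine [nu]. *)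
    apply: (entrance_family_iso q0 goo fCn Cn_incr Cn_cover).2.1 => //.
    apply/funext => n; apply/funext => x; rewrite /entrance_family; case: ifPn => // /set_mem xC.
    have := e (H_is (Cn n) x); rewrite H_isE => /(_ (measurable_pi_cyl _ (fCn n))).
    rewrite -H_isE !F2H// asboolT// BUC => /(congr1 (fun u => u * ((fine (h x))^-1)%:E)).
    by rewrite -hE -!EFinM !mulfK// => -[].
  - move=> eta Qeta.
    have [nu nuE e] := quasi_process_surj q0 goo fB hgt0 fCn Cn_incr Cn_cover BCn Qeta.
    exists nu => //; apply: (quasi_process_eq fCn Cn_incr Cn_cover (F2Q _ nuE) Qeta) => n x.
    by rewrite F2H// e BUC.
  - move=> nu nu' nuE nuE' A mA.
    have K12 : is_Kuznetsov p d (fun x => nu x + nu' x)%R (measure_add (KK nu) (KK nu')).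
      exact: (Kuznetsov_add q0 nuE nuE' (HKK _ nuE) (HKK _ nuE')).
    have nuE2 := Q_excessive_add q0 nuE nuE'.
    by rewrite (F2K _ _ _ nuE2 K12 mA) [LHS]measure_addE !HF2.
  - move=> c nu c0 nuE A mA.
    have Kc : is_Kuznetsov p d (fun x => c * nu x)%R (mscale (NngNum c0) (KK nu)).
      exact: (Kuznetsov_scale q0 c0 nuE (HKK _ nuE)).
    have nuE2 := Q_excessive_scale q0 c0 nuE.
    by rewrite (F2K _ _ _ nuE2 Kc mA) HF2.
split; first exact: entrance_family_iso.
move=> nu nuE mu eta mb.
split; first by exists (KK nu); exact: HKK.
split.
  move=> K HK; split.
    by move=> A mA; rewrite proj_preimageE; exact: F2K.
  move=> n x; rewrite /mb /entrance_family; case: ifPn => xB.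
    rewrite -[LHS]mule1 -[1]/(qchain p d x [::]) -(Kuz_pastW q0 goo x [::] (fBn n) nuE HK).
    congr (K _); apply/seteqP; split=> w.
      move=> [cw pw]; have w0 := cylW_head cw; split=> //; split; first exact: cw.1.
      by split; [exists x; split => //; exact: set_mem|exact: pw].
    move=> [[iw [_ H]] /= w0]; split; last exact: H.
    by split => //; rewrite /mkseq /= w0.
  rewrite (_ : _ `&` _ = set0) ?measure0//; apply/seteqP; split => // w.
  by move=> [[_ [[y [w0 By]] _]] /=]; rewrite w0 => -[yx]; move/negP: xB; apply; rewrite -yx; exact: mem_set.
split; first by move=> x; exact: occupation_of_decomp.
split.
  move=> x; rewrite /mu /occupation_of EFinM hE; apply/esym.
  exact: (occupation_integral q0 goo fB nuE (HKK _ nuE) (HF2 nu)).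
split.
  move=> n BB x; rewrite F2H// /mb /entrance_family (setUidr BB).
  case: asboolP => Bx; last by rewrite memNset// mule0.
  by rewrite mem_set// -[X in _ = _ * (_ * X)]hE -!EFinM mulrCA mulVf// mulr1.
by move=> n y By; exact: entrance_family_gm.
Qed.
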